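(* Let $k\ge 2$ be an integer, let $\Omega\subset\mathbf{R}^2$ be a bounded region with $C^k$ boundary, and let $K$ be its double layer potential on $L^2(\partial\Omega)$, with ordered singular values $\alpha_j$ and ordered eigenvalues $\lambda_j$. Then for any $\alpha>-2k+3$, $$\alpha_j=o(j^{\alpha/2})\quad\text{and}\quad \lambda_j=o(j^{\alpha/2})\qquad\text{as } j\to\infty.$$
   Context: For a bounded region $\Omega\subset\mathbf{R}^2$ with (at least) $C^2$ boundary, the double layer potential is the compact operator $K:L^2(\partial\Omega)\to L^2(\partial\Omega)$, $(K\psi)(x)=\int_{\partial\Omega}\psi(y)\,\nu_yE(x,y)\,ds_y$, where $E(x,y)=\frac1\pi\log\frac{1}{|x-y|}$, $ds_y$ is the line element, and $\nu_y$ denotes the outer normal derivative on $\partial\Omega$ in the variable $y$. The eigenvalues of $K$, counted with multiplicity, are ordered by nonincreasing modulus $|\lambda_0|\ge|\lambda_1|\ge|\lambda_2|\ge\cdots$; it is assumed that there are infinitely many eigenvalues counted with multiplicity. The singular values of $K$ (eigenvalues of $(K^*K)^{1/2}$), counted with multiplicity, are ordered as $\alpha_1\ge\alpha_2\ge\cdots\ge 0$. *)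

(* Defs.v *)
From mathcomp Require Import all_boot all_order all_algebra.
From mathcomp Require Import all_classical all_reals all_analysis.
From mathcomp Require Export complex.
Import Order.TTheory GRing.Theory Num.Theory.
Import numFieldNormedType.Exports.

Set Implicit Arguments.
Unset Strict Implicit.
Unset Printing Implicit Defensive.

Local Open Scope ring_scope.
Local Open Scope classical_set_scope.
Local Open Scope complex_scope.
Local Open Scope card_scope.

(* Complex L^2(mu). As in the library's Lfun, its elements are represented by
   functions; two of them are the same vector when they agree mu-a.e. *)
Section L2.
Context {R : realType} {d : measure_display} {T : measurableType d}.
Variable mu : {measure set T -> \bar R}.
Implicit Types (f g : T -> R[i]) (A B : (T -> R[i]) -> (T -> R[i])).

Definition cintegral (D : set T) f : R[i] :=
  (\int[mu]_(x in D) complex.Re (f x))%R +i*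
  (\int[mu]_(x in D) complex.Im (f x))%R.

Definition L2 f : Prop :=
  (fun x => complex.Re (f x)) \in Lfun mu 2%:E /\
  (fun x => complex.Im (f x)) \in Lfun mu 2%:E.

Definition L2dot f g : R[i] := cintegral setT (fun x => f x * (g x)^*).

Definition bounded_operator A : Prop :=
  [/\ forall f, L2 f -> L2 (A f),
      forall f g, L2 f -> L2 g ->
        {ae mu, forall x, f x = g x} -> {ae mu, forall x, A f x = A g x},
      forall (c : R[i]) f g, L2 f -> L2 g ->
        {ae mu, forall x, A (fun y => c * f y + g y) x = c * A f x + A g x}
    & exists M : R, forall f, L2 f ->
        L2dot (A f) (A f) <= M%:C * L2dot f f].

Definition is_adjoint A B : Prop :=
  bounded_operator B /\
  forall f g, L2 f -> L2 g -> L2dot (A f) g = L2dot f (B g).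

(* B = A^(1/2); the inequality in R[i] says that the left member is a real
   number >= 0. *)
Definition is_sqrt_operator A B : Prop :=
  [/\ bounded_operator B,
      forall f, L2 f -> 0 <= L2dot (B f) f
    & forall f, L2 f -> {ae mu, forall x, B (B f) x = A f x}].

Definition free_family n (f : 'I_n -> T -> R[i]) : Prop :=
  forall c : 'I_n -> R[i],
    {ae mu, forall x, \sum_(i < n) c i * f i x = 0} -> forall i, c i = 0.

Definition generalized_eigenvector A (z : R[i]) f : Prop :=
  L2 f /\ exists m : nat,
    {ae mu, forall x, iter m (fun g y => A g y - z * g y) f x = 0}.

(* The algebraic multiplicity of z, i.e. the dimension of the union over m of
   ker (A - z)^m, is at least n. *)
Definition multiplicity_ge A (z : R[i]) (n : nat) : Prop :=
  exists f : 'I_n -> T -> R[i],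
    (forall i, generalized_eigenvector A z (f i)) /\ free_family f.

(* s enumerates eigenvalues with multiplicity by nonincreasing modulus. Every
   nonzero eigenvalue is listed exactly as often as its multiplicity; the value
   0, which can only come after all the nonzero ones, is listed at most as often
   as its multiplicity. So 0 is listed only if there are finitely many nonzero
   eigenvalues, and such an s exists (for a compact A) exactly when there are
   infinitely many eigenvalues counted with multiplicity. *)
Definition ordered_eigenvalues A (s : nat -> R[i]) : Prop :=
  [/\ forall j, Normc.normc (s j.+1) <= Normc.normc (s j),
      forall z, z != 0 -> forall n,
        (`I_n #<= [set j | s j = z]) <-> multiplicity_ge A z n
    & forall n, `I_n #<= [set j | s j = 0] -> multiplicity_ge A 0 n].

Definition ordered_singular_values A (s : nat -> R) : Prop :=
  (forall j, 0 <= s j) /\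
  exists B C, [/\ is_adjoint A B, is_sqrt_operator (fun f => B (A f)) C
                & ordered_eigenvalues C (fun j => (s j)%:C)].

End L2.

Section Plane.
Context {R : realType}.
Implicit Types (Omega U : set (R * R)) (p x y : R * R).

Definition dot x y : R := x.1 * y.1 + x.2 * y.2.

Definition enorm x : R := Num.sqrt (dot x x).

Definition boundary Omega : set (R * R) := closure Omega `\` interior Omega.

Definition bounded_region Omega : Prop :=
  [/\ Omega !=set0, open Omega, connected Omega & bounded_set Omega].

Definition Ck (k : nat) (g : R -> R) : Prop :=
  (forall i, (i < k)%N -> forall t, derivable (g^`(i)) t 1) /\
  continuous (g^`(k)).

(* In the orthonormal coordinates of axes e1, e2, the part of Omega lying in the
   open set U is the part of U strictly above the graph of g. *)
Definition graph_chart (k : nat) Omega U (e1 e2 : R * R) (g : R -> R) : Prop :=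
  [/\ open U,
      [/\ dot e1 e1 = 1, dot e2 e2 = 1 & dot e1 e2 = 0],
      Ck k g
    & Omega `&` U = [set x | U x /\ g (dot x e1) < dot x e2]].

Definition Ck_boundary (k : nat) Omega : Prop :=
  forall p, boundary Omega p ->
    exists U e1 e2 g, U p /\ graph_chart k Omega U e1 e2 g.

(* The outer unit normal on the boundary: e1 + g' e2 is tangent to the graph, and
   -e2 points out of Omega. Values of nu off the boundary are irrelevant. *)
Definition outer_unit_normal Omega (nu : R * R -> R * R) : Prop :=
  forall U e1 e2 g, graph_chart 1 Omega U e1 e2 g ->
  forall p, U p -> boundary Omega p ->
    [/\ dot (nu p) (nu p) = 1,
        dot (nu p) (e1 + derive1 g (dot p e1) *: e2) = 0
      & dot (nu p) e2 < 0].

(* The line element ds, as a Borel measure on the plane carried by the boundary: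
   ds = sqrt (1 + g'(t)^2) dt on each graph t |-> t e1 + g(t) e2. *)
Definition line_element Omega (ds : {measure set (R * R) -> \bar R}) : Prop :=
  ds (~` boundary Omega) = 0%E /\
  forall U e1 e2 g, graph_chart 1 Omega U e1 e2 g ->
  forall B, measurable B -> B `<=` U ->
    ds (B `&` boundary Omega) =
    (\int[lebesgue_measure]_(t in [set t | B (t *: e1 + g t *: e2)%R])
       (Num.sqrt (1 + derive1 g t ^+ 2))%:E)%E.

Definition log_kernel x y : R := pi^-1 * ln (enorm (x - y))^-1.

Definition double_layer Omega (ds : {measure set (R * R) -> \bar R})
    (nu : R * R -> R * R) (psi : R * R -> R[i]) (x : R * R) : R[i] :=
  cintegral ds (boundary Omega)
    (fun y => psi y * ('D_(nu y) (log_kernel x) y)%:C).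

End Plane.

(* Main.v *)
(* In a C^k chart the kernel of K is a quotient of divided differences.  By Taylor's
   formula it is, as a function of the parameter of x in an interval of length h and
   uniformly in y, within O(h^(k-2)) of a polynomial of bounded degree.  So with
   N = O(r) suitable boundary points z_j, every section K(x, .) is within O(r^-(k-2))
   of a combination of the sections K(z_j, .), and Bessel's inequality bounds the
   Hilbert-Schmidt norm of K on the orthogonal complement of these N sections by
   e = O(r^-(k-2)).
   The first n eigenvalues are the diagonal entries of the triangular matrix of K on
   a flag of generalized eigenvectors.  Bounding its determinant by |K|^N times the
   factor due to the orthogonal complement of the N constraints gives
   |lambda_n|^n <= |K|^N (e / sqrt(n - N))^(n - N).  For N about n/q with q large,
   lambda_n has every exponent of decay below (k - 2) + 1/2.
   The argument uses K only through the norms |K f|, hence it applies as well to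
   C = (K^* K)^(1/2), for which |C f| = |K f|. *)
From HB Require Import structures.
Require Import Defs.
From mathcomp Require Import all_boot all_order all_algebra finmap.
From mathcomp Require Import all_classical all_reals all_analysis.
From mathcomp Require qpoly.
From mathcomp Require Import measurable_realfun ring lra zify.
Import Order.TTheory GRing.Theory Num.Theory.
Import numFieldNormedType.Exports.
Set Implicit Arguments.
Unset Strict Implicit.
Unset Printing Implicit Defensive.
Local Open Scope classical_set_scope.
Local Open Scope ring_scope.

(** * Determinant bounds *)

Section DetBound.
Local Open Scope sesquilinear_scope.
Variable C : numClosedFieldType.

(** The two lost derivatives come from the second difference [g s - g t - g'(t) (s - t)] over
    [(s - t) ^+ 2]: in a chart the kernel is this quotient divided by [1 + q ^+ 2], up to a bounded
    factor, where [q] is the first difference quotient. The pole [t] may lie anywhere relative to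
    the interval of [s], so the approximating polynomial varies with [y]; interpolation at fixed
    nodes replaces it by one combination of sections that is valid for all [y] at once. The extra
    exponent 1/2 is due to the arithmetic-geometric mean inequality: a Hilbert-Schmidt norm [e]
    spread over [n - N] directions contributes [e / sqrt (n - N)] per direction. The [N] constrained
    directions contribute no decay, so an n-th root multiplies the exponent by [1 - N / n], about
    [1 - 1 / q]; the strict inequality assumed on the exponent absorbs this loss. Eigenvalues are
    counted with algebraic multiplicity, so there may be too few eigenvectors and a flag must be
    built from generalized ones. Its vectors are not orthogonal, which is why the determinant bound
    is needed relative to a Gram matrix. *)

Lemma trmxC_mul m n p (A : 'M[C]_(m, n)) (B : 'M[C]_(n, p)) :
  (A *m B)^t* = B^t* *m A^t*.
Proof. by rewrite trmx_mul map_mxM. Qed.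

Lemma mxtrace_mul_adjoint p n (X : 'M[C]_(p, n)) :
  \tr (X *m X^t*) = \sum_i \sum_j `|X i j| ^+ 2.
Proof.
apply: eq_bigr => i _; rewrite mxE; apply: eq_bigr => j _.
by rewrite !mxE normCK.
Qed.

(* Schur's inequality: the eigenvalues are the diagonal entries of a unitarily
   equivalent triangular matrix, which has the same Frobenius norm. *)
Lemma norm_det_le1 n (X : 'M[C]_n) : \tr (X *m X^t*) <= n%:R -> `|\det X| <= 1.
Proof.
case: n X => [|n] X hX; first by rewrite det_mx00 normr1.
have [P Pu /= Ptrig] := Schur X (ltn0Sn n).
rewrite /similar_to /= conjymx // in Ptrig.
set T := P *m X *m P^t* in Ptrig.
have PP : P^t* *m P = 1%:M by rewrite -invmx_unitary // mulVmx // unitarymx_unit.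
have XE : X = P^t* *m T *m P.
  by rewrite /T !mulmxA PP mul1mx -mulmxA PP mulmx1.
clearbody T.
have dT : \det X = \det T.
  have dP : \det (P^t*) * \det P = 1 by rewrite -det_mulmx PP det1.
  by rewrite XE -mulmxA !det_mulmx mulrCA dP mulr1.
have trT : \tr (T *m T^t*) = \tr (X *m X^t*).
  rewrite [in RHS]XE !trmxC_mul trmxCK !mulmxA -(mulmxA _ P) (unitarymxP Pu) mulmx1.
  by rewrite [RHS]mxtrace_mulC !mulmxA (unitarymxP Pu) mul1mx.
rewrite dT det_trig // normr_prod.
have := @leif_AGM C 'I_n.+1 predT (fun i => `|T i i| ^+ 2) (fun i _ => exprn_ge0 _ (normr_ge0 _)).
rewrite /= cardT size_enum_ord => -[hle _].
have s1 : (\sum_i `|T i i| ^+ 2) / n.+1%:R <= 1.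
  rewrite ler_pdivrMr ?ltr0n // mul1r; apply: le_trans hX.
  rewrite -trT mxtrace_mul_adjoint; apply: ler_sum => i _.
  by rewrite (bigD1 i) //= lerDl sumr_ge0 // => j _; rewrite exprn_ge0.
rewrite -(@expr_le1 _ 2) ?prodr_ge0 // -prodrXl.
apply: le_trans hle _; apply: exprn_ile1 => //.
by rewrite divr_ge0 ?ler0n ?sumr_ge0 // => j _; rewrite exprn_ge0.
Qed.

(** After dividing the rows along [U1] by [eta] and those along [U2] by [M], the matrix
    [D *m U *m B] has squared Frobenius norm at most its size, so its determinant has modulus at
    most 1. *)
Lemma norm_det_le_split p q (U1 : 'M[C]_(p, p + q)) (U2 : 'M[C]_(q, p + q))
    (B : 'M[C]_(p + q)) (M eta : C) :
  0 < M -> 0 < eta -> col_mx U1 U2 \is unitarymx ->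
  \tr (U1 *m B *m (U1 *m B)^t*) <= eta ^+ 2 * p%:R ->
  \tr (U2 *m B *m (U2 *m B)^t*) <= M ^+ 2 * q%:R ->
  `|\det B| <= eta ^+ p * M ^+ q.
Proof.
move=> M0 e0 Uu h1 h2.
set U : 'M[C]_(p + q) := col_mx U1 U2 in Uu.
pose D : 'M[C]_(p + q) := block_mx (eta^-1)%:M 0 0 (M^-1)%:M.
have dD : \det D = eta ^- p * M ^- q by rewrite det_ublock !det_scalar -!exprVn.
have DU : D *m U = col_mx (eta^-1 *: U1) (M^-1 *: U2).
  by rewrite mul_block_col !mul0mx addr0 add0r !mul_scalar_mx.
have nU : `|\det U| = 1.
  have : `|\det U| ^+ 2 = 1.
    rewrite normCK -[X in _ * X](_ : \det (U^t*) = _); last by rewrite det_map_mx det_tr.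
    by rewrite -det_mulmx (unitarymxP Uu) det1.
  by move/eqP; rewrite sqrp_eq1 // => /eqP.
have scaled m (s : C) (V : 'M[C]_(m, p + q)) : 0 < s ->
    \tr (V *m V^t*) <= s ^+ 2 * m%:R ->
    \tr ((s^-1 *: V) *m (s^-1 *: V)^t*) <= m%:R.
  move=> s0 hV; rewrite mxtrace_mul_adjoint.
  rewrite (_ : \sum_i _ = s ^- 2 * \tr (V *m V^t*)).
    by rewrite ler_pdivrMl // exprn_gt0.
  rewrite mxtrace_mul_adjoint mulr_sumr; apply: eq_bigr => i _.
  rewrite mulr_sumr; apply: eq_bigr => j _.
  by rewrite !mxE normrM exprMn normfV (gtr0_norm s0) exprVn.
have := @norm_det_le1 _ (D *m U *m B).
rewrite {1 2}DU mul_col_mx -!scalemxAl tr_col_mx map_row_mx mul_col_row mxtrace_block natrD.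
move=> /(_ (lerD (scaled _ _ _ e0 h1) (scaled _ _ _ M0 h2))).
rewrite !det_mulmx !normrM nU mulr1 dD normrM !normfV !normrX.
rewrite (gtr0_norm e0) (gtr0_norm M0) -invfM ler_pdivrMl ?mulr1 //.
by rewrite mulr_gt0 // exprn_gt0.
Qed.

(** [U1] is an orthonormal basis of the left kernel of [Phi], where the sharp bound [eta] holds;
    [U2] is one of the orthogonal complement, of dimension at most [N], where only the operator
    bound [M] is available. *)
Lemma norm_det_le_kernel n N (B : 'M[C]_n) (Phi : 'M[C]_(n, N)) (M eta : C) :
  (N <= n)%N -> 1 <= M -> 0 < eta -> eta <= 1 ->
  (forall v : 'rV_n, \tr (v *m B *m (v *m B)^t*) <= M ^+ 2 * \tr (v *m v^t*)) ->
  (forall p (W : 'M[C]_(p, n)), W *m Phi = 0 -> W *m W^t* = 1%:M ->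
     \tr (W *m B *m (W *m B)^t*) <= eta ^+ 2 * (n - N)%:R) ->
  `|\det B| <= M ^+ N * eta ^+ (n - N).
Proof.
move=> Nn M1 e0 e1 hM hW.
have [p [q [e [U1 [U2 [Uu U1P qN]]]]]] : exists p q (e : (p + q = n)%N)
   (U1 : 'M[C]_(p, n)) (U2 : 'M[C]_(q, n)),
   [/\ col_mx U1 U2 \is unitarymx, U1 *m Phi = 0 & (q <= N)%N].
  pose V := kermx Phi; pose V' := orthomx Num.Def.conjC (mx_of_hermitian (hermitian1mx n)) V.
  exists (\rank V), (\rank V'), (add_rank_ortho V).
  exists (schmidt (row_base V)), (schmidt (row_base V')).
  split; first exact: schmidt_complete_unitarymx.
    have /(submxMr Phi) : (schmidt (row_base V) <= V)%MS.
      by rewrite eqmx_schmidt_free ?row_base_free // eq_row_base.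
    by rewrite mulmx_ker => /submx0null.
  rewrite rank_ortho mxrank_ker subKn ?rank_leq_row //; exact: rank_leq_col.
have pN : (n - N <= p)%N by rewrite leq_subLR -e addnC leq_add2r.
subst n.
have [W11 W12 W22] : [/\ U1 *m U1^t* = 1%:M, U1 *m U2^t* = 0 & U2 *m U2^t* = 1%:M].
  move/unitarymxP: Uu; rewrite tr_col_mx map_row_mx mul_col_row.
  by rewrite scalar_mx_block => /eq_block_mx[-> -> _ ->].
have M0 : 0 < M by exact: lt_le_trans M1.
have := @norm_det_le_split p q U1 U2 B M eta M0 e0 Uu.
have h1 : \tr (U1 *m B *m (U1 *m B)^t*) <= eta ^+ 2 * p%:R.
  apply: le_trans (hW _ _ U1P W11) _.
  by rewrite ler_wpM2l ?ler_nat // exprn_ge0 // ltW.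
have h2 : \tr (U2 *m B *m (U2 *m B)^t*) <= M ^+ 2 * q%:R.
  rewrite -[q%:R](_ : \tr (U2 *m U2^t*) = _); last by rewrite W22 mxtrace1.
  rewrite !mxtrace_mul_adjoint mulr_sumr; apply: ler_sum => i _.
  have := hM (row i U2); rewrite !mxtrace_mul_adjoint !big_ord1 -row_mul.
  under eq_bigr do rewrite mxE.
  by under [X in _ <= _ * X]eq_bigr do rewrite mxE.
move=> /(_ h1 h2) /le_trans; apply.
(* Since [eta <= 1 <= M], the exponents [p >= n - N] and [q <= N] may be replaced by [n - N] and
   [N]. *)
rewrite mulrC ler_pM ?exprn_ge0 ?(ltW e0) ?(ltW M0) //.
  exact: ler_weXn2l.
by apply: ler_wiXn2l => //; exact: ltW.
Qed.

(* The Gram matrix is diagonalised by a unitary matrix; dividing by the square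
   roots of its eigenvalues reduces to the standard inner product. *)
Lemma norm_det_le_gram n N (B G : 'M[C]_n) (Phi : 'M[C]_(n, N)) (M eta : C) :
  (N <= n)%N -> 1 <= M -> 0 < eta -> eta <= 1 ->
  G^t* = G -> (forall v : 'rV_n, v != 0 -> 0 < \tr (v *m G *m v^t*)) ->
  (forall v : 'rV_n,
     \tr (v *m B *m G *m (v *m B)^t*) <= M ^+ 2 * \tr (v *m G *m v^t*)) ->
  (forall p (W : 'M[C]_(p, n)), W *m Phi = 0 -> W *m G *m W^t* = 1%:M ->
     \tr (W *m B *m G *m (W *m B)^t*) <= eta ^+ 2 * (n - N)%:R) ->
  `|\det B| <= M ^+ N * eta ^+ (n - N).
Proof.
move=> Nn M1 e0 e1 Gh Gpos hM hW.
have [S [Su GE]] : exists S : 'M[C]_n, S \in unitmx /\ G = S *m S^t*.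
  have /orthomx_spectralP : G \is normalmx by apply/normalmxP; rewrite Gh.
  set P := spectralmx G; set D := spectral_diag G => GE.
  have Pu : P \is unitarymx := spectral_unitarymx G.
  rewrite invmx_unitary // in GE.
  have Dpos i : 0 < D 0 i.
    have -> : D 0 i = \tr (row i P *m G *m (row i P)^t*).
      rewrite GE rowE trmxC_mul; clearbody P D; rewrite !mulmxA -(mulmxA _ P (P^t*)).
      rewrite (unitarymxP Pu) mulmx1 -(mulmxA _ P (P^t*)) (unitarymxP Pu) mulmx1.
      rewrite /mxtrace big_ord1 -rowE mxE (bigD1 i) //= big1 => [|j ji].
        by rewrite !mxE !eqxx mulr1n conjC1 mulr1 addr0.
      by rewrite !mxE eq_sym (negPf ji) mulr0n mul0r.
    apply: Gpos; apply/eqP => /(congr1 (fun v => v *m P^t*)).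
    rewrite -row_mul (unitarymxP Pu) mul0mx row1 => /rowP /(_ i).
    by rewrite !mxE !eqxx => /eqP; rewrite oner_eq0.
  exists (P^t* *m diag_mx (\row_i sqrtC (D 0 i))); split.
    rewrite unitmx_mul unitarymx_unit ?trmxC_unitary // unitmxE det_diag unitfE.
    by apply/prodf_neq0 => i _; rewrite mxE sqrtC_eq0 gt_eqF.
  rewrite [LHS]GE trmxC_mul trmxCK !mulmxA; congr (_ *m _).
  rewrite -!mulmxA; congr (_ *m _).
  apply/matrixP => i j; rewrite mul_diag_mx !mxE.
  have [->|ij] := eqVneq i j; last first.
    by rewrite !mulr0n rmorph0 mulr0.
  rewrite !mulr1n (CrealP _) ?ger0_real ?sqrtC_ge0 ?ltW //.
  by rewrite -expr2 sqrtCK.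
have Sadj : S^t* *m (invmx S)^t* = 1%:M by rewrite -trmxC_mul mulVmx // trmx1 map_mx1.
have key m (W : 'M[C]_(m, n)) : W *m invmx S *m (G *m (W *m invmx S)^t*) = W *m W^t*.
  rewrite GE trmxC_mul !mulmxA mulmxKV // -!mulmxA (mulmxA (S^t*)).
  by rewrite Sadj mul1mx.
have keyB m (W : 'M[C]_(m, n)) :
   W *m (invmx S *m B *m S) *m (W *m (invmx S *m B *m S))^t* =
   (W *m invmx S) *m B *m G *m ((W *m invmx S) *m B)^t*.
  have -> : W *m invmx S *m B = W *m (invmx S *m B *m S) *m invmx S.
    by rewrite !mulmxA mulmxK.
  by rewrite -!(mulmxA _ G) key.
have -> : \det B = \det (invmx S *m B *m S).
  rewrite !det_mulmx mulrAC -det_mulmx mulVmx // det1 mul1r //.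
apply: (@norm_det_le_kernel n N _ (invmx S *m Phi)) => //.
  by move=> v; rewrite keyB; apply: le_trans (hM _) _; rewrite -(mulmxA _ G) key.
move=> p W WP W1; rewrite keyB; apply: hW; first by rewrite -mulmxA.
by rewrite -(mulmxA _ G) key.
Qed.

End DetBound.

(** * Complex square-integrable functions *)

Section ComplexParts.
Local Open Scope complex_scope.
Local Open Scope ring_scope.
Variable R : rcfType.
Implicit Types a b : R[i].

Lemma cReM a b :
  complex.Re (a * b) = complex.Re a * complex.Re b - complex.Im a * complex.Im b.
Proof. by case: a; case: b. Qed.

Lemma cImM a b :
  complex.Im (a * b) = complex.Re a * complex.Im b + complex.Im a * complex.Re b.
Proof. by case: a; case: b. Qed.

Lemma cReD a b : complex.Re (a + b) = complex.Re a + complex.Re b.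
Proof. by case: a; case: b. Qed.

Lemma cImD a b : complex.Im (a + b) = complex.Im a + complex.Im b.
Proof. by case: a; case: b. Qed.

Lemma cReC a : complex.Re (a^*) = complex.Re a.
Proof. by case: a. Qed.

Lemma cImC a : complex.Im (a^*) = - complex.Im a.
Proof. by case: a. Qed.

Lemma mulcC a : a * a^* = (complex.Re a ^+ 2 + complex.Im a ^+ 2)%:C.
Proof. by apply/eqP; rewrite eq_complex cReM cImM cReC cImC /=; apply/andP; split; apply/eqP; ring. Qed.

End ComplexParts.

Section L2Theory.
Local Open Scope complex_scope.
Local Open Scope ring_scope.
Context {R : realType} {d : measure_display} {T : measurableType d}.
Variable mu : {measure set T -> \bar R}.
Implicit Types (f g h : T -> R[i]).

Definition cintegrable f : Prop :=
  mu.-integrable setT (EFin \o (fun x => complex.Re (f x))) /\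
  mu.-integrable setT (EFin \o (fun x => complex.Im (f x))).

Lemma Lfun2_lin (r : R) (u v : T -> R) : u \in Lfun mu 2%:E -> v \in Lfun mu 2%:E ->
  r *: u + v \in Lfun mu 2%:E.
Proof.
have p1 : (1 <= 2%:E :> \bar R)%E by rewrite lee_fin ler1n.
move=> uL vL; have /= := @Lfun_submod_closed _ T R mu _ p1.
by move=> [_ H]; exact: (H).
Qed.

Lemma L2_lin (c : R[i]) f g : L2 mu f -> L2 mu g -> L2 mu (fun x => c * f x + g x).
Proof.
have p1 : (1 <= 2%:E :> \bar R)%E by rewrite lee_fin ler1n.
move=> [f1 f2] [g1 g2]; split.
- rewrite (_ : (fun _ => _) = complex.Re c *: (fun x => complex.Re (f x)) +
     (- complex.Im c *: (fun x => complex.Im (f x)) + (fun x => complex.Re (g x)))).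
    by do 2!apply: Lfun2_lin => //.
  by apply/funext => x; rewrite cReD cReM !fctE -addrA; congr (_ + (_ + _)); rewrite -mulNr.
- rewrite (_ : (fun _ => _) = complex.Re c *: (fun x => complex.Im (f x)) +
     (complex.Im c *: (fun x => complex.Re (f x)) + (fun x => complex.Im (g x)))).
    by do 2!apply: Lfun2_lin => //.
  by apply/funext => x; rewrite cImD cImM !fctE -addrA.
Qed.

Lemma L2_0 : L2 mu (fun=> 0).
Proof.
have p1 : (1 <= 2%:E :> \bar R)%E by rewrite lee_fin ler1n.
by split; have [H _] := @Lfun_submod_closed _ T R mu _ p1; exact: H.
Qed.

Lemma L2_sum (I : Type) (r : seq I) (c : I -> R[i]) (f : I -> T -> R[i]) :
  (forall i, L2 mu (f i)) -> L2 mu (fun x => \sum_(i <- r) c i * f i x).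
Proof.
move=> fL; elim: r => [|i r ih].
  by rewrite (_ : (fun _ => _) = (fun=> 0)); [exact: L2_0|apply/funext => x; rewrite big_nil].
rewrite (_ : (fun _ => _) = (fun x => c i * f i x + \sum_(i <- r) c i * f i x)).
  exact: L2_lin.
by apply/funext => x; rewrite big_cons.
Qed.

Lemma cintegral_lin (c : R[i]) f g : cintegrable f -> cintegrable g ->
  cintegral mu setT (fun x => c * f x + g x) =
  c * cintegral mu setT f + cintegral mu setT g.
Proof.
move=> [f1 f2] [g1 g2].
have Z r (u : T -> R) : mu.-integrable setT (EFin \o u) ->
    mu.-integrable setT (EFin \o (fun x => r * u x)).
  by move=> hu; apply: (@integrableZl _ _ _ _ _ measurableT r _ hu).
have D (u v : T -> R) : mu.-integrable setT (EFin \o u) -> mu.-integrable setT (EFin \o v) ->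
    mu.-integrable setT (EFin \o (fun x => u x + v x)).
  by move=> hu hv; apply: (@integrableD _ _ _ _ _ measurableT _ _ hu hv).
apply/eqP; rewrite eq_complex cReD cImD cReM cImM /=; apply/andP; split; apply/eqP.
- under eq_Rintegral do rewrite cReD cReM -mulNr.
  by rewrite !RintegralD ?RintegralZl ?mulNr //; [exact: Z|exact: Z|apply: D; exact: Z].
- under eq_Rintegral do rewrite cImD cImM.
  by rewrite !RintegralD ?RintegralZl //; [exact: Z|exact: Z|apply: D; exact: Z].
Qed.

Lemma cintegral_conj f : cintegrable f ->
  cintegral mu setT (fun x => (f x)^*) = (cintegral mu setT f)^*.
Proof.
move=> [f1 f2]; rewrite /cintegral /=.
under eq_Rintegral do rewrite cReC.
under [X in _ +i* X]eq_Rintegral do rewrite cImC -mulN1r.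
by rewrite RintegralZl // mulN1r.
Qed.

Lemma L2_conj f : L2 mu f -> L2 mu (fun x => (f x)^*).
Proof.
move=> [f1 f2]; split.
  by rewrite (_ : (fun _ => _) = (fun x => complex.Re (f x))) //; apply/funext => x; rewrite cReC.
have p1 : (1 <= 2%:E :> \bar R)%E by rewrite lee_fin ler1n.
rewrite (_ : (fun _ => _) = - (fun x => complex.Im (f x))).
  exact: (Lfun_oppr_closed f2).
by apply/funext => x; rewrite cImC.
Qed.

Lemma L2_mul_cintegrable f g : L2 mu f -> L2 mu g -> cintegrable (fun x => f x * g x).
Proof.
move=> [f1 f2] [g1 g2]; split.
- rewrite (_ : _ \o _ = ((EFin \o ((fun x => complex.Re (f x)) \* (fun x => complex.Re (g x)))%R) \-
    (EFin \o ((fun x => complex.Im (f x)) \* (fun x => complex.Im (g x)))%R))%E).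
    by apply: integrableB => //; apply/Lfun1_integrable/Lfun2_mul_Lfun1.
  by apply/funext => x /=; rewrite cReM.
- rewrite (_ : _ \o _ = ((EFin \o ((fun x => complex.Re (f x)) \* (fun x => complex.Im (g x)))%R) \+
    (EFin \o ((fun x => complex.Im (f x)) \* (fun x => complex.Re (g x)))%R))%E).
    by apply: integrableD => //; apply/Lfun1_integrable/Lfun2_mul_Lfun1.
  by apply/funext => x /=; rewrite cImM.
Qed.

Lemma L2dot_cintegrable f g : L2 mu f -> L2 mu g -> cintegrable (fun x => f x * (g x)^*).
Proof. by move=> fL gL; apply: L2_mul_cintegrable => //; exact: L2_conj. Qed.

Lemma L2dot_linl (c : R[i]) f g h : L2 mu f -> L2 mu g -> L2 mu h ->
  L2dot mu (fun x => c * f x + g x) h = c * L2dot mu f h + L2dot mu g h.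
Proof.
move=> fL gL hL; rewrite /L2dot -cintegral_lin; [|exact: L2dot_cintegrable..].
by congr cintegral; apply/funext => x; rewrite mulrDl mulrA.
Qed.

Lemma L2dotC f g : L2 mu f -> L2 mu g -> L2dot mu g f = (L2dot mu f g)^*.
Proof.
move=> fL gL; rewrite /L2dot -cintegral_conj; last exact: L2dot_cintegrable.
by congr cintegral; apply/funext => x; rewrite rmorphM /= conjCK mulrC.
Qed.

Lemma L2dot_linr (c : R[i]) f g h : L2 mu f -> L2 mu g -> L2 mu h ->
  L2dot mu h (fun x => c * f x + g x) = c^* * L2dot mu h f + L2dot mu h g.
Proof.
move=> fL gL hL; rewrite (@L2dotC _ h) //; last exact: L2_lin.
by rewrite L2dot_linl // rmorphD rmorphM /= -!L2dotC.
Qed.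

Lemma L2dot0l g : L2 mu g -> L2dot mu (fun=> 0) g = 0.
Proof.
move=> gL; have e : L2dot mu (fun x => -1 * 0 + 0) g = 0.
  by rewrite L2dot_linl //; [rewrite mulN1r addNr|exact: L2_0..].
rewrite -[RHS]e (_ : (fun=> -1 * 0 + 0) = (fun=> 0 : R[i])) //.
by apply/funext => x; rewrite mulr0 addr0.
Qed.

Lemma L2dot_suml (I : Type) (r : seq I) (c : I -> R[i]) (f : I -> T -> R[i]) g :
  (forall i, L2 mu (f i)) -> L2 mu g ->
  L2dot mu (fun x => \sum_(i <- r) c i * f i x) g = \sum_(i <- r) c i * L2dot mu (f i) g.
Proof.
move=> fL gL; elim: r => [|i r ih].
  rewrite big_nil (_ : (fun _ => _) = (fun=> 0 : R[i])) ?L2dot0l //.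
  by apply/funext => x; rewrite big_nil.
rewrite big_cons -ih -L2dot_linl //; last exact: L2_sum.
rewrite (_ : (fun x => \sum_(j <- _) _) = (fun x => c i * f i x + \sum_(j <- r) c j * f j x)) //.
by apply/funext => x; rewrite big_cons.
Qed.

Lemma L2dot_sumr (I : Type) (r : seq I) (c : I -> R[i]) (f : I -> T -> R[i]) g :
  (forall i, L2 mu (f i)) -> L2 mu g ->
  L2dot mu g (fun x => \sum_(i <- r) c i * f i x) = \sum_(i <- r) (c i)^* * L2dot mu g (f i).
Proof.
move=> fL gL; rewrite (@L2dotC _ g) //; last exact: L2_sum.
rewrite L2dot_suml // rmorph_sum /=; apply: eq_bigr => i _.
by rewrite rmorphM /= -L2dotC.
Qed.

Lemma L2_measurable f : L2 mu f ->
  measurable_fun setT (fun x => complex.Re (f x)) /\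
  measurable_fun setT (fun x => complex.Im (f x)).
Proof. by move=> [/andP[+ _] /andP[+ _]]; rewrite !inE. Qed.

Lemma ae_eq_Rintegral (u v : T -> R) : measurable_fun setT u -> measurable_fun setT v ->
  {ae mu, forall x, u x = v x} -> (\int[mu]_x u x = \int[mu]_x v x)%R.
Proof.
move=> mu_ mv uv; congr fine; apply: ae_eq_integral => //.
- exact/measurable_EFinP.
- exact/measurable_EFinP.
- by apply: filterS uv => x -> _.
Qed.

Lemma ae_eq_cintegral f g : cintegrable f -> cintegrable g ->
  {ae mu, forall x, f x = g x} -> cintegral mu setT f = cintegral mu setT g.
Proof.
move=> [/measurable_int/measurable_EFinP f1 /measurable_int/measurable_EFinP f2].
move=> [/measurable_int/measurable_EFinP g1 /measurable_int/measurable_EFinP g2] fg.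
by congr (_ +i* _); apply: ae_eq_Rintegral => //; apply: filterS fg => x ->.
Qed.

Lemma L2dot_ae f f' g g' : L2 mu f -> L2 mu f' -> L2 mu g -> L2 mu g' ->
  {ae mu, forall x, f x = f' x} -> {ae mu, forall x, g x = g' x} ->
  L2dot mu f g = L2dot mu f' g'.
Proof.
move=> fL f'L gL g'L ff gg; apply: ae_eq_cintegral; [exact: L2dot_cintegrable..|].
by apply: filterS2 ff gg => x -> ->.
Qed.

(** A real-valued squared norm, so that estimates use the total order of [R] instead of the partial
    order of [R[i]]. *)
Definition sqnorm f : R := (\int[mu]_x (complex.Re (f x) ^+ 2 + complex.Im (f x) ^+ 2))%R.

Lemma L2dotE f : L2dot mu f f = (sqnorm f)%:C.
Proof.
rewrite /L2dot /cintegral /sqnorm; apply/eqP; rewrite eq_complex /=.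
apply/andP; split; apply/eqP; first by apply: eq_Rintegral => x _; rewrite mulcC.
under eq_Rintegral do rewrite mulcC /=.
by rewrite /Rintegral integral0.
Qed.

Lemma sqnorm_ge0 f : 0 <= sqnorm f.
Proof. by apply: Rintegral_ge0 => x _; rewrite addr_ge0 ?sqr_ge0. Qed.

Lemma sqnorm_integrable f : L2 mu f ->
  mu.-integrable setT (EFin \o (fun x => complex.Re (f x) ^+ 2 + complex.Im (f x) ^+ 2)).
Proof.
move=> [f1 f2]; apply: (@integrableD _ _ _ mu _ measurableT
  (EFin \o (fun x => complex.Re (f x) ^+ 2)) (EFin \o (fun x => complex.Im (f x) ^+ 2)));
exact: Lfun2_integrable_sqr.
Qed.

Lemma sqnorm_eq0 f : L2 mu f -> sqnorm f = 0 -> {ae mu, forall x, f x = 0}.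
Proof.
move=> fL s0.
have fi := sqnorm_integrable fL.
have fin := integral_fune_fin_num measurableT fi.
have /(ae_eq_integral_abs _ measurableT (measurable_int _ fi)) : (\int[mu]_x
    `|(EFin \o (fun x => complex.Re (f x) ^+ 2 + complex.Im (f x) ^+ 2)%R) x| = 0)%E.
  under eq_integral => x _ do
    rewrite /= ger0_norm ?addr_ge0 ?sqr_ge0 //.
  by rewrite -[LHS]fineK //; rewrite -[fine _]/(sqnorm f) s0.
apply: filterS => x /(_ I) [] /eqP; rewrite paddr_eq0 ?sqr_ge0 // !sqrf_eq0.
by move=> /andP[/eqP h1 /eqP h2]; apply/eqP; rewrite eq_complex h1 h2 !eqxx.
Qed.

Lemma L2dot_ge0 f : 0 <= L2dot mu f f.
Proof. by rewrite L2dotE lecR sqnorm_ge0. Qed.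

Lemma bessel p (u : 'I_p -> T -> R[i]) f : (forall i, L2 mu (u i)) -> L2 mu f ->
  (forall i j, L2dot mu (u i) (u j) = (i == j)%:R) ->
  \sum_i `|L2dot mu f (u i)| ^+ 2 <= L2dot mu f f.
Proof.
move=> uL fL uo; pose c i := L2dot mu f (u i).
pose s x := \sum_i c i * u i x.
have sL : L2 mu s by exact: L2_sum.
have su j : L2dot mu s (u j) = c j.
  rewrite L2dot_suml // (bigD1 j) //= uo eqxx mulr1 big1 ?addr0 // => i /negPf ij.
  by rewrite uo ij mulr0.
have ss : L2dot mu s s = \sum_i `|c i| ^+ 2.
  by rewrite [LHS]L2dot_sumr //; apply: eq_bigr => i _; rewrite su normCK mulrC.
have fs : L2dot mu f s = \sum_i `|c i| ^+ 2.
  by rewrite [LHS]L2dot_sumr //; apply: eq_bigr => i _; rewrite normCK mulrC.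
have sf : L2dot mu s f = \sum_i `|c i| ^+ 2.
  rewrite (L2dotC fL sL) fs rmorph_sum; apply: eq_bigr => i _ /=.
  by rewrite normCK rmorphM /= conjCK mulrC.
have : 0 <= L2dot mu (fun x => -1 * s x + f x) (fun x => -1 * s x + f x).
  exact: L2dot_ge0.
rewrite L2dot_linl //; last exact: L2_lin.
rewrite !L2dot_linr // rmorphN rmorph1 ss fs sf !mulN1r addNr oppr0 add0r.
by rewrite addrC subr_ge0.
Qed.

End L2Theory.

(** * Generalized eigenvectors *)

Section TriangularIteration.
Local Open Scope complex_scope.
Local Open Scope ring_scope.
Variables (F : fieldType) (p : nat).

(** For row vectors and a lower triangular matrix, the last nonzero coordinate receives nothing from
    the others: each step only multiplies it by the diagonal entry. *)
Lemma trig_iter_top (N : 'M[F]_p) (e : 'rV_p) (j : 'I_p) m :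
  is_trig_mx N -> (forall i : 'I_p, (j < i)%N -> e 0 i = 0) ->
  iter m (fun u => u *m N) e 0 j = e 0 j * N j j ^+ m /\
  (forall i : 'I_p, (j < i)%N -> iter m (fun u => u *m N) e 0 i = 0).
Proof.
move=> /is_trig_mxP Nt e0; elim: m => [|m [ih1 ih2]]; first by rewrite expr0 mulr1.
split=> [|i ji] /=.
  rewrite mxE (bigD1 j) //= ih1 big1 ?addr0 ?exprSr ?mulrA // => l lj.
  case: (ltnP j l) => [jl|]; first by rewrite ih2 ?mul0r.
  by rewrite leq_eqVlt val_eqE (negPf lj) /= => lj'; rewrite (Nt _ _ lj') mulr0.
rewrite mxE big1 // => l _; case: (ltnP j l) => [jl|lj]; first by rewrite ih2 ?mul0r.
by rewrite Nt ?mulr0 // (leq_ltn_trans lj).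
Qed.

(** The generalized kernel of [N] thus embeds into the coordinates whose diagonal entry is zero, so
    its dimension is at most the number of these entries. *)
Lemma trig_iter_eq0 (N : 'M[F]_p) (e : 'rV_p) m : is_trig_mx N ->
  iter m (fun u => u *m N) e = 0 -> (forall j, N j j = 0 -> e 0 j = 0) -> e = 0.
Proof.
move=> Nt em eN; apply/eqP/negPn/negP => /rV0Pn [i0 ei0].
have [j ej jmax] := @arg_maxnP _ i0 (fun i => e 0 i != 0) (fun i => i : nat) ei0.
have [|+ _] := @trig_iter_top N e j m Nt.
  move=> i ji; apply/eqP/negPn/negP => /jmax; rewrite /= leqNgt ji //.
rewrite em mxE => /esym/eqP; rewrite mulf_eq0 (negPf ej) /= expf_eq0 => /andP[_ /eqP].
by move/eN/eqP; rewrite (negPf ej).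
Qed.

End TriangularIteration.

Section EigenvalueChain.
Local Open Scope complex_scope.
Local Open Scope ring_scope.
Context {R : realType} {d : measure_display} {T : measurableType d}.
Variables (mu : {measure set T -> \bar R}) (A : (T -> R[i]) -> T -> R[i]).
Hypothesis bA : bounded_operator mu A.
Implicit Types (f g : T -> R[i]).

Lemma bounded_operator0 : {ae mu, forall x, A (fun=> 0) x = 0}.
Proof.
case: bA => _ _ Alin _.
apply: filterS (Alin (-1) _ _ (L2_0 mu) (L2_0 mu)) => x.
have -> : (fun _ : T => -1 * 0 + 0 : R[i]) = (fun=> 0).
  by apply/funext => y; rewrite mulr0 addr0.
by move=> ->; rewrite mulN1r addNr.
Qed.

Lemma bounded_operator_sum (I : Type) (r : seq I) (c : I -> R[i]) (f : I -> T -> R[i]) :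
  (forall i, L2 mu (f i)) ->
  {ae mu, forall x, A (fun y => \sum_(i <- r) c i * f i y) x = \sum_(i <- r) c i * A (f i) x}.
Proof.
move=> fL; elim: r => [|i r ih].
  apply: filterS bounded_operator0 => x.
  have -> : (fun y : T => \sum_(i <- nil) c i * f i y) = (fun=> 0).
    by apply/funext => y; rewrite big_nil.
  by rewrite big_nil.
have -> : (fun y : T => \sum_(i <- cons i r) c i * f i y) =
    (fun y => c i * f i y + \sum_(i <- r) c i * f i y).
  by apply/funext => y; rewrite big_cons.
case: bA => _ _ Alin _.
apply: filterS2 ih (Alin (c i) _ _ (fL i) (L2_sum r c fL)) => x ih ->.
by rewrite big_cons ih.
Qed.

Definition comb p (v : nat -> T -> R[i]) (e : 'rV[R[i]]_p) : T -> R[i] :=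
  fun x => \sum_(l < p) e 0 l * v l x.

Lemma comb_L2 p v (e : 'rV_p) : (forall l, L2 mu (v l)) -> L2 mu (comb v e).
Proof. by move=> vL; exact: L2_sum. Qed.

Lemma comb_sum p r v (c : 'rV_r) (E : 'M[R[i]]_(r, p)) x :
  \sum_i c 0 i * comb v (row i E) x = comb v (c *m E) x.
Proof.
rewrite /comb; under eq_bigr do rewrite mulr_sumr.
rewrite exchange_big; apply: eq_bigr => l _ /=; rewrite mxE mulr_suml.
by apply: eq_bigr => i _; rewrite mxE mulrA.
Qed.

(* A flag of invariant subspaces, given by a free family v on which A acts
   through the lower triangular matrix b. *)
Definition chain p (v : nat -> T -> R[i]) (b : nat -> nat -> R[i]) : Prop :=
  [/\ forall l, L2 mu (v l),
      forall l, (l < p)%N -> {ae mu, forall x, A (v l) x = \sum_(i < p) b l i * v i x},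
      forall l i, (l < i)%N -> b l i = 0
    & forall e : 'rV_p, {ae mu, forall x, comb v e x = 0} -> e = 0].

Definition chain_mx p (b : nat -> nat -> R[i]) : 'M[R[i]]_p := \matrix_(l, i) b l i.

Lemma chain_mx_trig p v b : chain p v b -> is_trig_mx (chain_mx p b).
Proof. by case=> _ _ b0 _; apply/is_trig_mxP => i j ij; rewrite mxE b0. Qed.

Lemma chain_act p v b (e : 'rV_p) f : chain p v b -> L2 mu f ->
  {ae mu, forall x, f x = comb v e x} ->
  {ae mu, forall x, A f x = comb v (e *m chain_mx p b) x}.
Proof.
move=> [vL vA _ _] fL fe; case: bA => _ Aae _ _.
have := Aae _ _ fL (comb_L2 e vL) fe.
have h2 : {ae mu, forall x, forall l : 'I_p, A (v l) x = \sum_(i < p) b l i * v i x}.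
  by apply: filter_forall => l; exact: vA.
have := @bounded_operator_sum _ (index_enum 'I_p) (fun l => e 0 l) (fun l => v l) (fun l => vL l).
apply: filterS3 h2 => x h2 h3 ->; rewrite h3.
rewrite -comb_sum; apply: eq_bigr => l _; congr (_ * _).
by rewrite h2; apply: eq_bigr => i _; rewrite !mxE.
Qed.

Definition shifted (z : R[i]) f : T -> R[i] := fun y => A f y - z * f y.

Lemma shifted_L2 z f : L2 mu f -> L2 mu (shifted z f).
Proof.
move=> fL; case: bA => AL _ _ _.
rewrite (_ : shifted z f = fun x => (- z) * f x + A f x).
  by apply: L2_lin => //; exact: AL.
by apply/funext => x; rewrite /shifted mulNr addrC.
Qed.

Lemma iter_shifted_L2 z f m : L2 mu f -> L2 mu (iter m (shifted z) f).
Proof. by move=> fL; elim: m => // m ih /=; exact: shifted_L2. Qed.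

Lemma chain_shifted p v b z (e : 'rV_p) f m : chain p v b -> L2 mu f ->
  {ae mu, forall x, f x = comb v e x} ->
  {ae mu, forall x, iter m (shifted z) f x =
     comb v (iter m (fun u => u *m (chain_mx p b - z%:M)) e) x}.
Proof.
move=> vc fL fe; elim: m => //= m ih.
apply: filterS2 (chain_act vc (iter_shifted_L2 z m fL) ih) ih => x h1 h2.
rewrite {1}/shifted h1 h2 mulmxBr mul_mx_scalar /comb mulr_sumr -sumrB.
by apply: eq_bigr => l _; rewrite [in RHS]mxE [in X in _ = (_ + X) * _]mxE [in X in _ = (_ + - X) * _]mxE mulrBl mulrA.
Qed.

Definition in_span p (v : nat -> T -> R[i]) f : Prop :=
  exists e : 'rV_p, {ae mu, forall x, f x = comb v e x}.

(** A dimension count: if the span contained [r] free generalized eigenvectors, their coordinate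
    rows would be killed by a power of the chain matrix minus [z], whose generalized kernel is no
    larger than the number of diagonal entries equal to [z]. *)
Lemma generalized_not_in_span p v b z r : chain p v b ->
  (count_mem z [seq b l l | l <- iota 0 p] < r)%N -> multiplicity_ge mu A z r ->
  exists f, [/\ L2 mu f, ~ in_span p v f &
    exists m, {ae mu, forall x, iter m (shifted z) f x = 0}].
Proof.
move=> vc rlt [f [fgen ffree]]; apply: contrapT => noex.
have fspan i : in_span p v (f i).
  apply: contrapT => nf; apply: noex; exists (f i).
  by have [fL [m fm]] := fgen i; split => //; exists m.
have /choice[e fe] := fspan.
have /choice[m fm] : forall i, exists m, {ae mu, forall x, iter m (shifted z) (f i) x = 0}.
  by move=> i; have [] := fgen i.
have [vL _ _ vfree] := vc.
set N := chain_mx p b - z%:M.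
have Nt : is_trig_mx N.
  apply/is_trig_mxP => i j ij; rewrite !mxE.
  have /is_trig_mxP /(_ i j ij) := chain_mx_trig vc; rewrite mxE => ->.
  by rewrite -val_eqE /= (ltn_eqF ij) mulr0n subr0.
have em i : iter (m i) (fun u => u *m N) (e i) = 0.
  apply: vfree; have [fL _] := fgen i.
  by apply: filterS2 (fm i) (chain_shifted z (m i) vc fL (fe i)) => x -> <-.
(* A common exponent that kills all the rows [e i]. *)
pose M := (\max_i m i)%N.
have iter0 k : iter k (fun u : 'rV_p => u *m N) 0 = 0.
  by elim: k => //= k ->; rewrite mul0mx.
have eM i : iter M (fun u => u *m N) (e i) = 0.
  by rewrite -(subnK (leq_bigmax i : (m i <= M)%N)) iterD em iter0.
pose J := [set l : 'I_p | b l l == z]%SET.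
have Jr : (#|J| < r)%N.
  apply: leq_ltn_trans rlt; rewrite count_map -val_enum_ord count_map enumT cardsE cardE.
  by rewrite /enum_mem size_filter; apply: sub_count => l.
pose E : 'M[R[i]]_(r, p) := \matrix_i e i.
pose EJ : 'M[R[i]]_(r, #|J|) := \matrix_(i, k) e i 0 (enum_val k).
(* [EJ] keeps only the coordinates with diagonal entry [z]; it has fewer columns than rows, so some
   nontrivial combination of the [e i] vanishes on all of them. *)
have : kermx EJ != 0.
  rewrite -mxrank_eq0 mxrank_ker subn_eq0 -ltnNge.
  exact: leq_ltn_trans (rank_leq_col _) Jr.
move=> /rowV0Pn [c /sub_kermxP cE c0].
have cEM : iter M (fun u => u *m N) (c *m E) = 0.
  have -> : iter M (fun u => u *m N) (c *m E) = c *m \matrix_i iter M (fun u => u *m N) (e i).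
    elim: (M) => [|k ih] //=; rewrite ih -mulmxA; congr (_ *m _).
    by apply/row_matrixP => i; rewrite row_mul !rowK.
  by rewrite (_ : \matrix_i _ = 0) ?mulmx0 //; apply/row_matrixP => i; rewrite rowK eM row0.
have cE0 : c *m E = 0.
  apply: (trig_iter_eq0 Nt cEM) => j; rewrite !mxE eqxx mulr1n => /eqP; rewrite subr_eq0 => bj.
  have jJ : j \in J by rewrite inE.
  move/rowP: cE => /(_ (enum_rank_in jJ j)); rewrite !mxE => cE.
  rewrite -[RHS]cE; apply: eq_bigr => i _.
  by rewrite !mxE enum_rankK_in.
case/negP: c0; apply/eqP/rowP => i; rewrite mxE; move: i; apply: (ffree (fun i => c 0 i)).
have : {ae mu, forall x, forall i, f i x = comb v (e i) x} by exact: filter_forall.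
apply: filterS => x fx.
transitivity (comb v (c *m E) x); last by rewrite cE0 /comb big1 // => l _; rewrite mxE mul0r.
by rewrite -comb_sum; apply: eq_bigr => i _; rewrite rowK fx.
Qed.

(** Among the iterates of [A - z] on a generalized eigenvector outside the span, the new vector [w]
    is the last one still outside: [A w - z w] is then in the span, so the new row is triangular
    with diagonal entry [z]. *)
Lemma chain_extend p v b z r : chain p v b ->
  (count_mem z [seq b l l | l <- iota 0 p] < r)%N -> multiplicity_ge mu A z r ->
  exists v' b', [/\ chain p.+1 v' b', b' p p = z & forall l, (l < p)%N -> b' l l = b l l].
Proof.
move=> vc rlt zr.
have [f [fL fns [m fm]]] := generalized_not_in_span vc rlt zr.
have [vL vA b0 vfree] := vc.
have span0 : in_span p v (iter m (shifted z) f).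
  by exists 0; apply: filterS fm => x ->; rewrite /comb big1 // => l _; rewrite mxE mul0r.
(* Descend from the exponent [m], whose iterate is in the span, to the first exponent whose iterate
   is not. *)
have [w [wL wns [e we]]] : exists w, [/\ L2 mu w, ~ in_span p v w & in_span p v (shifted z w)].
  elim: m span0 {fm} => [|m ih] //= sp.
  case: (pselect (in_span p v (iter m (shifted z) f))) => [/ih //|nsp].
  by exists (iter m (shifted z) f); split => //; exact: iter_shifted_L2.
pose v' l := if l == p then w else v l.
pose b' l i : R[i] := if l == p then (if i == p then z else
   if insub i is Some i' then e 0 (i' : 'I_p) else 0) else if i == p then 0 else b l i.
have v'E x (c : 'I_p -> R[i]) : \sum_(l < p) c l * v' l x = \sum_(l < p) c l * v l x.
  by apply: eq_bigr => l _; rewrite /v' ltn_eqF.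
exists v', b'; split; last 2 first.
- by rewrite /b' !eqxx.
- by move=> l lp; rewrite /b' ltn_eqF.
split.
- by move=> l; rewrite /v'; case: ifP.
- move=> l; rewrite ltnS leq_eqVlt => /orP[/eqP ->|lp].
    apply: filterS we => x; rewrite /shifted => /eqP; rewrite subr_eq => /eqP h.
    rewrite big_ord_recr /= {1 3}/v' /b' !eqxx h; congr (_ + _).
    rewrite v'E; apply: eq_bigr => i _; rewrite ltn_eqF //.
    by rewrite valK.
  apply: filterS (vA l lp) => x; rewrite {1}/v' (ltn_eqF lp) => ->.
  rewrite big_ord_recr /= {2}/b' eqxx (ltn_eqF lp) mul0r addr0 v'E.
  by apply: eq_bigr => i _; rewrite /b' !ltn_eqF.
- move=> l i li; rewrite /b'; case: eqP => [lp|_].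
    rewrite gtn_eqF -?lp // insubF //; apply/negbTE; rewrite -leqNgt -lp ltnW //.
  by case: ifP => // _; exact: b0.
- move=> c; rewrite /comb => c0.
  have cp : c 0 ord_max = 0.
    apply/eqP/negPn/negP => cp; apply: wns.
    exists (\row_l (- (c 0 ord_max)^-1 * c 0 (widen_ord (leqnSn p) l))).
    apply: filterS c0 => x; rewrite big_ord_recr /= v'E {1}/v' eqxx => /eqP.
    rewrite addr_eq0 => /eqP h; rewrite /comb.
    transitivity ((- (c 0 ord_max)^-1) * \sum_(l < p) c 0 (widen_ord (leqnSn p) l) * v l x).
      by rewrite h mulrNN mulKf.
    by rewrite mulr_sumr; apply: eq_bigr => l _; rewrite mxE mulrA.
  have c'0 : (\row_l c 0 (widen_ord (leqnSn p) l)) = 0 :> 'rV_p.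
    apply: vfree; apply: filterS c0 => x; rewrite big_ord_recr /= cp mul0r addr0 v'E => h.
    by rewrite /comb -[RHS]h; apply: eq_bigr => l _; rewrite mxE.
  apply/rowP => l; rewrite mxE; case: (unliftP ord_max l) => [l' ->|-> //].
  move/rowP: c'0 => /(_ l'); rewrite !mxE => <-; congr (c 0 _).
  by apply: val_inj; rewrite /= /bump leqNgt ltn_ord.
Qed.

(** The diagonal entries appear in no prescribed order. Knowing that each is some [s j] with [j < n]
    is enough to bound their moduli below by that of [s n.-1]. *)
Lemma ordered_eigenvalues_chain (s : nat -> R[i]) n p : ordered_eigenvalues mu A s ->
  (forall j, (j < n)%N -> s j != 0) -> (p <= n)%N ->
  exists v b, chain p v b /\
    forall l, (l < p)%N -> exists2 j, (j < n)%N & b l l = s j.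
Proof.
move=> [_ sm _] s0; elim: p => [_|p ih pn].
  exists (fun _ => fun=> 0), (fun _ => fun=> 0); split => //; split => //.
  - by move=> l; exact: L2_0.
  - by move=> e _; apply/rowP => -[].
have [v [b [vc bs]]] := ih (ltnW pn).
pose ss := [seq s j | j <- iota 0 n]; pose zz := [seq b l l | l <- iota 0 p].
(* Pigeonhole: otherwise the [n] listed eigenvalues would be, up to order, a sublist of the [p < n]
   diagonal entries found so far. *)
have [z zlt] : exists z, (count_mem z zz < count_mem z ss)%N.
  apply: contrapT => noz.
  have /count_subseqP [t tzz /perm_size sst] : forall z, (count_mem z ss <= count_mem z zz)%N.
    by move=> z; rewrite leqNgt; apply/negP => h; apply: noz; exists z.
  have := size_subseq tzz; rewrite -sst !size_map !size_iota leqNgt pn //.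
have zss : z \in ss by rewrite -has_pred1 has_count (leq_ltn_trans _ zlt).
have z0 : z != 0 by case/mapP: zss => j; rewrite mem_iota /= add0n => jn ->; exact: s0.
have zm : multiplicity_ge mu A z (count_mem z ss).
  apply/(sm z z0).
  pose t := [seq j <- iota 0 n | s j == z].
  have tu : uniq t by rewrite filter_uniq // iota_uniq.
  have st : size t = count_mem z ss by rewrite size_filter count_map.
  apply: (@card_le_trans _ _ _ [set j | j \in t]).
    apply: (@card_le_trans _ _ _ [set index j t | j in [set j | j \in t]]); last exact: card_image_le.
    apply: subset_card_le => i /=; rewrite -st => it.
    by exists (nth 0%N t i); rewrite ?index_uniq //=; exact: mem_nth.
  by apply: subset_card_le => j /=; rewrite mem_filter => /andP[/eqP].
have [v' [b' [v'c b'p b'l]]] := chain_extend vc zlt zm.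
exists v', b'; split => // l; rewrite ltnS leq_eqVlt => /orP[/eqP ->|lp].
  by case/mapP: zss => j; rewrite mem_iota /= add0n => jn zj; exists j => //; rewrite b'p.
by rewrite b'l //; exact: bs.
Qed.

End EigenvalueChain.

(** * Product bound for the leading eigenvalues *)

Section EigenvalueBound.
Local Open Scope complex_scope.
Local Open Scope ring_scope.
Context {R : realType} {d : measure_display} {T : measurableType d}.
Variables (mu : {measure set T -> \bar R}) (A : (T -> R[i]) -> T -> R[i]).
Hypothesis bA : bounded_operator mu A.

Lemma normc_le (s : nat -> R[i]) i j :
  (forall j, Normc.normc (s j.+1) <= Normc.normc (s j)) -> (i <= j)%N ->
  Normc.normc (s j) <= Normc.normc (s i).
Proof.
move=> sn /subnK <-; elim: (j - i)%N => // m ih.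
by rewrite addSn; exact: le_trans ih.
Qed.

Lemma normcE (z : R[i]) : `|z| = (Normc.normc z)%:C.
Proof. by []. Qed.

Lemma L2dot_comb p q (v : nat -> T -> R[i]) (e : 'rV_p) (f : 'rV_q) :
  (forall l, L2 mu (v l)) ->
  L2dot mu (comb v e) (comb v f) =
  \sum_(i < p) \sum_(j < q) e 0 i * L2dot mu (v i) (v j) * (f 0 j)^*.
Proof.
move=> vL; rewrite L2dot_suml //; last exact: comb_L2.
apply: eq_bigr => i _; rewrite L2dot_sumr // mulr_sumr; apply: eq_bigr => j _.
by rewrite mulrA mulrAC.
Qed.

(** On the flag, [A] has the triangular matrix [chain_mx n b], whose determinant is a product of [n]
    eigenvalues of modulus at least that of [s n.-1]. The inner product becomes the Gram matrix [G],
    and orthogonality to the [k j] becomes the condition [W *m Phi = 0]. *)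
Lemma eigenvalue_product_bound (s : nat -> R[i]) n N (k : 'I_N -> T -> R[i]) (M eta : R) :
  ordered_eigenvalues mu A s -> (0 < n)%N -> (N <= n)%N -> 1 <= M -> 0 < eta -> eta <= 1 ->
  (forall j, L2 mu (k j)) ->
  (forall f, L2 mu f -> sqnorm mu (A f) <= M ^+ 2 * sqnorm mu f) ->
  (forall p (u : 'I_p -> T -> R[i]), (forall i, L2 mu (u i)) ->
     (forall i j, L2dot mu (u i) (u j) = (i == j)%:R) ->
     (forall i j, L2dot mu (u i) (k j) = 0) ->
     \sum_i sqnorm mu (A (u i)) <= eta ^+ 2 * (n - N)%:R) ->
  Normc.normc (s n.-1) ^+ n <= M ^+ N * eta ^+ (n - N).
Proof.
move=> sA n0 Nn M1 e0 e1 kL AM Aeta.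
have smono := let: And3 h _ _ := sA in h.
(* If [s n.-1] vanishes the bound is trivial; otherwise monotonicity makes the first [n] eigenvalues
   nonzero, as the flag construction asks. *)
have [sn0|sn0] := eqVneq (s n.-1) 0.
  rewrite sn0 (_ : Normc.normc 0 = 0); last by rewrite /= expr0n /= addr0 sqrtr0.
  by rewrite expr0n gtn_eqF //= mulr_ge0 // exprn_ge0 ?(ltW e0) // (le_trans ler01).
have rho_gt0 : 0 < Normc.normc (s n.-1) by rewrite -ltcR -normcE normr_gt0.
have s0 j : (j < n)%N -> s j != 0.
  move=> jn; rewrite -normr_gt0 normcE ltcR; apply: lt_le_trans rho_gt0 _.
  by apply: normc_le => //; rewrite -ltnS prednK.
have [v [b [vc bs]]] := ordered_eigenvalues_chain bA sA s0 (leqnn n).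
have [vL _ _ vfree] := vc.
pose G : 'M[R[i]]_n := \matrix_(i, j) L2dot mu (v i) (v j).
have GE p q (W : 'M[R[i]]_(p, n)) (V : 'M[R[i]]_(q, n)) i j :
    (W *m G *m map_mx Num.conj (V^T)) i j = L2dot mu (comb v (row i W)) (comb v (row j V)).
  rewrite L2dot_comb // mxE exchange_big; apply: eq_bigr => l _; rewrite !mxE mulr_suml.
  by apply: eq_bigr => m _; rewrite !mxE.
have rowE' (w : 'rV[R[i]]_n) : row 0 w = w by apply/rowP => i; rewrite mxE.
pose Phi : 'M[R[i]]_(n, N) := \matrix_(i, j) L2dot mu (v i) (k j).
have act p (W : 'M[R[i]]_(p, n)) i :
    L2dot mu (comb v (row i (W *m chain_mx n b))) (comb v (row i (W *m chain_mx n b))) =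
    (sqnorm mu (A (comb v (row i W))))%:C.
  rewrite -L2dotE row_mul; have := chain_act bA vc (comb_L2 (row i W) vL) (aeW _ (fun x => erefl)).
  move=> h; have AL : L2 mu (A (comb v (row i W))).
    by case: bA => + _ _ _; apply; exact: comb_L2.
  by apply: L2dot_ae => //; try exact: comb_L2; apply: filterS h.
have trE p (W : 'M[R[i]]_(p, n)) :
    \tr (W *m chain_mx n b *m G *m map_mx Num.conj ((W *m chain_mx n b)^T)) =
    (\sum_i sqnorm mu (A (comb v (row i W))))%:C.
  by rewrite rmorph_sum; apply: eq_bigr => i _; rewrite GE act.
have tr1 (w : 'rV[R[i]]_n) :
    \tr (w *m G *m map_mx Num.conj (w^T)) = (sqnorm mu (comb v w))%:C.
  by rewrite /mxtrace big_ord1 GE -L2dotE rowE'.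
have := @norm_det_le_gram R[i] n N (chain_mx n b) G Phi M%:C eta%:C Nn.
rewrite -!rmorphXn -rmorphM !normcE !lecR !ltcR.
have detb : Normc.normc (s n.-1) ^+ n <= Normc.normc (\det (chain_mx n b)).
  rewrite det_trig ?(chain_mx_trig vc) // -lecR -normcE normr_prod rmorphXn /=.
  rewrite -[n in _ ^+ n]card_ord -prodr_const; apply: ler_prod => i _.
  rewrite lecR ltW //= mxE; have [j jn ->] := bs i (ltn_ord i).
  by rewrite normcE lecR; apply: normc_le => //; rewrite -ltnS prednK.
move=> H; apply: le_trans detb _; apply: H => //.
- by apply/matrixP => i j; rewrite !mxE -L2dotC.
- move=> w w0; rewrite tr1 ltcR lt_def sqnorm_ge0 andbT; apply: contra w0 => /eqP sw.
  by apply/eqP/vfree/(sqnorm_eq0 _ sw)/comb_L2.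
- move=> w; rewrite trE tr1 big_ord1 rowE' -rmorphM lecR; apply: AM; exact: comb_L2.
- move=> p W WP W1; rewrite trE -(rmorph_nat (real_complex R)) -rmorphM lecR; apply: Aeta.
  + by move=> i; exact: comb_L2.
  + by move=> i j; rewrite -GE W1 mxE.
  + move=> i j; rewrite L2dot_suml //.
    move/matrixP: WP => /(_ i j); rewrite !mxE => WP; rewrite -[RHS]WP.
    by apply: eq_bigr => l _; rewrite !mxE.
Qed.

End EigenvalueBound.

(** * Integral operators *)

Section FiniteMeasure.
Local Open Scope complex_scope.
Local Open Scope ring_scope.
Context {R : realType} {d : measure_display} {T : measurableType d}.
Variable mu : {finite_measure set T -> \bar R}.
Implicit Types (f g : T -> R[i]).
Let m : R := fine (mu setT).

Lemma ae_Rintegral_le_cst (h : T -> R) (B : R) : measurable_fun setT h ->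
  (forall x, 0 <= h x) -> 0 <= B -> {ae mu, forall x, h x <= B} ->
  (\int[mu]_x h x <= B * m)%R /\ mu.-integrable setT (EFin \o h).
Proof.
move=> mh h0 B0 hB.
have mT : mu setT \is a fin_num by exact: fin_num_measure.
have le : (\int[mu]_x (h x)%:E <= (B * m)%:E)%E.
  apply: (@le_trans _ _ (\int[mu]_x (cst B%:E x)))%E.
    apply: ae_ge0_le_integral => //.
    - by move=> x _; rewrite lee_fin.
    - exact/measurable_EFinP.
    - by apply: filterS hB => x hB _; rewrite lee_fin.
  by rewrite integral_cst // EFinM fineK.
split; last first.
  apply/integrableP; split; first exact/measurable_EFinP.
  under eq_integral => x _ do rewrite /= ger0_norm //.
  exact: le_lt_trans le (ltry _).
rewrite -lee_fin fineK //.
rewrite ge0_fin_numE ?integral_ge0 // => [|x _]; last by rewrite lee_fin.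
exact: le_lt_trans le (ltry _).
Qed.

Lemma bounded_Lfun2 (h : T -> R) (B : R) : measurable_fun setT h -> 0 <= B ->
  {ae mu, forall x, `|h x| <= B} -> h \in Lfun mu 2%:E.
Proof.
move=> mh B0 hB; apply/andP; split; rewrite inE //=.
rewrite /finite_norm unlock poweR_lty //.
have mh2 : measurable_fun setT (fun x => `|h x| `^ 2).
  apply: (measurableT_comp (measurable_powR _)); exact: measurableT_comp.
have hB2 : {ae mu, forall x, `|h x| `^ 2 <= B `^ 2}.
  by apply: filterS hB => x hx; rewrite ge0_ler_powR ?nnegrE.
have [_ +] := ae_Rintegral_le_cst mh2 (fun x => powR_ge0 _ _) (powR_ge0 _ _) hB2.
move/integrable_lty => /(_ measurableT).
by under eq_integral => x _ do rewrite /=.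
Qed.

Lemma bounded_L2 f (B : R) : measurable_fun setT (fun x => complex.Re (f x)) ->
  measurable_fun setT (fun x => complex.Im (f x)) -> 0 <= B ->
  {ae mu, forall x, complex.Re (f x) ^+ 2 + complex.Im (f x) ^+ 2 <= B ^+ 2} ->
  L2 mu f /\ sqnorm mu f <= B ^+ 2 * m.
Proof.
move=> m1 m2 B0 fB; split.
  split; apply: (bounded_Lfun2 _ B0) => //; apply: filterS fB => x hx;
    rewrite -ler_sqr ?nnegrE // real_normK ?num_real //; apply: le_trans hx.
    by rewrite lerDl sqr_ge0.
  by rewrite lerDr sqr_ge0.
have mf : measurable_fun setT (fun x => complex.Re (f x) ^+ 2 + complex.Im (f x) ^+ 2).
  by apply: measurable_funD; exact: measurable_funX.
have f0 x : 0 <= complex.Re (f x) ^+ 2 + complex.Im (f x) ^+ 2 by rewrite addr_ge0 ?sqr_ge0.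
by have [] := ae_Rintegral_le_cst mf f0 (sqr_ge0 B) fB.
Qed.

End FiniteMeasure.

Section IntegralOperator.
Local Open Scope complex_scope.
Local Open Scope ring_scope.
Context {R : realType} {d : measure_display} {T : measurableType d}.
Variable mu : {finite_measure set T -> \bar R}.
Variables (D : set T) (kap : T -> T -> R) (B : R).
Hypothesis mD : measurable D.
Hypothesis D0 : mu (~` D) = 0%E.
Hypothesis mkap : measurable_fun setT (fun z : T * T => kap z.1 z.2).
Hypothesis B0 : 0 <= B.
Hypothesis kapB : forall x, D x -> {ae mu, forall y, `|kap x y| <= B}.
Implicit Types (f g : T -> R[i]).
Let m : R := fine (mu setT).

Definition kernel_op f x : R[i] := cintegral mu setT (fun y => f y * (kap x y)%:C).

Lemma ae_domain : {ae mu, forall x, D x}.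
Proof. by apply/negligibleP => //; exact: measurableC. Qed.

Lemma measurable_section x : measurable_fun setT (kap x).
Proof. exact: (measurable_fun_pair2 x mkap). Qed.

Lemma section_L2 x : D x ->
  L2 mu (fun y => (kap x y)%:C) /\ sqnorm mu (fun y => (kap x y)%:C) <= B ^+ 2 * m.
Proof.
move=> Dx; apply: bounded_L2 => //; first exact: measurable_section.
apply: filterS (kapB Dx) => y kB /=; rewrite expr0n /= addr0 -(real_normK (num_real _)).
by rewrite ler_sqr ?nnegrE.
Qed.

Lemma kernel_opE f x : kernel_op f x = L2dot mu f (fun y => (kap x y)%:C).
Proof.
congr cintegral; apply/funext => y; congr (_ * _).
by apply/eqP; rewrite eq_complex cReC cImC /= oppr0 !eqxx.
Qed.

(** Tonelli's measurability statement is applied to the positive and negative parts separately, so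
    integrability of the sections is not an issue. *)
Lemma measurable_Rintegral_section (h : T -> R) : measurable_fun setT h ->
  measurable_fun setT (fun x => \int[mu]_y (h y * kap x y))%R.
Proof.
move=> mh; apply: (measurableT_comp (@fine_measurable R setT measurableT)).
have mF : measurable_fun setT (fun z : T * T => (h z.2 * kap z.1 z.2)%:E).
  apply/measurable_EFinP; apply: measurable_funM => //.
  exact: measurableT_comp.
rewrite (_ : (fun x => _) = (fun x => \int[mu]_y (fun z : T * T => (h z.2 * kap z.1 z.2)%:E)^\+ (x, y)) \-
   (fun x => \int[mu]_y (fun z : T * T => (h z.2 * kap z.1 z.2)%:E)^\- (x, y)))%E.
  apply: emeasurable_funB.
    by apply: measurable_fun_fubini_tonelli_F => //; exact: measurable_funepos.
  by apply: measurable_fun_fubini_tonelli_F => //; exact: measurable_funeneg.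
apply/funext => x; rewrite integralE; congr (_ - _)%E; apply: eq_integral => y _.
- by rewrite !funeposE.
- by rewrite !funenegE.
Qed.

Lemma kernel_op_measurable f : L2 mu f ->
  measurable_fun setT (fun x => complex.Re (kernel_op f x)) /\
  measurable_fun setT (fun x => complex.Im (kernel_op f x)).
Proof.
move=> /L2_measurable[f1 f2]; split.
- rewrite (_ : (fun _ => _) = (fun x => \int[mu]_y (complex.Re (f y) * kap x y)%R)%R).
    exact: measurable_Rintegral_section.
  by apply/funext => x; apply: eq_Rintegral => y _; rewrite cReM /= mulr0 subr0.
- rewrite (_ : (fun _ => _) = (fun x => \int[mu]_y (complex.Im (f y) * kap x y)%R)%R).
    exact: measurable_Rintegral_section.
  by apply/funext => x; apply: eq_Rintegral => y _; rewrite cImM /= mulr0 add0r.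
Qed.

(** The values at [x] of the images of the [u i] are, up to conjugation, the coefficients of a
    single function on an orthonormal family, so Bessel's inequality applies. That function [g] may
    be the section at [x] or anything with the same inner products with the [u i]. *)
Lemma kernel_op_sum_le p (u : 'I_p -> T -> R[i]) x g (b : R) :
  (forall i, L2 mu (u i)) -> (forall i j, L2dot mu (u i) (u j) = (i == j)%:R) ->
  L2 mu g -> sqnorm mu g <= b -> (forall i, kernel_op (u i) x = L2dot mu (u i) g) ->
  \sum_i (complex.Re (kernel_op (u i) x) ^+ 2 + complex.Im (kernel_op (u i) x) ^+ 2) <= b.
Proof.
move=> uL uo gL gb uk; apply: le_trans gb.
rewrite -lecR -L2dotE; apply: le_trans (bessel uL gL uo).
rewrite rmorph_sum; apply: ler_sum => i _.
rewrite [leLHS](_ : _ = kernel_op (u i) x * (kernel_op (u i) x)^*); last by rewrite mulcC.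
by rewrite uk [in X in _ <= X]L2dotC // normCK /= conjCK mulrC.
Qed.

(** This is the Cauchy-Schwarz inequality, obtained as Bessel's inequality for the family consisting
    of the normalized [f] alone. *)
Lemma kernel_op_pointwise f x : D x -> L2 mu f ->
  complex.Re (kernel_op f x) ^+ 2 + complex.Im (kernel_op f x) ^+ 2 <= B ^+ 2 * m * sqnorm mu f.
Proof.
move=> Dx fL; have [kL kB] := section_L2 Dx.
have [f0|f0] := eqVneq (sqnorm mu f) 0.
  have fae := sqnorm_eq0 fL f0.
  rewrite kernel_opE (L2dot_ae fL (L2_0 mu) kL kL fae (aeW _ (fun=> erefl))).
  by rewrite L2dot0l //= expr0n /= addr0 f0 mulr0.
have n0 : 0 < sqnorm mu f by rewrite lt_def f0 sqnorm_ge0.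
pose c := (Num.sqrt (sqnorm mu f))^-1.
have c2 : c ^+ 2 = (sqnorm mu f)^-1 by rewrite exprVn sqr_sqrtr // ltW.
have uL : L2 mu (fun x => c%:C * f x).
  by have := L2_lin c%:C fL (L2_0 mu); congr L2; apply/funext => y; rewrite addr0.
have Z g : L2 mu g -> L2dot mu (fun x => c%:C * f x) g = c%:C * L2dot mu f g.
  move=> gL; rewrite -[RHS]addr0 -(L2dot0l gL) -L2dot_linl //; last exact: L2_0.
  rewrite (_ : (fun x => c%:C * f x + 0) = (fun x => c%:C * f x)) //.
  by apply/funext => y; rewrite addr0.
have := @kernel_op_sum_le 1 (fun _ x => c%:C * f x) x _ _ (fun=> uL) _ kL kB
   (fun=> kernel_opE _ _).
rewrite big_ord1 kernel_opE (Z _ kL) -!kernel_opE cReM cImM /= !mul0r subr0 addr0.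
rewrite !exprMn -mulrDr c2 ler_pdivrMl // => H; rewrite mulrC; apply: H.
move=> i j; rewrite !ord1 eqxx Z // (L2dotC uL fL) Z // L2dotE.
have -> : (c%:C * (sqnorm mu f)%:C)^* = (c * sqnorm mu f)%:C.
  by apply/eqP; rewrite eq_complex cReC cImC cReM cImM /= !(mul0r, mulr0, subr0, addr0) oppr0 !eqxx.
by rewrite -rmorphM mulrA -expr2 c2 mulVf.
Qed.

Lemma kernel_op_L2 f : L2 mu f ->
  L2 mu (kernel_op f) /\ sqnorm mu (kernel_op f) <= (B * m) ^+ 2 * sqnorm mu f.
Proof.
move=> fL; have [m1 m2] := kernel_op_measurable fL.
have m0 : 0 <= m by exact: fine_ge0.
have b0 : 0 <= B ^+ 2 * m * sqnorm mu f by rewrite !mulr_ge0 ?sqr_ge0 ?sqnorm_ge0.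
have [] := @bounded_L2 _ _ _ mu (kernel_op f) (Num.sqrt (B ^+ 2 * m * sqnorm mu f)) m1 m2 (sqrtr_ge0 _).
  by apply: filterS ae_domain => x Dx; rewrite sqr_sqrtr // kernel_op_pointwise.
rewrite sqr_sqrtr // => h1 h2; split => //; apply: le_trans h2 _.
by rewrite -/m le_eqVlt; apply/orP; left; apply/eqP; ring.
Qed.

Lemma kernel_op_bounded : bounded_operator mu kernel_op.
Proof.
split.
- by move=> f /kernel_op_L2[].
- move=> f g fL gL fg; apply: filterS ae_domain => x Dx.
  have [kL _] := section_L2 Dx.
  by rewrite !kernel_opE; apply: L2dot_ae => //; exact: aeW.
- move=> c f g fL gL; apply: filterS ae_domain => x Dx.
  have [kL _] := section_L2 Dx.
  by rewrite !kernel_opE L2dot_linl.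
- exists ((B * m) ^+ 2) => f /kernel_op_L2[_ h].
  by rewrite !L2dotE -rmorphM lecR.
Qed.

(* Summing Bessel's inequality over x bounds the Hilbert-Schmidt norm on the
   orthogonal complement of the sections at the nodes. *)
Lemma kernel_op_HS N (z : 'I_N -> T) (e : R) p (u : 'I_p -> T -> R[i]) :
  0 <= e -> (forall j, D (z j)) ->
  (forall x, D x -> exists c : 'I_N -> R,
     {ae mu, forall y, `|kap x y - \sum_j c j * kap (z j) y| <= e}) ->
  (forall i, L2 mu (u i)) -> (forall i j, L2dot mu (u i) (u j) = (i == j)%:R) ->
  (forall i j, L2dot mu (u i) (fun y => (kap (z j) y)%:C) = 0) ->
  \sum_i sqnorm mu (kernel_op (u i)) <= (e * m) ^+ 2.
Proof.
move=> e0 zD app uL uo uz.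
have m0 : 0 <= m by exact: fine_ge0.
have mk i := kernel_op_measurable (uL i).
have pt x : D x -> \sum_i (complex.Re (kernel_op (u i) x) ^+ 2 + complex.Im (kernel_op (u i) x) ^+ 2) <= e ^+ 2 * m.
  move=> Dx; have [c hc] := app x Dx.
  have [kL _] := section_L2 Dx.
  have zL j : L2 mu (fun y => (kap (z j) y)%:C) by have [] := section_L2 (zD j).
  (* The section at [x] minus its approximation by node sections: the [u i] are orthogonal to the
     latter, so [g] has the same coefficients as the section but is of size [e]. *)
  pose g y : R[i] := (-1) * (\sum_j (c j)%:C * (kap (z j) y)%:C) + (kap x y)%:C.
  have gE y : g y = (kap x y - \sum_j c j * kap (z j) y)%:C.
    rewrite /g mulN1r addrC rmorphB rmorph_sum /=; congr (_ - _).
    by apply: eq_bigr => j _; rewrite rmorphM.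
  have gL : L2 mu g by apply: L2_lin => //; exact: L2_sum.
  apply: (@kernel_op_sum_le p u x g) => //; last first.
    move=> i; rewrite kernel_opE L2dot_linr //; last exact: L2_sum.
    rewrite L2dot_sumr // big1 ?mulr0 ?add0r // => j _.
    by rewrite uz mulr0.
  have [m1 m2] := L2_measurable gL.
  have [] // := @bounded_L2 _ _ _ mu g e m1 m2 e0.
  apply: filterS hc => y; rewrite gE /= expr0n /= addr0 => h.
  by rewrite -(real_normK (num_real _)) ler_sqr ?nnegrE.
have mF i : measurable_fun setT (fun x => complex.Re (kernel_op (u i) x) ^+ 2 + complex.Im (kernel_op (u i) x) ^+ 2).
  by have [m1 m2] := mk i; apply: measurable_funD; exact: measurable_funX.
have F0 i x : 0 <= complex.Re (kernel_op (u i) x) ^+ 2 + complex.Im (kernel_op (u i) x) ^+ 2.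
  by rewrite addr_ge0 ?sqr_ge0.
have -> : \sum_i sqnorm mu (kernel_op (u i)) = (\int[mu]_x
    \sum_i (complex.Re (kernel_op (u i) x) ^+ 2 + complex.Im (kernel_op (u i) x) ^+ 2))%R.
  rewrite /Rintegral; under eq_integral do rewrite -sumEFin.
  rewrite ge0_integral_sum //; last 2 first.
  - by move=> i; exact/measurable_EFinP.
  - by move=> i x _; rewrite lee_fin.
  rewrite -sum_fine // => i _.
  by apply: integral_fune_fin_num => //; apply: sqnorm_integrable; have [] := kernel_op_L2 (uL i).
have aept : {ae mu, forall x, \sum_i (complex.Re (kernel_op (u i) x) ^+ 2 +
    complex.Im (kernel_op (u i) x) ^+ 2) <= e ^+ 2 * m}.
  by apply: filterS ae_domain => x; exact: pt.
have [+ _] := ae_Rintegral_le_cst (measurable_sum _ mF) (fun x => sumr_ge0 _ (fun i _ => F0 i x))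
   (mulr_ge0 (sqr_ge0 e) m0) aept.
by rewrite -/m -mulrA -expr2 exprMn.
Qed.

End IntegralOperator.

(** * Norms under the square root of the operator composed with its adjoint *)

Section SquareRoot.
Local Open Scope complex_scope.
Local Open Scope ring_scope.
Context {R : realType} {d : measure_display} {T : measurableType d}.
Variable mu : {measure set T -> \bar R}.

(* A positive operator on a complex inner product space is symmetric. *)
Lemma sqrt_operator_sqnorm (A B S : (T -> R[i]) -> T -> R[i]) f :
  bounded_operator mu A -> is_adjoint mu A B -> is_sqrt_operator mu (fun g => B (A g)) S ->
  L2 mu f -> sqnorm mu (S f) = sqnorm mu (A f).
Proof.
move=> [AL _ _ _] [[BL _ _ _] adj] [[SL Sae Slin _] Spos Ssq] fL.
have posr g : L2 mu g -> complex.Im (L2dot mu (S g) g) = 0.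
  by move=> /Spos; rewrite lecE /= => /andP[/eqP -> _].
have sym g h : L2 mu g -> L2 mu h -> L2dot mu (S g) h = L2dot mu g (S h).
  move=> gL hL.
  have expand c : L2dot mu (S (fun y => c * g y + h y)) (fun y => c * g y + h y) =
      c * c^* * L2dot mu (S g) g + c * L2dot mu (S g) h + c^* * L2dot mu (S h) g + L2dot mu (S h) h.
    have cL : L2 mu (fun y => c * g y + h y) by exact: L2_lin.
    rewrite (@L2dot_ae _ _ _ mu _ (fun y => c * S g y + S h y) _ (fun y => c * g y + h y)) //;
      [|exact: SL|by apply: L2_lin; exact: SL|exact: Slin|exact: aeW].
    rewrite L2dot_linl ?L2dot_linr //; try exact: SL.
    by rewrite mulrDr !mulrA addrA.
  have H c : complex.Im (c * L2dot mu (S g) h + c^* * L2dot mu (S h) g) = 0.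
    have := posr _ (L2_lin c gL hL); rewrite expand !cImD (posr h) // addr0.
    have -> : c * c^* = (complex.Re c ^+ 2 + complex.Im c ^+ 2)%:C by exact: mulcC.
    by rewrite [complex.Im (_%:C * _)]cImM (posr g) //= mulr0 mul0r !add0r => /eqP; rewrite addr_eq0 => /eqP ->; rewrite addNr.
  (* Polarization: [c = 1] compares the imaginary parts of the two inner products, [c = 'i] their
     real parts. *)
  have h1 := H 1; have h2 := H 'i%C.
  rewrite (L2dotC (SL _ hL) gL); apply/eqP; rewrite eq_complex cReC cImC.
  move: h1 h2; rewrite !cImD !cImM !cReC !cImC /= => h1 h2.
  by apply/andP; split; apply/eqP; lra.
apply/eqP; rewrite -(inj_eq (@complexI _)) -!L2dotE; apply/eqP.
rewrite sym //; last exact: SL.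
rewrite adj //; last exact: AL.
by apply: L2dot_ae => //; [exact/SL/SL|exact/BL/AL|exact: aeW|exact: Ssq].
Qed.

End SquareRoot.

(** * Polynomial approximation *)

Section Taylor.
Local Open Scope classical_set_scope.
Variable R : realType.
Implicit Types (g : R -> R) (s t : R).

Lemma derive1n_shift g n : (g^`())^`(n) = g^`(n.+1) :> (R -> R).
Proof. by rewrite /derive1n -iterSr. Qed.

Lemma Ck_derive k g : Ck k.+1 g -> Ck k (g^`()).
Proof.
move=> [gd gc]; split; last by rewrite derive1n_shift.
by move=> i ik t; rewrite derive1n_shift; exact: gd.
Qed.

Lemma Ck_is_derive k g t : Ck k.+1 g -> is_derive t 1 g (g^`() t).
Proof.
by move=> [gd _]; apply: DeriveDef; [exact: (gd 0%N)|rewrite derive1E].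
Qed.

Lemma Ck_continuous k g : Ck k g -> continuous g.
Proof.
case: k => [[]//|k gk] t.
have [d _] := Ck_is_derive t gk.
exact/differentiable_continuous/derivable1_diffP.
Qed.

Lemma Ck_le k l g : (l <= k)%N -> Ck k g -> Ck l g.
Proof.
move=> /subnK <-; elim: (k - l)%N => // i ih gk; apply: ih.
move: gk; rewrite addSn => -[gd gc]; split; first by move=> j jl; apply: gd; exact: leqW.
move=> t; apply/differentiable_continuous/derivable1_diffP; exact: gd.
Qed.

Lemma continuous_bounded g (L : R) : continuous g ->
  exists2 C, 0 <= C & forall t, `|t| <= L -> `|g t| <= C.
Proof.
move=> gc; have [L0|L0] := leP 0 L; last first.
  by exists 0 => // t /le_lt_trans/(_ L0); rewrite normr_lt0.
have [c cI cM] : exists2 c, c \in `[- L, L]%R & forall t, t \in `[- L, L]%R -> `|g t| <= `|g c|.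
  apply: (@EVT_max R (fun t => `|g t|)); first lra.
  apply: continuous_subspaceT => t; apply: continuous_comp; [exact: gc|exact: norm_continuous].
exists `|g c| => // t tL; apply: cM.
by rewrite in_itv /= -ler_norml.
Qed.

Definition taylor_poly k g b : {poly R} :=
  \sum_(i < k) ((g^`(i))%classic b / i`!%:R) *: ('X - b%:P) ^+ i.

Lemma size_taylor_poly k g b : (size (taylor_poly k g b) <= k)%N.
Proof.
apply: leq_trans (size_sum _ _ _) _; apply/bigmax_leqP => i _.
by apply: leq_trans (size_scale_leq _ _) _; rewrite size_exp_XsubC.
Qed.

Lemma deriv_taylor_poly k g b :
  (taylor_poly k.+1 g b)^`()%R = taylor_poly k (g^`()) b.
Proof.
rewrite /taylor_poly raddf_sum big_ord_recl /= expr0 derivZ derivC scaler0 add0r.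
apply: eq_bigr => i _; rewrite derivZ deriv_exp derivXsubC mul1r /= -[bump 0 i]/i.+1 /= derive1n_shift.
rewrite -(scaler_nat i.+1) scalerA; congr (_ *: _).
by rewrite factS natrM invfM mulrA mulrAC mulfVK // pnatr_eq0.
Qed.

Lemma taylor_poly_base k g b : (0 < k)%N -> (taylor_poly k g b).[b] = g b.
Proof.
case: k => // k _; rewrite /taylor_poly horner_sum big_ord_recl /= big1 ?addr0.
  by rewrite expr0 hornerZ hornerC mulr1 divr1.
by move=> i _; rewrite hornerZ horner_exp hornerXsubC subrr expr0n mulr0.
Qed.

Lemma MVT_between (f df : R -> R) (b s : R) : (forall x : R, is_derive x (1 : R) f (df x)) ->
  exists2 c, `|c - b| <= `|s - b| /\ Num.min b s <= c <= Num.max b s & f s - f b = df c * (s - b).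
Proof.
move=> fd.
have fc : continuous f.
  by move=> x; have [d _] := fd x; exact/differentiable_continuous/derivable1_diffP.
have [bs|sb] := leP b s.
  have [c] := MVT_segment bs (fun x _ => fd x) (continuous_subspaceT fc).
  rewrite in_itv /= => /andP[bc cs] e; exists c => //.
  by rewrite bc cs; split => //; rewrite !ger0_norm ?subr_ge0 // lerD2r.
have [c] := MVT_segment (ltW sb) (fun x _ => fd x) (continuous_subspaceT fc).
rewrite in_itv /= => /andP[sc cb] e; exists c.
  by rewrite sc cb; split => //; rewrite !ler0_norm ?subr_le0 // ?(ltW sb) //; lra.
by rewrite -opprB e -mulrN opprB.
Qed.

(** The derivative of the remainder of order [k.+1] of [g] is the remainder of order [k] of its
    derivative, so each induction step is one use of the mean value theorem. Bounding [|c - b|] by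
    [|s - b|] there is what leaves the constant without a factorial. *)
Lemma taylor_bound k g (L : R) : Ck k g -> exists2 C, 0 <= C &
  forall b s, `|b| <= L -> `|s| <= L ->
    `|g s - (taylor_poly k g b).[s]| <= C * `|s - b| ^+ k.
Proof.
elim: k g => [|k ih] g gk.
  have [C C0 hC] := continuous_bounded L (Ck_continuous gk).
  exists C => // b s bL sL; rewrite /taylor_poly big_ord0 horner0 subr0 expr0 mulr1.
  exact: hC.
have [C C0 hC] := ih _ (Ck_derive gk).
exists C => // b s bL sL.
pose f := g - horner (taylor_poly k.+1 g b).
pose df x := (g^`())%classic x - (taylor_poly k (g^`())%classic b).[x].
have fd (x : R) : is_derive x (1 : R) f (df x).
  rewrite /f /df -deriv_taylor_poly.
  by apply: is_deriveB; exact: Ck_is_derive gk.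
have [c [cb /andP[c1 c2]]] := MVT_between b s fd.
rewrite /f !fctE taylor_poly_base // subrr subr0 => ->.
rewrite normrM exprSr mulrA ler_wpM2r //.
have cL : `|c| <= L.
  move: bL sL; rewrite !ler_norml => /andP[b1 b2] /andP[s1 s2]; apply/andP; split.
    by apply: le_trans c1; rewrite le_min b1 s1.
  by apply: le_trans c2 _; rewrite ge_max b2 s2.
apply: le_trans (hC b c bL cL) _.
by rewrite ler_wpM2l // lerXn2r ?nnegrE.
Qed.

End Taylor.

(** * Arithmetic of uniformly approximable families *)

Section PolyApprox.
Local Open Scope classical_set_scope.
Variable (R : realType) (I : Type) (S : I -> R -> Prop) (h : I -> R) (m : nat).
Hypothesis h0 : forall i, 0 <= h i.
Hypothesis h1 : forall i, h i <= 1.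
Implicit Types F G : I -> R -> R.

Let hm0 i : 0 <= h i ^+ m. Proof. exact: exprn_ge0. Qed.
Let hm1 i : h i ^+ m <= 1. Proof. exact: exprn_ile1. Qed.

(** The index [i] collects all the parameters (interval, pole, normal) on which [C] and the degree
    bound [M] must not depend. The bound on [F] itself makes the class stable under products. *)
Definition poly_approx F : Prop := exists C M, 0 <= C /\
  forall i, exists2 p : {poly R}, (size p <= M)%N & forall s, S i s ->
    `|F i s| <= C /\ `|F i s - p.[s]| <= C * h i ^+ m.

Lemma poly_approx_cst (c : I -> R) C : (forall i, `|c i| <= C) ->
  poly_approx (fun i _ => c i).
Proof.
move=> cC; exists `|C|, 1%N; split => // i; exists (c i)%:P; first exact: size_polyC_leq1.
move=> s _; rewrite hornerC subrr normr0 mulr_ge0 //; split => //.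
exact: le_trans (cC i) (ler_norm _).
Qed.

Lemma poly_approx_perturb F G C : poly_approx G ->
  (forall i s, S i s -> `|F i s - G i s| <= C * h i ^+ m) -> poly_approx F.
Proof.
move=> [C' [M [C0 hG]]] FG; exists (C' + `|C|), M; split; first exact: addr_ge0.
move=> i; have [p pM hp] := hG i; exists p => // s Ss.
have [h2 h3] := hp s Ss; have h4 := FG i s Ss.
have h5 : C * h i ^+ m <= `|C| * h i ^+ m by rewrite ler_wpM2r // ler_norm.
have h6 : `|C| * h i ^+ m <= `|C| by rewrite ler_piMr.
split.
  rewrite -(subrK (G i s) (F i s)) addrC; apply: le_trans (ler_normD _ _) _; apply: lerD => //.
  exact: le_trans h4 (le_trans h5 h6).
rewrite -(subrK (G i s) (F i s)) -addrA addrC mulrDl.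
by apply: le_trans (ler_normD _ _) _; apply: lerD => //; exact: le_trans h4 h5.
Qed.

Lemma poly_approx_add F G : poly_approx F -> poly_approx G ->
  poly_approx (fun i s => F i s + G i s).
Proof.
move=> [C [M [C0 hF]]] [C' [M' [C'0 hG]]]; exists (C + C'), (maxn M M').
split; first exact: addr_ge0.
move=> i; have [p pM hp] := hF i; have [q qM hq] := hG i; exists (p + q).
  by apply: leq_trans (size_polyD _ _) _; rewrite geq_max !leq_max pM qM orbT.
move=> s Ss; have [p1 p2] := hp s Ss; have [q1 q2] := hq s Ss; split.
  by apply: le_trans (ler_normD _ _) _; exact: lerD.
rewrite hornerD opprD addrACA mulrDl.
by apply: le_trans (ler_normD _ _) _; exact: lerD.
Qed.

Lemma poly_approx_mul F G : poly_approx F -> poly_approx G ->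
  poly_approx (fun i s => F i s * G i s).
Proof.
move=> [C [M [C0 hF]]] [C' [M' [C'0 hG]]]; exists (3 * (C * C')), (M + M')%N.
have CC : 0 <= C * C' by exact: mulr_ge0.
split; first by rewrite mulr_ge0.
move=> i; have [p pM hp] := hF i; have [q qM hq] := hG i; exists (p * q).
  by apply: leq_trans (size_polyMleq _ _) _; apply: leq_trans (leq_pred _) _; exact: leq_add.
move=> s Ss; have [p1 p2] := hp s Ss; have [q1 q2] := hq s Ss; split.
  by rewrite normrM; apply: le_trans (ler_pM _ _ p1 q1) _ => //; lra.
have ph : `|p.[s]| <= 2 * C.
  rewrite -(subKr (F i s) p.[s]); apply: le_trans (ler_normB _ _) _.
  have : C * h i ^+ m <= C by rewrite ler_piMr.
  by move: p1 p2; lra.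
rewrite hornerM (_ : _ - _ = (F i s - p.[s]) * G i s + p.[s] * (G i s - q.[s])); last by ring.
apply: le_trans (ler_normD _ _) _; rewrite !normrM.
have e1 : `|F i s - p.[s]| * `|G i s| <= C * h i ^+ m * C' by exact: ler_pM.
have e2 : `|p.[s]| * `|G i s - q.[s]| <= 2 * C * (C' * h i ^+ m) by exact: ler_pM.
by apply: le_trans (lerD e1 e2) _; rewrite le_eqVlt; apply/orP; left; apply/eqP; ring.
Qed.

Lemma poly_approx_opp F : poly_approx F -> poly_approx (fun i s => - F i s).
Proof.
move=> [C [M [C0 hF]]]; exists C, M; split => // i; have [p pM hp] := hF i.
exists (- p); first by rewrite size_polyN.
by move=> s /hp [p1 p2]; rewrite hornerN -opprD !normrN.
Qed.

Lemma poly_approx_exp F j : poly_approx F -> poly_approx (fun i s => F i s ^+ j).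
Proof.
move=> hF; elim: j => [|j ih]; first by apply: (@poly_approx_cst (fun=> 1) 1) => i; rewrite normr1.
rewrite (_ : (fun _ _ => _) = (fun i s => F i s * F i s ^+ j)); first exact: poly_approx_mul.
by apply/funext => i; apply/funext => s; rewrite exprS.
Qed.

Lemma poly_approx_sum n (F : 'I_n -> I -> R -> R) : (forall j, poly_approx (F j)) ->
  poly_approx (fun i s => \sum_j F j i s).
Proof.
elim: n F => [|n ih] F hF.
  rewrite (_ : (fun _ _ => _) = (fun _ _ => 0)).
    by apply: (@poly_approx_cst (fun=> 0) 0) => i; rewrite normr0.
  by apply/funext => i; apply/funext => s; rewrite big_ord0.
rewrite (_ : (fun _ _ => _) = (fun i s => F ord0 i s + \sum_j F (lift ord0 j) i s)).
  by apply: poly_approx_add => //; exact: ih.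
by apply/funext => i; apply/funext => s; rewrite big_ord_recl.
Qed.

(* Expand 1/F geometrically around a value c of F: since F - c = O(h), the
   remainder ((c - F)/c)^m / F is O(h^m). *)
Lemma poly_approx_inv F (c L : R) : poly_approx F -> 0 < c ->
  (forall i s, S i s -> c <= F i s) ->
  (forall i s s', S i s -> S i s' -> `|F i s - F i s'| <= L * h i) ->
  poly_approx (fun i s => (F i s)^-1).
Proof.
move=> hF c0 cF FL.
have [C [M [C0 hFC]]] := hF.
have FC i s : S i s -> `|F i s| <= C by move=> Ss; have [p _ /(_ s Ss)[]] := hFC i.
(* [f0 i] is a value of [F i] on [S i], or the default [c] when [S i] is empty. *)
have /choice[f0 hf0] : forall i, exists f : R, [/\ c <= f, f <= c + C &
    forall s, S i s -> `|F i s - f| <= L * h i].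
  move=> i; case: (pselect (exists s, S i s)) => [[s Ss]|nS].
    exists (F i s); split; [exact: cF| |by move=> s' Ss'; exact: FL].
    by apply: le_trans (ler_norm _) _; apply: le_trans (FC i s Ss) _; rewrite lerDr ltW.
  by exists c; split; rewrite ?lerDl // => s Ss; case: nS; exists s.
have f00 i : 0 < f0 i by have [h2 _ _] := hf0 i; exact: lt_le_trans h2.
have inv_le x : c <= x -> `|x^-1| <= c^-1.
  move=> cx; have x0 : 0 < x by exact: lt_le_trans cx.
  by rewrite ger0_norm ?invr_ge0 ?(ltW x0) // lef_pV2 ?posrE.
pose G i s := \sum_(j < m) (f0 i)^-1 ^+ j.+1 * (f0 i - F i s) ^+ j.
apply: (@poly_approx_perturb _ G (c^-1 * (`|L| / c) ^+ m)).
  apply: poly_approx_sum => j; apply: poly_approx_mul.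
    apply: (@poly_approx_cst (fun i => (f0 i)^-1 ^+ j.+1) (c^-1 ^+ j.+1)) => i.
    have [h2 _ _] := hf0 i.
    by rewrite normrX lerXn2r ?nnegrE ?invr_ge0 ?(ltW c0) // inv_le.
  apply: poly_approx_exp; apply: poly_approx_add; last exact: poly_approx_opp.
  apply: (@poly_approx_cst f0 (c + C)) => i; have [_ h2 _] := hf0 i.
  by rewrite ger0_norm // ltW.
move=> i s Ss; have Fs := cF i s Ss; have F0 : 0 < F i s by exact: lt_le_trans Fs.
have fi := f00 i; have [cf _ Ff] := hf0 i.
have fn0 : f0 i != 0 by rewrite gt_eqF.
have Fn0 : F i s != 0 by rewrite gt_eqF.
pose x := (f0 i - F i s) / f0 i.
have GE : (F i s)^-1 - G i s = x ^+ m * (F i s)^-1.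
  have e : x ^+ m - 1 = (x - 1) * \sum_(j < m) x ^+ j by exact: subrX1.
  have x1 : x - 1 = - (F i s / f0 i) by rewrite /x; field.
  have -> : G i s = (f0 i)^-1 * \sum_(j < m) x ^+ j.
    rewrite /G mulr_sumr; apply: eq_bigr => j _.
    by rewrite /x exprMn exprS -mulrA; congr (_ * _); rewrite mulrC.
  have -> : x ^+ m = 1 - (F i s / f0 i) * \sum_(j < m) x ^+ j.
    by rewrite -mulNr -x1 -e; ring.
  by move: (\sum_(j < m) x ^+ j) => X; field; rewrite fn0 Fn0.
rewrite GE normrM normrX mulrC -mulrA -exprMn; apply: ler_pM => //; first exact: inv_le.
apply: lerXn2r; rewrite ?nnegrE ?mulr_ge0 ?invr_ge0 ?(ltW c0) //.
rewrite /x normrM mulrAC; apply: ler_pM => //; last exact: inv_le.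
rewrite distrC; apply: le_trans (Ff s Ss) _.
by rewrite ler_wpM2r // ler_norm.
Qed.

End PolyApprox.

(** * Divided differences with a near or a far pole *)

Section DividedDifferences.
Local Open Scope classical_set_scope.
Variable R : realType.
Implicit Types (g : R -> R) (s t a h : R).

Lemma poly_divided_difference (P : {poly R}) t : exists2 Q : {poly R},
  (size Q <= (size P).-1)%N & P = P.[t]%:P + Q * ('X - t%:P).
Proof.
have /factor_theorem[Q e] : root (P - P.[t]%:P) t by rewrite rootE !hornerE subrr.
exists Q; last by rewrite -e addrC subrK.
have [-> |Q0] := eqVneq Q 0; first by rewrite size_poly0.
have : size (Q * ('X - t%:P)) = (size Q).+1.
  by rewrite size_Mmonic ?monicXsubC // size_XsubC addn2.
rewrite -e => es; have : (size (P - P.[t]%:P)%R <= maxn (size P) 1)%N.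
  apply: leq_trans (size_polyD _ _) _; rewrite size_polyN geq_max leq_maxl /=.
  by apply: leq_trans (size_polyC_leq1 _) _; exact: leq_maxr.
rewrite es; have : (0 < size Q)%N by rewrite lt0n size_poly_eq0.
move: (size Q) (size P) => x y; rewrite leq_max => ? /orP[]; lia.
Qed.

(** [w] is the truncated geometric series of [1 / (a + (s - s0))] with [a = s0 - t]. The error keeps
    the factor [(h / |a|) ^+ m]: it will multiply a Taylor remainder at [t], whose power of [|a|]
    cancels the denominators and leaves [h ^+ m]. *)
Lemma pole_approx m s0 h t : 0 < h -> 2 * h < `|s0 - t| ->
  exists2 w : {poly R}, (size w <= m)%N & forall s, `|s - s0| <= h ->
    [/\ h <= `|s - t|, `|(s - t)^-1| <= 2 / `|s0 - t|, `|w.[s]| <= 4 / `|s0 - t| &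
        `|(s - t)^-1 - w.[s]| <= 2 / `|s0 - t| * (h / `|s0 - t|) ^+ m].
Proof.
move=> hp ha; set a := s0 - t.
have na0 : 0 < `|a| by rewrite /a; lra.
have a0 : a != 0 by rewrite -normr_gt0.
exists (\sum_(j < m) (a^-1 * (- a^-1) ^+ j) *: ('X - s0%:P) ^+ j).
  apply: leq_trans (size_sum _ _ _) _; apply/bigmax_leqP => i _.
  by apply: leq_trans (size_scale_leq _ _) _; rewrite size_exp_XsubC.
move=> s hs; set w := \sum_(j < m) _.
have stE : s - t = (s - s0) + a by rewrite /a; ring.
have st : `|a| / 2 <= `|s - t|.
  have : `|a| <= `|s - t| + `|s - s0|.
    by rewrite -[a](_ : (s - t) - (s - s0) = _) ?ler_normB // stE; ring.
  by rewrite /a in ha *; move: ha hs; lra.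
have st0 : 0 < `|s - t| by apply: lt_le_trans st; rewrite divr_gt0.
have nst0 : s - t != 0 by rewrite -normr_gt0.
have ist : `|(s - t)^-1| <= 2 / `|a|.
  by rewrite normfV -[leRHS]invf_div lef_pV2 ?posrE // divr_gt0.
pose x := - ((s - s0) / a).
have xh : `|x| <= h / `|a| by rewrite normrN normrM normfV ler_wpM2r // invr_ge0 ltW.
have ha1 : h / `|a| <= 1 by rewrite ler_pdivrMr // mul1r /a; lra.
have ha0 : 0 <= h / `|a| by rewrite divr_ge0 // ltW.
have wE : (s - t)^-1 - w.[s] = x ^+ m * (s - t)^-1.
  have e : x ^+ m - 1 = (x - 1) * \sum_(j < m) x ^+ j by exact: subrX1.
  have x1 : x - 1 = - ((s - t) / a) by rewrite /x stE; field.
  have -> : w.[s] = a^-1 * \sum_(j < m) x ^+ j.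
    rewrite /w horner_sum mulr_sumr; apply: eq_bigr => j _.
    rewrite hornerZ horner_exp hornerXsubC -mulrA -exprMn; congr (_ * _ ^+ _).
    by rewrite /x mulrC mulrN.
  have -> : x ^+ m = 1 - ((s - t) / a) * \sum_(j < m) x ^+ j.
    by rewrite -mulNr -x1 -e; ring.
  by field; rewrite a0 nst0.
have werr : `|(s - t)^-1 - w.[s]| <= 2 / `|a| * (h / `|a|) ^+ m.
  rewrite wE normrM normrX mulrC ler_pM ?exprn_ge0 //.
  by rewrite lerXn2r ?nnegrE.
split => //; first by apply: le_trans st; rewrite ler_pdivlMr // mulrC /a ltW.
rewrite -(subKr (s - t)^-1 w.[s]); apply: le_trans (ler_normB _ _) _.
have -> : 4 / `|a| = 2 / `|a| + 2 / `|a| by field; rewrite gt_eqF.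
apply: lerD => //; apply: le_trans werr _.
by rewrite ler_piMr ?divr_ge0 ?(ltW na0) // exprn_ile1.
Qed.

(* The base point of the Taylor expansion is t when t is within 2h of s0, where
   the quotient is a polynomial up to O(h^m), and s0 otherwise, where the poles
   at t are expanded in powers of s - s0. *)
Lemma divided_difference_approx m g (L : R) : Ck m.+1 g -> exists2 C, 0 <= C &
  forall s0 h t, 0 < h -> `|s0| <= L -> (forall s, `|s - s0| <= h -> `|s| <= L) -> `|t| <= L ->
  exists2 p : {poly R}, (size p <= m)%N & forall s, `|s - s0| <= h -> s != t ->
    `|(g s - g t) / (s - t) - p.[s]| <= C * h ^+ m.
Proof.
move=> gk; have [C C0 hC] := taylor_bound L gk.
(* The first term serves the near case, where [|s - t| <= 3 * h]. The second serves the far case: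
   [C] for the Taylor remainder at [s] and [2 * C] for the pole at [t]. *)
exists (C * 3 ^+ m + 3 * C) => [|s0 h t hp s0L sL tL]; first by rewrite addr_ge0 ?mulr_ge0 ?exprn_ge0.
have hm : 0 <= h ^+ m by rewrite exprn_ge0 // ltW.
have [near|far] := leP `|s0 - t| (2 * h).
  pose P := taylor_poly m.+1 g t.
  have [Q sQ PE] := poly_divided_difference P t.
  exists Q.
    by apply: leq_trans sQ _; rewrite -subn1 leq_subLR add1n; exact: size_taylor_poly.
  move=> s hs st; have st0 : s - t != 0 by rewrite subr_eq0.
  have -> : (g s - g t) / (s - t) - Q.[s] = (g s - P.[s]) / (s - t).
    rewrite {1}PE hornerD hornerM hornerC hornerXsubC /P taylor_poly_base //.
    by field.
  have st3 : `|s - t| <= 3 * h.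
    rewrite (_ : s - t = (s - s0) + (s0 - t)); last by ring.
    by apply: le_trans (ler_normD _ _) _; lra.
  rewrite normrM normfV ler_pdivrMr ?normr_gt0 //.
  apply: le_trans (hC t s tL (sL s hs)) _.
  rewrite exprSr mulrA ler_wpM2r //.
  have : `|s - t| ^+ m <= (3 * h) ^+ m by rewrite lerXn2r ?nnegrE // mulr_ge0 // ltW.
  move/(ler_wpM2l C0)/le_trans; apply; rewrite exprMn mulrDl mulrA.
  by rewrite lerDl !mulr_ge0.
pose P := taylor_poly m.+1 g s0.
have [Q sQ PE] := poly_divided_difference P t.
have [w sw hw] := pole_approx m hp far.
set a := s0 - t in far hw.
have na0 : 0 < `|a| by apply: le_lt_trans far; rewrite mulr_ge0 // ltW.
pose rt := g t - P.[t].
have rtC : `|rt| <= C * `|a| ^+ m.+1 by rewrite /a (distrC s0); exact: hC.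
exists (Q - rt *: w).
  apply: leq_trans (size_polyD _ _) _; rewrite size_polyN geq_max.
  rewrite (leq_trans (size_scale_leq _ _) sw) andbT.
  by apply: leq_trans sQ _; rewrite -subn1 leq_subLR add1n; exact: size_taylor_poly.
move=> s hs st; have st0 : s - t != 0 by rewrite subr_eq0.
have [w1 w2 w3 w4] := hw s hs.
(* The remainder at [s] is divided by [s - t], of modulus at least [h]; the remainder [rt] at [t] is
   constant in [s] and multiplies the error in approximating the pole. *)
have -> : (g s - g t) / (s - t) - (Q - rt *: w).[s] =
    (g s - P.[s]) / (s - t) - rt * ((s - t)^-1 - w.[s]).
  rewrite hornerD hornerN hornerZ {1}PE hornerD hornerM hornerC hornerXsubC /rt.
  by field.
apply: le_trans (ler_normB _ _) _.
have e1 : `|(g s - P.[s]) / (s - t)| <= C * h ^+ m.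
  rewrite normrM normfV ler_pdivrMr ?normr_gt0 //.
  apply: le_trans (hC s0 s s0L (sL s hs)) _.
  rewrite -mulrA ler_wpM2l // exprSr ler_pM ?exprn_ge0 ?(le_trans hs) //.
  by rewrite lerXn2r ?nnegrE // ltW.
have e2 : `|rt * ((s - t)^-1 - w.[s])| <= 2 * C * h ^+ m.
  rewrite normrM; apply: le_trans (ler_pM _ _ rtC w4) _ => //.
  have am0 : `|a| ^+ m != 0 by rewrite expf_neq0 ?gt_eqF.
  rewrite exprMn exprVn !exprS le_eqVlt; apply/orP; left; apply/eqP.
  by move: (`|a| ^+ m) am0 => X X0; field; rewrite X0 gt_eqF.
have : 0 <= C * 3 ^+ m * h ^+ m by rewrite !mulr_ge0 // exprn_ge0.
by move: e1 e2; lra.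
Qed.

(** The same near and far base points as for the first difference. In the far case there is a double
    pole, with the Taylor remainder of [g] at [t] as coefficient, and a simple one, with that of
    [derive1 g]; [w ^+ 2] approximates the double pole, which is why the size grows to about
    [2 * m]. *)
Lemma second_difference_approx m g (L : R) : Ck m.+2 g -> exists C M, 0 <= C /\
  forall s0 h t, 0 < h -> `|s0| <= L -> (forall s, `|s - s0| <= h -> `|s| <= L) -> `|t| <= L ->
  exists2 p : {poly R}, (size p <= M)%N & forall s, `|s - s0| <= h -> s != t ->
    `|(g s - g t - derive1 g t * (s - t)) / (s - t) ^+ 2 - p.[s]| <= C * h ^+ m.
Proof.
move=> gk; have [C C0 hC] := taylor_bound L gk.
have [C' C'0 hC'] := taylor_bound L (Ck_derive gk).
exists (C * 3 ^+ m + 13 * C + 2 * C'), (m + m).+1; split => [|s0 h t hp s0L sL tL].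
  by rewrite !addr_ge0 ?mulr_ge0 ?exprn_ge0.
have hm : 0 <= h ^+ m by rewrite exprn_ge0 // ltW.
have two_step b : exists2 Q2 : {poly R}, (size Q2 <= m)%N &
    forall s, s != t -> (g s - g t - derive1 g t * (s - t)) / (s - t) ^+ 2 - Q2.[s] =
     (g s - (taylor_poly m.+2 g b).[s]) / (s - t) ^+ 2
     - (g t - (taylor_poly m.+2 g b).[t]) / (s - t) ^+ 2
     - (derive1 g t - (taylor_poly m.+1 (derive1 g) b).[t]) / (s - t).
  pose P := taylor_poly m.+2 g b; rewrite -deriv_taylor_poly -/P.
  have [Q sQ PE] := poly_divided_difference P t.
  have [Q2 sQ2 QE] := poly_divided_difference Q t.
  exists Q2.
    apply: leq_trans sQ2 _; rewrite -subn1 leq_subLR add1n; apply: leq_trans sQ _.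
    by rewrite -subn1 leq_subLR add1n; exact: size_taylor_poly.
  (* The first quotient takes at [t] the value of the derivative of [P], that is, of the Taylor
     polynomial of [derive1 g]; hence the simple pole has a Taylor remainder of [derive1 g] as
     coefficient. *)
  have -> : (P^`()%R).[t] = Q.[t].
    by rewrite {1}PE derivD derivC derivM derivXsubC !hornerE subrr mulr0 ?add0r ?addr0 ?mulr1.
  move=> s st; have st0 : s - t != 0 by rewrite subr_eq0.
  have -> : P.[s] = P.[t] + (Q.[t] + Q2.[s] * (s - t)) * (s - t).
    by rewrite {1}PE hornerD hornerM hornerC hornerXsubC {1}QE hornerD hornerM hornerC hornerXsubC.
  by field.
have [near|far] := leP `|s0 - t| (2 * h).
  have [Q2 sQ2 QE] := two_step t; exists Q2; first by apply: leq_trans sQ2 _; rewrite leqW // leq_addr.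
  move=> s hs st; have st0 : s - t != 0 by rewrite subr_eq0.
  rewrite QE // !taylor_poly_base // !subrr !mul0r !subr0.
  have st3 : `|s - t| <= 3 * h.
    rewrite (_ : s - t = (s - s0) + (s0 - t)); last by ring.
    by apply: le_trans (ler_normD _ _) _; lra.
  rewrite normrM normfV normrX ler_pdivrMr ?exprn_gt0 ?normr_gt0 //.
  apply: le_trans (hC t s tL (sL s hs)) _.
  rewrite -addn2 exprD mulrA ler_wpM2r ?exprn_ge0 //.
  have : `|s - t| ^+ m <= (3 * h) ^+ m by rewrite lerXn2r ?nnegrE // mulr_ge0 // ltW.
  move/(ler_wpM2l C0)/le_trans; apply; rewrite exprMn.
  have Ch : 0 <= C * h ^+ m by exact: mulr_ge0.
  have C'h : 0 <= C' * h ^+ m by exact: mulr_ge0.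
  by rewrite !mulrDl; lra.
have [Q2 sQ2 QE] := two_step s0.
have [w sw hw] := pole_approx m hp far.
set a := s0 - t in far hw.
have na0 : 0 < `|a| by apply: le_lt_trans far; rewrite mulr_ge0 // ltW.
pose rt := g t - (taylor_poly m.+2 g s0).[t].
pose rt' := derive1 g t - (taylor_poly m.+1 (derive1 g) s0).[t].
have rtC : `|rt| <= C * `|a| ^+ m.+2 by rewrite /a (distrC s0); exact: hC.
have rtC' : `|rt'| <= C' * `|a| ^+ m.+1 by rewrite /a (distrC s0); exact: hC'.
exists (Q2 - rt *: w ^+ 2 - rt' *: w).
  apply: leq_trans (size_polyD _ _) _; rewrite size_polyN geq_max; apply/andP; split.
    apply: leq_trans (size_polyD _ _) _; rewrite size_polyN geq_max; apply/andP; split.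
      by apply: leq_trans sQ2 _; rewrite leqW // leq_addr.
    apply: leq_trans (size_scale_leq _ _) _; rewrite expr2.
    apply: leq_trans (size_polyMleq _ _) _; apply: leq_trans (leq_pred _) _.
    by rewrite leqW // leq_add.
  by apply: leq_trans (size_scale_leq _ _) _; apply: leq_trans sw _; rewrite leqW // leq_addr.
move=> s hs st; have st0 : s - t != 0 by rewrite subr_eq0.
have [w1 w2 w3 w4] := hw s hs.
have -> : (g s - g t - derive1 g t * (s - t)) / (s - t) ^+ 2 - (Q2 - rt *: w ^+ 2 - rt' *: w).[s] =
    (g s - (taylor_poly m.+2 g s0).[s]) / (s - t) ^+ 2
    - rt * (((s - t)^-1 - w.[s]) * ((s - t)^-1 + w.[s])) - rt' * ((s - t)^-1 - w.[s]).
  have := QE s st; rewrite -/rt -/rt' => /(canRL (subrK _)) ->.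
  by rewrite !(hornerD, hornerN, hornerZ, horner_exp); field.
have e1 : `|(g s - (taylor_poly m.+2 g s0).[s]) / (s - t) ^+ 2| <= C * h ^+ m.
  rewrite normrM normfV normrX ler_pdivrMr ?exprn_gt0 ?normr_gt0 //.
  apply: le_trans (hC s0 s s0L (sL s hs)) _.
  rewrite -addn2 exprD -mulrA ler_wpM2l // ler_pM ?exprn_ge0 //.
    by rewrite lerXn2r ?nnegrE // ltW.
  by rewrite lerXn2r ?nnegrE // (le_trans hs).
(* The difference of squares is factored: one factor is the error of [w], of size
   [2 / |a| * (h / |a|) ^+ m], the other is at most [6 / |a|], whence the constant 12. *)
have e2 : `|rt * (((s - t)^-1 - w.[s]) * ((s - t)^-1 + w.[s]))| <= 12 * C * h ^+ m.
  have e3 : `|(s - t)^-1 + w.[s]| <= 6 / `|a|.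
    apply: le_trans (ler_normD _ _) _.
    have -> : 6 / `|a| = 2 / `|a| + 4 / `|a| by field; rewrite gt_eqF.
    exact: lerD.
  rewrite !normrM; apply: le_trans (ler_pM _ _ rtC (ler_pM _ _ w4 e3)) _ => //.
  have am0 : `|a| ^+ m != 0 by rewrite expf_neq0 ?gt_eqF.
  rewrite exprMn exprVn !exprS le_eqVlt; apply/orP; left; apply/eqP.
  by move: (`|a| ^+ m) am0 => X X0; field; rewrite X0 gt_eqF.
have e4 : `|rt' * ((s - t)^-1 - w.[s])| <= 2 * C' * h ^+ m.
  rewrite normrM; apply: le_trans (ler_pM _ _ rtC' w4) _ => //.
  have am0 : `|a| ^+ m != 0 by rewrite expf_neq0 ?gt_eqF.
  rewrite exprMn exprVn !exprS le_eqVlt; apply/orP; left; apply/eqP.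
  by move: (`|a| ^+ m) am0 => X X0; field; rewrite X0 gt_eqF.
apply: le_trans (ler_normB _ _) _; apply: le_trans (lerD (ler_normB _ _) (lexx _)) _.
have : 0 <= C * 3 ^+ m * h ^+ m by rewrite !mulr_ge0 // exprn_ge0.
by move: e1 e2 e4; rewrite !mulrDl; lra.
Qed.

End DividedDifferences.

(** * The kernel in a chart *)

Section Interpolation.
Local Open Scope classical_set_scope.
Variable R : realType.

Lemma horner_bounded (p : {poly R}) : exists2 B : R, 0 <= B & forall v, `|v| <= 1 -> `|p.[v]| <= B.
Proof. by have [B B0 hB] := continuous_bounded 1 (@continuous_horner R p); exists B. Qed.

(** Lagrange interpolation. The order of the quantifiers matters: the coefficients [c] depend only
    on [v], while [f] and [p] will vary with the pole. [Lam] plays the role of a Lebesgue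
    constant. *)
Lemma interpolation M : exists (u : 'I_M -> R) (Lam : R),
  [/\ 0 <= Lam, forall j, `|u j| <= 1 & forall v, `|v| <= 1 -> exists c : 'I_M -> R,
    forall (f : R -> R) (p : {poly R}) e, (size p <= M)%N -> `|f v - p.[v]| <= e ->
      (forall j, `|f (u j) - p.[u j]| <= e) -> `|f v - \sum_j c j * f (u j)| <= (1 + Lam) * e].
Proof.
case: M => [|M].
  exists (fun=> 0), 0; split => [//|j|v _]; first by rewrite normr0.
  exists (fun=> 0) => f p e; rewrite leqn0 size_poly_eq0 => /eqP -> + _.
  by rewrite horner0 subr0 big_ord0 subr0 addr0 mul1r.
(* An injective sequence in [[-1, 1]]; no better nodes are sought because [Lam] may depend on
   [M]. *)
pose x (j : nat) : R := j.+1%:R^-1.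
have x_inj : injective x.
  by move=> i j /invr_inj /eqP; rewrite eqr_nat eqSS => /eqP.
have /choice[B hB] : forall j : 'I_M.+1, exists B : R, 0 <= B /\
    forall v, `|v| <= 1 -> `|(tnth (qpoly.lagrange M.+1 x) j : {poly R}).[v]| <= B.
  by move=> j; have [B B0 hB] := horner_bounded (tnth (qpoly.lagrange M.+1 x) j); exists B.
exists (fun j => x j), (\sum_j B j); split => [|j|v v1].
- by apply: sumr_ge0 => j _; have [] := hB j.
- by rewrite /x normfV normr_nat invf_le1 ?ler1n ?ltr0n.
exists (fun j => (tnth (qpoly.lagrange M.+1 x) j : {poly R}).[v]) => f p e sp fv fu.
have e0 : 0 <= e by exact: le_trans fv.
have pE : p.[v] = \sum_j (tnth (qpoly.lagrange M.+1 x) j : {poly R}).[v] * p.[x j].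
  rewrite {1}(qpoly.lagrange_gen (ltn0Sn M) x_inj sp) horner_sum; apply: eq_bigr => j _.
  by rewrite hornerM hornerC mulrC.
(* Interpolation reproduces [p], so only the errors [f - p] at [v] and at the nodes remain. *)
have -> : f v - \sum_j (tnth (qpoly.lagrange M.+1 x) j : {poly R}).[v] * f (x j) =
    (f v - p.[v]) - \sum_j (tnth (qpoly.lagrange M.+1 x) j : {poly R}).[v] * (f (x j) - p.[x j]).
  rewrite {1}pE -addrA; congr (_ + _); rewrite -opprD; congr (- _).
  by rewrite -big_split; apply: eq_bigr => j _ /=; ring.
apply: le_trans (ler_normB _ _) _; rewrite mulrDl mul1r; apply: lerD => //.
apply: le_trans (ler_norm_sum _ _ _) _; rewrite mulr_suml; apply: ler_sum => j _.
by rewrite normrM ler_pM //; have [_] := hB j; exact.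
Qed.

Lemma scaled_interpolation M : exists (u : 'I_M -> R) (Lam : R),
  [/\ 0 <= Lam, forall j, `|u j| <= 1 & forall s0 h s, 0 < h -> `|s - s0| <= h ->
    exists c : 'I_M -> R,
    forall (f : R -> R) (p : {poly R}) e, (size p <= M)%N -> `|f s - p.[s]| <= e ->
      (forall j, `|f (s0 + h * u j) - p.[s0 + h * u j]| <= e) ->
      `|f s - \sum_j c j * f (s0 + h * u j)| <= (1 + Lam) * e].
Proof.
have [u [Lam [L0 u1 H]]] := interpolation M.
exists u, Lam; split => // s0 h s h0 sh.
have [|c hc] := H ((s - s0) / h).
  by rewrite normrM normfV (gtr0_norm h0) ler_pdivrMr // mul1r.
exists c => f p e sp fs fu.
have sE : s0 + h * ((s - s0) / h) = s by field; rewrite gt_eqF.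
pose q : {poly R} := p \Po (s0%:P + h *: 'X).
have qE v : q.[v] = p.[s0 + h * v] by rewrite /q horner_comp !hornerE.
have sq : (size q <= M)%N.
  apply: leq_trans sp; rewrite /q.
  have [->|p0] := eqVneq p 0; first by rewrite comp_poly0 size_poly0.
  have s2 : size (s0%:P + h *: 'X : {poly R}) = 2%N.
    by rewrite addrC -mul_polyC -[h%:P * 'X]addr0 -[_ + 0 + _]/(_ + s0%:P) addr0 size_MXaddC polyC_eq0 gt_eqF //= size_polyC gt_eqF.
  by rewrite size_comp_poly2.
have := hc (fun v => f (s0 + h * v)) q e sq; rewrite !qE sE; apply => //.
by move=> j; rewrite qE; exact: fu.
Qed.

End Interpolation.

Section PlanarKernel.
Local Open Scope classical_set_scope.
Variable R : realType.
Implicit Types (g : R -> R) (s t : R).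

Definition planar_kernel g (y n : R * R) s : R :=
  ((s - y.1) * n.1 + (g s - y.2) * n.2) / ((s - y.1) ^+ 2 + (g s - y.2) ^+ 2).

Variables (m : nat) (g : R -> R) (L : R).
Hypothesis gk : Ck m.+2 g.

Lemma difference_bound : exists2 C, 0 <= C & forall s t, `|s| <= L -> `|t| <= L ->
  `|g s - g t| <= C * `|s - t|.
Proof.
have [C C0 hC] := taylor_bound L (Ck_le (isT : (1 <= m.+2)%N) gk).
exists C => // s t sL tL; have := hC t s tL sL.
by rewrite /taylor_poly big_ord_recl big_ord0 addr0 expr0 hornerZ hornerC mulr1 divr1 expr1.
Qed.

Lemma second_difference_bound : exists2 C, 0 <= C & forall s t, `|s| <= L -> `|t| <= L ->
  `|g s - g t - derive1 g t * (s - t)| <= C * `|s - t| ^+ 2.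
Proof.
have [C C0 hC] := taylor_bound L (Ck_le (isT : (2 <= m.+2)%N) gk).
exists C => // s t sL tL; have := hC t s tL sL.
rewrite /taylor_poly !big_ord_recl big_ord0 addr0 expr0 expr1.
rewrite hornerD !hornerZ hornerC hornerXsubC mulr1 divr1 /= divr1.
by rewrite opprD addrA.
Qed.

(** The parameters over which the approximation is uniform: an interval of half-length [pc_width], a
    pole and a normal. *)
Record piece := Piece {
  pc_center : R; pc_width : R; pc_pole : R * R; pc_normal : R * R;
  pc_width_gt0 : 0 < pc_width; pc_width_le1 : pc_width <= 1;
  pc_range : forall s, `|s - pc_center| <= pc_width -> `|s| <= L;
  pc_normal_le1 : `|pc_normal.1| <= 1 /\ `|pc_normal.2| <= 1 }.

Definition pc_dom (i : piece) s := `|s - pc_center i| <= pc_width i.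

Lemma pc_center_dom i : pc_dom i (pc_center i).
Proof. by rewrite /pc_dom subrr normr0 ltW // pc_width_gt0. Qed.

Lemma pc_dist i s s' : pc_dom i s -> pc_dom i s' -> `|s - s'| <= 2 * pc_width i.
Proof.
rewrite /pc_dom => h1 h2; have -> : s - s' = (s - pc_center i) - (s' - pc_center i) by ring.
by apply: le_trans (ler_normB _ _) _; lra.
Qed.

Lemma square_osc (f : R -> R) (s s' A e : R) : `|f s| <= A -> `|f s'| <= A -> `|f s - f s'| <= e ->
  `|f s ^+ 2 - f s' ^+ 2| <= e * (2 * A).
Proof.
move=> h1 h2 h3; rewrite subr_sqr normrM; apply: ler_pM => //.
by apply: le_trans (ler_normD _ _) _; lra.
Qed.

(** With its denominator bounded below by [r], the kernel is built by arithmetic from [s], [g s] and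
    bounded constants, so it inherits their approximability. *)
Lemma far_kernel_approx (Y r : R) : 0 < r -> exists C M, 0 <= C /\
  forall i : piece, `|(pc_pole i).1| <= Y -> `|(pc_pole i).2| <= Y ->
  (forall s, pc_dom i s -> r <= (s - (pc_pole i).1) ^+ 2 + (g s - (pc_pole i).2) ^+ 2) ->
  exists2 p : {poly R}, (size p <= M)%N & forall s, pc_dom i s ->
    let F := planar_kernel g (pc_pole i) (pc_normal i) in
    `|F s| <= C /\ `|F s - p.[s]| <= C * pc_width i ^+ m.
Proof.
move=> r0.
(* The restrictions on the pole are put into the index type, so that the uniformity in [poly_approx]
   extends exactly over the admissible pieces. *)
pose I := {i : piece | [/\ `|(pc_pole i).1| <= Y, `|(pc_pole i).2| <= Y &
  forall s, pc_dom i s -> r <= (s - (pc_pole i).1) ^+ 2 + (g s - (pc_pole i).2) ^+ 2]}.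
pose S (i : I) := pc_dom (sval i).
pose h (i : I) := pc_width (sval i).
have h0 i : 0 <= h i by rewrite ltW // pc_width_gt0.
have h1 i : h i <= 1 by exact: pc_width_le1.
have SL i s : S i s -> `|s| <= L by exact: pc_range.
have aid : poly_approx S h m (fun i s => s).
  exists `|L|, 2%N; split => // i; exists 'X; rewrite ?size_polyX // => s Ss.
  rewrite hornerX subrr normr0 mulr_ge0 ?exprn_ge0 //; split => //.
  exact: le_trans (SL i s Ss) (ler_norm _).
have [G G0 hG] := continuous_bounded L (Ck_continuous gk).
have ag : poly_approx S h m (fun i s => g s).
  have [C C0 hC] := taylor_bound L (Ck_le (leqW (leqnSn m)) gk).
  exists (G + C), m; split; first exact: addr_ge0.
  move=> i; exists (taylor_poly m g (pc_center (sval i))); first exact: size_taylor_poly.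
  move=> s Ss; split; first by apply: le_trans (hG s (SL i s Ss)) _; rewrite lerDl.
  apply: le_trans (hC _ _ (SL i _ (pc_center_dom _)) (SL i s Ss)) _.
  by rewrite ler_pM ?exprn_ge0 ?lerDr // lerXn2r ?nnegrE.
have cst (c : piece -> R) C : (forall i : I, `|c (sval i)| <= C) ->
    poly_approx S h m (fun i _ => c (sval i)).
  by move=> hc; exact: (poly_approx_cst _ _ h0 hc).
have ay1 : poly_approx S h m (fun i s => s - (pc_pole (sval i)).1).
  apply: poly_approx_add => //; apply: poly_approx_opp => //.
  by apply: (cst (fun i => (pc_pole i).1) Y) => -[i []].
have ay2 : poly_approx S h m (fun i s => g s - (pc_pole (sval i)).2).
  apply: poly_approx_add => //; apply: poly_approx_opp => //.
  by apply: (cst (fun i => (pc_pole i).2) Y) => -[i []].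
have an1 : poly_approx S h m (fun i s => (pc_normal (sval i)).1).
  by apply: (cst (fun i => (pc_normal i).1) 1) => i; have [] := pc_normal_le1 (sval i).
have an2 : poly_approx S h m (fun i s => (pc_normal (sval i)).2).
  by apply: (cst (fun i => (pc_normal i).2) 1) => i; have [] := pc_normal_le1 (sval i).
have aF : poly_approx S h m (fun i s => planar_kernel g (pc_pole (sval i)) (pc_normal (sval i)) s).
  apply: poly_approx_mul => //.
    by apply: poly_approx_add => //; exact: poly_approx_mul.
  have [D D0 hD] := difference_bound.
  apply: (@poly_approx_inv _ _ _ _ _ h0 h1 _ r (2 * (2 * (L + Y)) + 2 * D * (2 * (G + Y)))) => //.
  - by apply: poly_approx_add => //; exact: poly_approx_exp.
  - by move=> [i [i1 i2 i3]] s Ss; exact (i3 s Ss).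
  move=> [i [i1 i2 i3]] s s' Ss Ss'; rewrite /h /=.
  have d := pc_dist Ss Ss'; have sL := pc_range Ss; have s'L := pc_range Ss'.
  have q1 : `|(s - (pc_pole i).1) ^+ 2 - (s' - (pc_pole i).1) ^+ 2| <=
      2 * pc_width i * (2 * (L + Y)).
    apply: (@square_osc (fun s => s - (pc_pole i).1)).
    + by apply: le_trans (ler_normB _ _) _; exact: lerD.
    + by apply: le_trans (ler_normB _ _) _; exact: lerD.
    + by rewrite opprB addrA subrK.
  have q2 : `|(g s - (pc_pole i).2) ^+ 2 - (g s' - (pc_pole i).2) ^+ 2| <=
      D * (2 * pc_width i) * (2 * (G + Y)).
    apply: (@square_osc (fun s => g s - (pc_pole i).2)).
    + by apply: le_trans (ler_normB _ _) _; apply: lerD => //; exact: hG.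
    + by apply: le_trans (ler_normB _ _) _; apply: lerD => //; exact: hG.
    + rewrite opprB addrA subrK; apply: le_trans (hD _ _ sL s'L) _.
      by rewrite ler_wpM2l.
  rewrite opprD addrACA; apply: le_trans (ler_normD _ _) _.
  by apply: le_trans (lerD q1 q2) _; rewrite le_eqVlt; apply/orP; left; apply/eqP; ring.
have [C [M [C0 hC]]] := aF.
by exists C, M; split => // i i1 i2 i3; have [p sp hp] := hC (exist _ i (And3 i1 i2 i3)); exists p.
Qed.

(** The normal is a multiple of [(g' t, -1)], so the first-order term of the numerator cancels.
    Dividing numerator and denominator by [(s - t) ^+ 2] gives [- c] times the second difference
    quotient over [1 + q ^+ 2], and this denominator is at least 1. *)
Lemma near_kernel_approx : exists C M, 0 <= C /\
  forall (i : piece) t c, `|t| <= L -> `|c| <= 1 -> pc_pole i = (t, g t) ->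
  pc_normal i = (c * derive1 g t, - c) ->
  exists2 p : {poly R}, (size p <= M)%N & forall s, pc_dom i s -> s != t ->
    let F := planar_kernel g (pc_pole i) (pc_normal i) in
    `|F s| <= C /\ `|F s - p.[s]| <= C * pc_width i ^+ m.
Proof.
pose I := {z : piece * R * R | [/\ `|z.1.2| <= L & `|z.2| <= 1]}.
pose S (z : I) s := pc_dom (sval z).1.1 s /\ s != (sval z).1.2.
pose h (z : I) := pc_width (sval z).1.1.
have h0 i : 0 <= h i by rewrite ltW // pc_width_gt0.
have h1 i : h i <= 1 by exact: pc_width_le1.
have SL i s : S i s -> `|s| <= L by move=> [/pc_range].
have hm0 i : 0 <= h i ^+ m by exact: exprn_ge0.
have cL (i : I) : `|pc_center (sval i).1.1| <= L by exact: pc_range (pc_center_dom _).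
pose q (i : I) s := (g s - g (sval i).1.2) / (s - (sval i).1.2).
pose N (i : I) s := (g s - g (sval i).1.2 - derive1 g (sval i).1.2 * (s - (sval i).1.2)) / (s - (sval i).1.2) ^+ 2.
have [D D0 hD] := difference_bound.
have qD i s : S i s -> `|q i s| <= D.
  case: i => [[[i t] c] [/= tL c1]] Ss; have sL := SL _ _ Ss; case: Ss => /= Ss st.
  rewrite /q /= normrM normfV ler_pdivrMr ?normr_gt0 ?subr_eq0 //; exact: hD.
have aq : poly_approx S h m q.
  have [C C0 hC] := divided_difference_approx L (Ck_le (leqnSn m.+1) gk).
  exists (D + C), m; split; first exact: addr_ge0.
  move=> i; have [p sp hp] := hC _ _ (sval i).1.2 (pc_width_gt0 (sval i).1.1) (cL i)
    (@pc_range (sval i).1.1) (let: conj a _ := svalP i in a).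
  exists p => // s Ss; split; first by apply: le_trans (qD i s Ss) _; rewrite lerDl.
  case: (Ss) => S1 S2; apply: le_trans (hp s S1 S2) _.
  by apply: (ler_wpM2r (hm0 i)); rewrite lerDr.
(* The approximation of order 1 uses a polynomial of size at most 1, a constant; this shows that [q]
   oscillates by [O(h)] on a piece. *)
have qosc : exists L', forall i s s', S i s -> S i s' -> `|q i s - q i s'| <= L' * h i.
  have [C C0 hC] := divided_difference_approx L (Ck_le (isT : (2 <= m.+2)%N) gk).
  exists (2 * C) => i s s' [S1 S2] [S1' S2'].
  have [p sp hp] := hC _ _ (sval i).1.2 (pc_width_gt0 (sval i).1.1) (cL i)
    (@pc_range (sval i).1.1) (let: conj a _ := svalP i in a).
  have := hp s S1 S2; have := hp s' S1' S2'.
  rewrite (size1_polyC sp) !hornerC expr1 => e1 e2.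
  rewrite /h (_ : q i s - q i s' = (q i s - p`_0) - (q i s' - p`_0)); last by ring.
  apply: le_trans (ler_normB _ _) _; apply: le_trans (lerD e2 e1) _.
  by rewrite le_eqVlt; apply/orP; left; apply/eqP; ring.
have aN : poly_approx S h m N.
  have [C [M [C0 hC]]] := second_difference_approx L gk.
  have [E E0 hE] := second_difference_bound.
  exists (E + C), M; split; first exact: addr_ge0.
  move=> i; have [p sp hp] := hC _ _ (sval i).1.2 (pc_width_gt0 (sval i).1.1) (cL i)
    (@pc_range (sval i).1.1) (let: conj a _ := svalP i in a).
  exists p => // s Ss; have sL := SL _ _ Ss; case: (Ss) => S1 S2; split.
    rewrite /N normrM normfV normrX ler_pdivrMr ?exprn_gt0 ?normr_gt0 ?subr_eq0 //.
    apply: le_trans (hE _ _ sL (let: conj a _ := svalP i in a)) _.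
    by rewrite ler_wpM2r ?exprn_ge0 // lerDl.
  by apply: le_trans (hp s S1 S2) _; apply: (ler_wpM2r (hm0 i)); rewrite lerDr.
have aF : poly_approx S h m (fun i s => - (sval i).2 * (N i s * (1 + q i s ^+ 2)^-1)).
  apply: poly_approx_mul => //.
    apply: (@poly_approx_cst _ _ S h m h0 (fun i => - (sval i).2) 1) => i.
    by rewrite normrN; have [] := svalP i.
  apply: poly_approx_mul => //.
  have [L' hL'] := qosc.
  apply: (@poly_approx_inv _ _ _ _ _ h0 h1 _ 1 (L' * (2 * D))) => //.
  - apply: poly_approx_add; last exact: poly_approx_exp.
    by apply: (@poly_approx_cst _ _ S h m h0 (fun=> 1) 1) => i; rewrite normr1.
  - by move=> i s Ss; rewrite lerDl sqr_ge0.
  move=> i s s' Ss Ss'; rewrite opprD addrACA subrr add0r mulrAC.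
  by apply: square_osc; [exact: qD|exact: qD|exact: hL'].
have [C [M [C0 hC]]] := aF.
exists C, M; split => // i t c tL c1 yE nE.
have [p sp hp] := hC (exist _ (i, t, c) (conj tL c1)); exists p => // s Ss st.
have := hp s (conj Ss st); rewrite /N /q /h /=.
suff -> : - c * ((g s - g t - derive1 g t * (s - t)) / (s - t) ^+ 2 * (1 + ((g s - g t) / (s - t)) ^+ 2)^-1) =
   planar_kernel g (pc_pole i) (pc_normal i) s by [].
have st0 : s - t != 0 by rewrite subr_eq0.
have n1 : (s - t) ^+ 2 + (g s - g t) ^+ 2 != 0.
  by rewrite gt_eqF // ltr_wpDr ?sqr_ge0 // exprn_even_gt0.
rewrite /planar_kernel yE nE /=; field.
by rewrite st0 n1.
Qed.

End PlanarKernel.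

(** * Interpolation along the boundary *)

Section PlaneTopology.
Local Open Scope classical_set_scope.
Variable R : realType.
Implicit Types (U V K : set (R * R)) (x y p : R * R).

Lemma ball_plane p (e : R) x : ball p e x <-> `|p.1 - x.1| < e /\ `|p.2 - x.2| < e.
Proof. by rewrite /ball /= /prod_ball -!ball_normE /ball_. Qed.

Lemma open_ballP U p : open U -> U p -> exists2 e : R, 0 < e & ball p e `<=` U.
Proof. by move=> oU Up; have /nbhs_ballP[e e0 he] := open_nbhs_nbhs (conj oU Up); exists e. Qed.

(** The plane carries the product sigma-algebra, so an open set is exhibited as the countable union
    of the rational boxes it contains. *)
Lemma open_measurable_plane U : open U -> measurable U.
Proof.
move=> oU.
pose I := ((rat * rat) * (rat * rat))%type.
pose box (q : I) : set (R * R) :=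
  `]ratr q.1.1, ratr q.1.2[%classic `*` `]ratr q.2.1, ratr q.2.2[%classic.
pose F (q : I) := if pselect (box q `<=` U) then box q else set0.
have -> : U = \bigcup_q F q.
  apply/seteqP; split => [x Ux|x [q _]]; last by rewrite /F; case: pselect => // h /h.
  have [e e0 he] := open_ballP oU Ux.
  have lo (a : R) : a - e < a by rewrite ltrBlDr ltrDl.
  have hi (a : R) : a < a + e by rewrite ltrDl.
  have [q1 q1P] := rat_in_itvoo (lo x.1); have [q2 q2P] := rat_in_itvoo (hi x.1).
  have [q3 q3P] := rat_in_itvoo (lo x.2); have [q4 q4P] := rat_in_itvoo (hi x.2).
  move: q1P q2P q3P q4P; rewrite !in_itv /= => /andP[a1 a2] /andP[b1 b2] /andP[c1 c2] /andP[d1 d2].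
  exists ((q1, q2), (q3, q4)) => //; rewrite /F; case: pselect => [h|[]].
    by rewrite /box /= !in_itv /= a2 b1 c2 d1.
  move=> y [] /=; rewrite !in_itv /= => /andP[y1 y2] /andP[y3 y4]; apply: he.
  apply/ball_plane; split; rewrite ltr_distl; lra.
apply: countable_bigcupT_measurable => [|q]; first exact: countableP.
rewrite /F; case: pselect => [h|h]; last exact: measurable0.
by apply: measurableX; exact: measurable_itv.
Qed.

Lemma boundary_closed (Omega : set (R * R)) : closed (boundary Omega).
Proof.
rewrite /boundary setDE; apply: closedI; first exact: closed_closure.
by rewrite closedC; exact: open_interior.
Qed.

Lemma bounded_region_bound (Omega : set (R * R)) : bounded_set Omega ->
  exists2 Y : R, 0 <= Y & forall x, boundary Omega x -> `|x.1| <= Y /\ `|x.2| <= Y.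
Proof.
move=> [M [_ hM]]; pose Y := `|M| + 1; exists Y; first by rewrite addr_ge0.
have MY : M < Y by rewrite /Y; apply: le_lt_trans (ler_norm _) _; rewrite ltrDl.
move=> x [xc _].
have hx : forall e : R, 0 < e -> `|x.1| <= Y + e /\ `|x.2| <= Y + e.
  move=> e e0; have [y [Oy /ball_plane[b1 b2]]] := xc _ (nbhsx_ballx x e e0).
  have := hM Y MY y Oy; rewrite /= prod_normE ge_max => /andP[y1 y2].
  have t1 : `|x.1| <= `|x.1 - y.1| + `|y.1| by rewrite -{1}(subrK y.1 x.1) ler_normD.
  have t2 : `|x.2| <= `|x.2 - y.2| + `|y.2| by rewrite -{1}(subrK y.2 x.2) ler_normD.
  by split; lra.
by split; apply/ler_addgt0Pr => e /hx[].
Qed.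

Lemma boundary_compact (Omega : set (R * R)) : bounded_set Omega -> compact (boundary Omega).
Proof.
move=> /bounded_region_bound[Y Y0 hY].
apply: (@subclosed_compact _ _ (`[- Y, Y]%classic `*` `[- Y, Y]%classic)).
- exact: boundary_closed.
- by apply: compact_setX; exact: segment_compact.
- by move=> x /hY[h1 h2]; split; rewrite /= in_itv /= -ler_norml.
Qed.

(** The finite subcover argument in the form of an induction principle; it globalizes both the
    interpolation and the regularity of the line element and the normal. *)
Lemma compact_local_ind K (P : set (R * R) -> Prop) : compact K ->
  P set0 -> (forall A B, P A -> P B -> P (A `|` B)) ->
  (forall p, K p -> exists W, [/\ open W, W p & P W]) ->
  exists2 W, K `<=` W & P W.
Proof.
move=> Kc P0 PU Ploc.
have /choice[W hW] : forall p, exists W, K p -> [/\ open W, W p & P W].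
  move=> p; case: (pselect (K p)) => [Kp|nKp]; last by exists set0.
  by have [W hW] := Ploc p Kp; exists W.
(* [compact_cover] is applied to the plane equipped with a base point. *)
pose T0 : ptopologicalType := HB.pack (R * R)%type (isPointed.Build (R * R)%type (0, 0)).
have : @cover_compact T0 K by rewrite -(@compact_cover T0).
move=> /(_ _ K W) [].
- by move=> p /hW[].
- by move=> p Kp; exists p => //; have [] := hW p Kp.
move=> D DK KD; exists (cover [set` D] W) => //.
have -> : cover [set` D] W = \big[setU/set0]_(i <- enum_fset D) W i.
  by rewrite /cover bigcup_fset.
have {KD} : forall p, p \in enum_fset D -> K p.
  by move=> p pD; have := DK p pD; rewrite inE.
elim: (enum_fset D) => [|p s ih] sK; first by rewrite big_nil.
rewrite big_cons; apply: PU.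
  by have [] := hW p (sK p (mem_head _ _)).
by apply: ih => q qs; apply: sK; rewrite in_cons qs orbT.
Qed.

End PlaneTopology.

Section Frame.
Local Open Scope classical_set_scope.
Variable R : realType.
Implicit Types (x y p : R * R).

Lemma dotBl x y z : dot (x - y) z = dot x z - dot y z :> R.
Proof. by rewrite /dot /=; ring. Qed.

Lemma dotDl x y z : dot (x + y) z = dot x z + dot y z :> R.
Proof. by rewrite /dot /=; ring. Qed.

Lemma dotZl (c : R) x z : dot (c *: x) z = c * dot x z.
Proof. by rewrite mulrDr !mulrA. Qed.

Lemma dot_sym x y : dot x y = dot y x :> R.
Proof. by rewrite /dot mulrC [in X in _ + X]mulrC. Qed.

Lemma dot_gt0 x : x != 0 -> 0 < dot x x :> R.
Proof.
case: x => a b; rewrite /dot /= -[0]/(0, 0) xpair_eqE negb_and => /orP[h|h].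
  by rewrite -!expr2 ltr_wpDr ?sqr_ge0 // exprn_even_gt0.
by rewrite -!expr2 ltr_wpDl ?sqr_ge0 // exprn_even_gt0.
Qed.

Variables e1 e2 : R * R.
Hypothesis u11 : dot e1 e1 = 1.
Hypothesis u22 : dot e2 e2 = 1.
Hypothesis u12 : dot e1 e2 = 0.

Lemma sqr_sum_component (a b r : R) : 0 <= r -> a ^+ 2 + b ^+ 2 <= r ^+ 2 -> `|a| <= r /\ `|b| <= r.
Proof.
move=> r0 h; have a0 := sqr_ge0 a; have b0 := sqr_ge0 b.
by split; rewrite -ler_sqr ?nnegrE // real_normK ?num_real //; lra.
Qed.

Lemma unit_component (e : R * R) : dot e e = 1 -> `|e.1| <= 1 /\ `|e.2| <= 1.
Proof.
by rewrite /dot -!expr2 => h; apply: sqr_sum_component; rewrite ?h ?expr1n.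
Qed.

(** Orthonormal rows have orthonormal columns: [e2] is the quarter turn of [e1] times the
    determinant [D], and [D ^+ 2 = 1]. *)
Lemma frame_transpose :
  [/\ e1.1 ^+ 2 + e2.1 ^+ 2 = 1, e1.2 ^+ 2 + e2.2 ^+ 2 = 1 & e1.1 * e1.2 + e2.1 * e2.2 = 0].
Proof.
move: u11 u22 u12; rewrite /dot; case: e1 e2 => [a b] [c d] /= h1 h2 h3.
pose D := a * d - b * c.
have D2 : D ^+ 2 = 1.
  have -> : D ^+ 2 = (a * a + b * b) * (c * c + d * d) - (a * c + b * d) ^+ 2 by rewrite /D; ring.
  by rewrite h1 h2 h3; ring.
have cE : c = - b * D.
  have -> : - b * D = c * (a * a + b * b) - a * (a * c + b * d) by rewrite /D; ring.
  by rewrite h1 h3; ring.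
have dE : d = a * D.
  have -> : a * D = d * (a * a + b * b) - b * (a * c + b * d) by rewrite /D; ring.
  by rewrite h1 h3; ring.
by rewrite cE dE !exprMn D2; split; [rewrite mulr1 -h1; ring|rewrite mulr1 -h1; ring|
  transitivity (a * b * (1 - D ^+ 2)); [ring|rewrite D2; ring]].
Qed.

Lemma frame_decomp x : x = dot x e1 *: e1 + dot x e2 *: e2.
Proof.
have [h1 h2 h3] := frame_transpose.
case: x => x1 x2; rewrite [RHS]surjective_pairing; congr (_, _).
- rewrite -[RHS]/((x1 * e1.1 + x2 * e1.2) * e1.1 + (x1 * e2.1 + x2 * e2.2) * e2.1).
  transitivity (x1 * (e1.1 ^+ 2 + e2.1 ^+ 2) + x2 * (e1.1 * e1.2 + e2.1 * e2.2)); last by ring.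
  by rewrite h1 h3; ring.
- rewrite -[RHS]/((x1 * e1.1 + x2 * e1.2) * e1.2 + (x1 * e2.1 + x2 * e2.2) * e2.2).
  transitivity (x2 * (e1.2 ^+ 2 + e2.2 ^+ 2) + x1 * (e1.1 * e1.2 + e2.1 * e2.2)); last by ring.
  by rewrite h2 h3; ring.
Qed.

Lemma dot_frame x y : dot x y = dot x e1 * dot y e1 + dot x e2 * dot y e2.
Proof.
have [h1 h2 h3] := frame_transpose; rewrite /dot.
transitivity (x.1 * y.1 * (e1.1 ^+ 2 + e2.1 ^+ 2) + x.2 * y.2 * (e1.2 ^+ 2 + e2.2 ^+ 2)
  + (x.1 * y.2 + x.2 * y.1) * (e1.1 * e1.2 + e2.1 * e2.2)); last by ring.
by rewrite h1 h2 h3; ring.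
Qed.

Lemma dot_component_le x (M : R) (e : R * R) : dot e e = 1 -> `|x.1| <= M -> `|x.2| <= M ->
  `|dot x e| <= 2 * M.
Proof.
move=> /unit_component[u1 u2] x1 x2; rewrite /dot; apply: le_trans (ler_normD _ _) _.
have h1 : `|x.1 * e.1| <= M * 1 by rewrite normrM ler_pM.
have h2 : `|x.2 * e.2| <= M * 1 by rewrite normrM ler_pM.
lra.
Qed.

Lemma continuous_dot (e : R * R) : continuous (fun x : R * R => dot x e).
Proof.
move=> x; rewrite /dot; apply: (@cvgD R R).
  by apply: cvgMr_tmp; exact: cvg_fst.
by apply: cvgMr_tmp; exact: cvg_snd.
Qed.

End Frame.

Section Chart.
Local Open Scope classical_set_scope.
Variables (R : realType) (k : nat) (Omega U : set (R * R)) (e1 e2 : R * R) (g : R -> R).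
Hypothesis oO : open Omega.
Hypothesis ch : graph_chart k Omega U e1 e2 g.
Implicit Types (p x : R * R) (s t : R).

Lemma graph_chart_le l : (l <= k)%N -> graph_chart l Omega U e1 e2 g.
Proof. by case: ch => h1 h2 h3 h4 lk; split => //; exact: Ck_le h3. Qed.

Definition graph_point t : R * R := t *: e1 + g t *: e2.

Lemma graph_point_coords t : dot (graph_point t) e1 = t /\ dot (graph_point t) e2 = g t.
Proof.
case: ch => _ [u11 u22 u12] _ _; rewrite /graph_point !dotDl !dotZl u11 u22 u12.
by rewrite (dot_sym e2 e1) u12; split; ring.
Qed.

Lemma continuous_graph_point : continuous graph_point.
Proof.
case: ch => _ _ gk _ t; apply: (@cvgD R (R * R)%type).
  by apply: cvgZr_tmp; exact: cvg_id.
by apply: cvgZr_tmp; exact: Ck_continuous gk _.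
Qed.

Lemma graph_pointK x : dot x e2 = g (dot x e1) -> graph_point (dot x e1) = x.
Proof.
case: ch => _ [u11 u22 u12] _ _ h.
by rewrite /graph_point -h -(frame_decomp u11 u22 u12).
Qed.

(** A point above the graph is in the open set [Omega], and one below has a neighbourhood that
    misses it. A point on the graph is not in [Omega] but is a limit of points above it, reached by
    moving along [e2]. *)
Lemma chart_boundary p : U p -> boundary Omega p <-> dot p e2 = g (dot p e1).
Proof.
case: ch => oU [u11 u22 u12] gk chE Up.
have gc : continuous g by exact: Ck_continuous gk.
have chP x : U x -> Omega x <-> g (dot x e1) < dot x e2.
  move=> Ux; split => [Ox|h]; first by have : (Omega `&` U) x by []; rewrite chE => -[].
  by have : [set x | U x /\ g (dot x e1) < dot x e2] x by []; rewrite -chE => -[].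
rewrite /boundary ((interior_id Omega).1 oO); split => [[clp nOp]|pg].
  apply/eqP; rewrite eq_le; apply/andP; split; rewrite leNgt; apply/negP => h.
    by apply: nOp; apply/chP.
  have fc : continuous (fun x : R * R => g (dot x e1) - dot x e2).
    move=> x; apply: (@cvgB R R); last exact: continuous_dot.
    by apply: continuous_comp; [exact: continuous_dot|exact: gc].
  have N1 : nbhs p [set x : R * R | 0 < g (dot x e1) - dot x e2].
    have := fc p => /(_ [set y : R | 0 < y]); apply; apply: open_nbhs_nbhs.
    by split; [exact: open_gt|rewrite /= subr_gt0].
  have [x [Ox [Ux /= hx]]] := clp _ (filterI (open_nbhs_nbhs (conj oU Up)) N1).
  by move/(chP x Ux): Ox; move: hx; rewrite subr_gt0 => /ltW; rewrite leNgt => /negP.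
split; last by move/(chP p Up); rewrite pg ltxx.
move=> B /nbhs_ballP[e e0 eB]; have [e' e'0 eU] := open_ballP oU Up.
(* The components of [e2] are at most 1 in modulus, so a step [d] along [e2] stays in both balls. *)
pose d := Num.min e e' / 2.
have d0 : 0 < d by rewrite divr_gt0 // lt_min e0.
have [c1 c2] := unit_component u22.
have de : ball p (Num.min e e') (p + d *: e2).
  have dd : d < Num.min e e' by rewrite /d ltr_pdivrMr // ltr_pMr ?lt_min ?e0 // ltr1n.
  apply/ball_plane; split; rewrite /= opprD addNKr normrN /GRing.scale /= normrM (gtr0_norm d0);
    by apply: le_lt_trans dd; rewrite ler_piMr // ltW.
have Ud : U (p + d *: e2) by apply: eU; apply: le_ball de; rewrite ge_min lexx orbT.
exists (p + d *: e2); split; last by apply: eB; apply: le_ball de; rewrite ge_min lexx.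
apply/(chP _ Ud); rewrite !dotDl !dotZl u22 (dot_sym e2) u12 mulr0 addr0 pg mulr1.
by rewrite ltrDl.
Qed.

Lemma graph_point_boundary t : U (graph_point t) -> boundary Omega (graph_point t).
Proof. by move=> Ut; apply/(chart_boundary Ut); have [-> ->] := graph_point_coords t. Qed.

Lemma boundary_graph_point p : U p -> boundary Omega p -> graph_point (dot p e1) = p.
Proof. by move=> Up /(chart_boundary Up) h; exact: graph_pointK. Qed.

End Chart.

(** * Normal derivative of the logarithmic kernel *)

Section NormalDerivative.
Local Open Scope classical_set_scope.
Variable R : realType.

(** The closed form of the normal derivative of [log_kernel] off the diagonal. On the diagonal it is
    0, as a division by 0. *)
Definition neumann_kernel (nu : R * R -> R * R) (x y : R * R) : R :=
  pi^-1 * (dot (x - y) (nu y) / dot (x - y) (x - y)).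

Lemma ln_enorm_inv (x : R * R) : ln (enorm x)^-1 = - (2^-1 * ln (dot x x)).
Proof.
rewrite /enorm; have d0 : 0 <= dot x x by rewrite /dot -!expr2 addr_ge0 ?sqr_ge0.
have [->|dn0] := eqVneq (dot x x) 0.
  by rewrite sqrtr0 invr0 !ln0 // mulr0 oppr0.
have dp : 0 < dot x x by rewrite lt_def dn0.
have sp : 0 < Num.sqrt (dot x x) by rewrite sqrtr_gt0.
rewrite lnV ?posrE // -{2}(sqr_sqrtr d0) expr2 lnM ?posrE //.
by field.
Qed.

(** Along the line through [y] in the direction [v], the squared distance to [x] is a quadratic
    polynomial [q], so the derivative is that of a multiple of [ln q] at 0. *)
Lemma derive_log_kernel (nu : R * R -> R * R) (x y : R * R) : x != y ->
  'D_(nu y) (log_kernel x) y = neumann_kernel nu x y.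
Proof.
move=> xy; set v := nu y.
pose A := dot (x - y) (x - y); pose B := dot (x - y) v; pose C := dot v v.
have A0 : 0 < A by rewrite dot_gt0 // subr_eq0.
pose q : {poly R} := (C *: 'X - (2 * B)%:P) * 'X + A%:P.
have qE h : q.[h] = dot (x - (h *: v + y)) (x - (h *: v + y)).
  by rewrite /q !hornerE /A /B /C /dot /= /GRing.scale /=; ring.
pose F h := - pi^-1 * 2^-1 * ln q.[h] : R.
have FE h : log_kernel x (h *: v + y) = F h.
  by rewrite /log_kernel ln_enorm_inv -qE /F; ring.
have qA : q.[0] = A by rewrite qE scale0r add0r.
have q0 : 0 < q.[0] by rewrite qA.
have Fd : is_derive (0 : R) (1 : R) F (- pi^-1 * 2^-1 * ((q.[0])^-1 * q^`()%R.[0])).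
  have h1 : is_derive (0 : R) (1 : R) (@ln R \o horner q) ((q.[0])^-1 * q^`()%R.[0]).
    by apply: is_derive1_comp; exact: is_derive1_ln.
  by have := is_deriveZ (- pi^-1 * 2^-1) h1.
have -> : 'D_v (log_kernel x) y = 'D_1 F 0.
  have E : (fun h : R => h^-1 *: ((log_kernel x \o shift y) (h *: v) - log_kernel x y)) =
      (fun h : R => h^-1 *: ((F \o shift 0) (h *: 1) - F 0)).
    have e0 : log_kernel x y = F 0 by rewrite -FE scale0r add0r.
    by apply/funext => h /=; rewrite FE e0 addr0 [h *: 1]mulr1.
  by rewrite /derive E.
have dq : q^`()%R.[0] = - (2 * B).
  rewrite /q derivD derivC addr0 derivM derivX derivB derivC subr0.
  by rewrite !(hornerD, hornerN, hornerM, hornerX, hornerC, hornerZ); ring.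
rewrite derive_val dq qA /neumann_kernel -/A -/B.
by move: (pi^-1) => P; field; rewrite gt_eqF.
Qed.

End NormalDerivative.

Section PlanarInterpolation.
Local Open Scope classical_set_scope.
Variables (R : realType) (m : nat) (g : R -> R) (L : R).
Hypothesis gk : Ck m.+2 g.

(** Far poles and poles on the graph get different polynomials, but both sizes are at most
    [maxn M1 M2]; one set of nodes and coefficients therefore serves all [y]. *)
Lemma planar_interpolation (Y r : R) : 0 < r -> exists C M (u : 'I_M -> R),
  [/\ 0 <= C, forall j, `|u j| <= 1 & forall s0 h, 0 < h -> h <= 1 ->
   (forall s, `|s - s0| <= h -> `|s| <= L) -> forall s, `|s - s0| <= h ->
   exists c : 'I_M -> R, forall y n : R * R, `|n.1| <= 1 -> `|n.2| <= 1 ->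
   ([/\ `|y.1| <= Y, `|y.2| <= Y & forall s', `|s' - s0| <= h ->
       r <= (s' - y.1) ^+ 2 + (g s' - y.2) ^+ 2] \/
    [/\ `|y.1| <= L, y.2 = g y.1, n.1 = - n.2 * derive1 g y.1,
       s != y.1 & forall j, s0 + h * u j != y.1]) ->
   let F := planar_kernel g y n in
   `|F s| <= C /\ `|F s - \sum_j c j * F (s0 + h * u j)| <= C * h ^+ m].
Proof.
move=> r0.
have [C1 [M1 [C10 far]]] := @far_kernel_approx R m g L gk Y r r0.
have [C2 [M2 [C20 near]]] := @near_kernel_approx R m g L gk.
have [u [Lam [Lam0 u1 itp]]] := scaled_interpolation R (maxn M1 M2).
exists ((1 + Lam) * (C1 + C2)), (maxn M1 M2), u.
have C0 : 0 <= C1 + C2 by exact: addr_ge0.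
split; [by rewrite mulr_ge0 // addr_ge0|by []|].
move=> s0 h h0 h1 hL s sh.
have [c hc] := itp s0 h s h0 sh; exists c => y n n1 n2 yP F.
have hm : 0 <= h ^+ m by rewrite exprn_ge0 // ltW.
have Cle : C1 + C2 <= (1 + Lam) * (C1 + C2) by rewrite ler_peMl // lerDl.
have node j : `|s0 + h * u j - s0| <= h.
  by rewrite addrAC subrr add0r normrM (gtr0_norm h0) ler_piMr // ltW.
pose i := Piece y h0 h1 hL (conj n1 n2).
suff [p sp [Fs [ps pj]]] : exists2 p : {poly R}, (size p <= maxn M1 M2)%N &
    `|F s| <= C1 + C2 /\ (`|F s - p.[s]| <= (C1 + C2) * h ^+ m /\
    forall j, `|F (s0 + h * u j) - p.[s0 + h * u j]| <= (C1 + C2) * h ^+ m).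
  split; first exact: le_trans Cle.
  by rewrite -mulrA; exact: (hc F p _ sp ps pj).
case: yP => [[y1 y2 yr]|[y1 y2 nE sy jy]].
  have [p sp hp] := far i y1 y2 yr; exists p; first by rewrite leq_max sp.
  have {}hp t : `|t - s0| <= h -> `|F t| <= C1 + C2 /\ `|F t - p.[t]| <= (C1 + C2) * h ^+ m.
    move=> th; have [h2 h3] := hp t th; split; first by apply: le_trans h2 _; rewrite lerDl.
    by apply: le_trans h3 _; apply: (ler_wpM2r hm); rewrite lerDl.
  have [Fs ps] := hp s sh; split => //; split => // j; by have [] := hp _ (node j).
have [p sp hp] : exists2 p : {poly R}, (size p <= M2)%N & forall s', pc_dom i s' -> s' != y.1 ->
    `|F s'| <= C2 /\ `|F s' - p.[s']| <= C2 * h ^+ m.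
  apply: (near i y.1 (- n.2) y1); first by rewrite normrN.
    rewrite -y2; exact: surjective_pairing.
  rewrite -nE opprK; exact: surjective_pairing.
exists p; first by rewrite leq_max sp orbT.
have {}hp t : `|t - s0| <= h -> t != y.1 -> `|F t| <= C1 + C2 /\ `|F t - p.[t]| <= (C1 + C2) * h ^+ m.
  move=> th ty; have [h2 h3] := hp t th ty; split; first by apply: le_trans h2 _; rewrite lerDr.
  by apply: le_trans h3 _; apply: (ler_wpM2r hm); rewrite lerDr.
have [Fs ps] := hp s sh sy; split => //; split => // j; by have [] := hp _ (node j) (jy j).
Qed.

End PlanarInterpolation.

Section BoundaryInterpolation.
Local Open Scope classical_set_scope.
Variables (R : realType) (Omega : set (R * R)) (nu : R * R -> R * R).
Implicit Types (W : set (R * R)) (x y p : R * R).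

(** The number of nodes grows linearly in [n], and [c] is chosen before [y]. The excluded [y], where
    the kernel or a node section is singular, are finitely many points and will be null. *)
Definition interpolable m W : Prop := exists C M, 0 <= C /\
  forall n, (0 < n)%N -> exists (J : finType) (z : J -> R * R),
  [/\ (#|J| <= M * n)%N, forall j, boundary Omega (z j) &
   forall x, W x -> boundary Omega x -> exists c : J -> R,
   forall y, boundary Omega y -> y <> x -> (forall j, y <> z j) ->
   `|neumann_kernel nu x y| <= C /\
   `|neumann_kernel nu x y - \sum_j c j * neumann_kernel nu (z j) y| <= C * n%:R ^- m].

Lemma interpolable0 m : interpolable m set0.
Proof.
exists 0, 0%N; split => // n n0; exists void, (@of_void (R * R)%type).
by split => //; rewrite card_void.
Qed.

Lemma interpolableU m W1 W2 : interpolable m W1 -> interpolable m W2 ->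
  interpolable m (W1 `|` W2).
Proof.
move=> [C1 [M1 [C10 h1]]] [C2 [M2 [C20 h2]]]; exists (C1 + C2), (M1 + M2)%N.
split; first exact: addr_ge0.
move=> n n0; have [J1 [z1 [J1M z1b H1]]] := h1 n n0; have [J2 [z2 [J2M z2b H2]]] := h2 n n0.
have nm : 0 <= n%:R ^- m :> R by rewrite invr_ge0 exprn_ge0.
exists (J1 + J2)%type, (fun j => match j with inl j => z1 j | inr j => z2 j end); split.
- by rewrite card_sum mulnDl leq_add.
- by case.
move=> x [Wx|Wx] bx.
  have [c hc] := H1 x Wx bx; exists (fun j => match j with inl j => c j | inr j => 0 end).
  move=> y yb yx yz; have [||h3 h4] := hc y yb => //; first by move=> j; exact: (yz (inl j)).
  rewrite big_sumType /= [X in _ - (_ + X)]big1 ?addr0 => [|j _]; last by rewrite mul0r.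
  split; first by apply: le_trans h3 _; rewrite lerDl.
  by apply: le_trans h4 _; apply: (ler_wpM2r nm); rewrite lerDl.
have [c hc] := H2 x Wx bx; exists (fun j => match j with inr j => c j | inl j => 0 end).
move=> y yb yx yz; have [||h3 h4] := hc y yb => //; first by move=> j; exact: (yz (inr j)).
rewrite big_sumType /= [X in _ - (X + _)]big1 ?add0r => [|j _]; last by rewrite mul0r.
split; first by apply: le_trans h3 _; rewrite lerDr.
by apply: le_trans h4 _; apply: (ler_wpM2r nm); rewrite lerDr.
Qed.

Hypothesis oO : open Omega.
Hypothesis nuP : outer_unit_normal Omega nu.
Hypothesis nu1 : forall y, boundary Omega y -> dot (nu y) (nu y) = 1.
Variable Y : R.
Hypothesis bY : forall x, boundary Omega x -> `|x.1| <= Y /\ `|x.2| <= Y.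

(** Orthogonality to the tangent, unit length and the sign of [dot (nu p) e2] determine the normal.
    The third relation produces the cancellation in the kernel, the fourth the measurability of
    [nu]. *)
Lemma normal_unit U e1 e2 g k p : (0 < k)%N -> graph_chart k Omega U e1 e2 g -> U p ->
  boundary Omega p ->
  [/\ `|dot (nu p) e1| <= 1, `|dot (nu p) e2| <= 1,
      dot (nu p) e1 = - dot (nu p) e2 * derive1 g (dot p e1) &
      dot (nu p) e2 = - (Num.sqrt (1 + derive1 g (dot p e1) ^+ 2))^-1].
Proof.
move=> k0 ch Up bp; have ch1 := graph_chart_le ch k0.
have [n1 nt n2] := nuP ch1 Up bp; case: ch1 => _ [u11 u22 u12] _ _.
set a := dot (nu p) e1; set b := dot (nu p) e2; set g' := derive1 g _.
have ab : a ^+ 2 + b ^+ 2 = 1 by rewrite -n1 (dot_frame u11 u22 u12) !expr2.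
have aE : a = - b * g'.
  by move: nt; rewrite dot_sym dotDl dotZl (dot_sym e1) (dot_sym e2) -/a -/b -/g' => h; lra.
have [a1 b1] : `|a| <= 1 /\ `|b| <= 1 by apply: sqr_sum_component; rewrite ?ab ?expr1n.
split => //.
have q0 : 0 < 1 + g' ^+ 2 by rewrite ltr_pwDl // sqr_ge0.
have bb : b ^+ 2 * (1 + g' ^+ 2) = 1 by rewrite -[RHS]ab aE; ring.
have s0 : 0 < Num.sqrt (1 + g' ^+ 2) by rewrite sqrtr_gt0.
have : (- b * Num.sqrt (1 + g' ^+ 2)) ^+ 2 = 1.
  by rewrite exprMn sqrrN sqr_sqrtr // ltW.
have bs : 0 < - b * Num.sqrt (1 + g' ^+ 2) by rewrite mulr_gt0 // oppr_gt0.
move/eqP; rewrite sqrp_eq1; last exact: ltW.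
move=> /eqP h; apply: oppr_inj; rewrite opprK -[LHS](mulfK (lt0r_neq0 s0)) h mul1r //.
Qed.

Lemma neumann_kernel_graph U e1 e2 g k s y : graph_chart k Omega U e1 e2 g ->
  neumann_kernel nu (graph_point e1 e2 g s) y =
  pi^-1 * planar_kernel g (dot y e1, dot y e2) (dot (nu y) e1, dot (nu y) e2) s.
Proof.
move=> ch; have [c1 c2] := graph_point_coords ch s; case: ch => _ [u11 u22 u12] _ _.
rewrite /neumann_kernel /planar_kernel (dot_frame u11 u22 u12 _ (nu y)).
by rewrite (dot_frame u11 u22 u12 _ (_ - y)) !dotBl c1 c2 /= -!expr2.
Qed.

Lemma subdivision (s0 rho s : R) n : (0 < n)%N -> 0 < rho -> `|s - s0| < rho ->
  exists i : 'I_n, `|s - (s0 - rho + (2 * i%:R + 1) * (rho / n%:R))| <= rho / n%:R.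
Proof.
move=> n0 r0; rewrite ltr_norml => /andP[lo hi].
have n0R : 0 < n%:R :> R by rewrite ltr0n.
(* The position of [s] in units of the subinterval length [2 * rho / n]; its integer part is the
   index. *)
pose tau := (s - s0 + rho) * n%:R / (2 * rho).
have tau0 : 0 <= tau by rewrite divr_ge0 ?mulr_ge0 ?ler0n //; lra.
have taun : tau < n%:R by rewrite ltr_pdivrMr ?mulr_gt0 // mulrC ltr_pM2l //; lra.
have /andP[t1 t2] := truncn_itv tau0.
have tn : (Num.truncn tau < n)%N by rewrite -(ltr_nat R); exact: le_lt_trans t1 taun.
exists (Ordinal tn) => /=; set i := Num.truncn tau in t1 t2 *.
have sE : s = s0 - rho + 2 * tau * (rho / n%:R).
  by rewrite /tau; field; rewrite !gt_eqF.
rewrite {1}sE (_ : _ - _ = (2 * tau - (2 * i%:R + 1)) * (rho / n%:R)); last by ring.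
rewrite normrM [X in _ * X]ger0_norm ?divr_ge0 ?(ltW r0) ?ler0n // ler_piMl ?divr_ge0 ?(ltW r0) ?ler0n //.
rewrite -natr1 in t2; rewrite ler_norml; apply/andP; split; lra.
Qed.

(** Two radii separate the cases: the graph pieces stay within [r] of [p]. A boundary point [y]
    within [r' = 2 * r] of [p] lies on the same graph; any other is at distance at least [r] from
    the pieces. *)
Lemma chart_interpolable U e1 e2 g m p : graph_chart m.+2 Omega U e1 e2 g -> U p ->
  boundary Omega p -> exists W, [/\ open W, W p & interpolable m W].
Proof.
move=> ch Up bp; have [oU [u11 u22 u12] gk _] := ch.
have [r' r'0 rU] := open_ballP oU Up.
pose r := r' / 2; have r0 : 0 < r by rewrite divr_gt0.
have ball_rU y : ball p r y -> ball p r' y.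
  by apply: le_ball; rewrite ler_pdivrMr // ler_pMr // ler1n.
pose s0 := dot p e1.
have gp0 : graph_point e1 e2 g s0 = p by exact: boundary_graph_point ch _ Up bp.
have [rho [rho0 rho1 rhoB]] : exists rho : R, [/\ 0 < rho, rho <= 1 &
    forall s, `|s - s0| <= rho -> ball p r (graph_point e1 e2 g s)].
  have : nbhs s0 [set s | ball p r (graph_point e1 e2 g s)].
    have := continuous_graph_point ch (x := s0) => /(_ (ball p r)); apply.
    by rewrite gp0; exact: nbhsx_ballx.
  move=> /nbhs_ballP[e /= e0 he]; exists (Num.min 1 (e / 2)); split.
  - by rewrite lt_min ltr01 divr_gt0.
  - by rewrite ge_min lexx.
  move=> s; rewrite le_min => /andP[_ se]; apply: he.
  by rewrite -ball_normE /ball_ /= distrC; apply: le_lt_trans se _; rewrite ltr_pdivrMr // ltr_pMr // ltr1n.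
pose W := ball p r `&` [set x | `|dot x e1 - s0| < rho].
exists W; split.
- apply: openI; first exact: ball_open.
  have -> : [set x : R * R | `|dot x e1 - s0| < rho] = (fun x => `|dot x e1 - s0|) @^-1` [set t : R | t < rho] by [].
  apply: open_comp; last exact: open_lt.
  move=> x _; apply: (@continuous_comp _ _ _ (fun x : R * R => dot x e1 - s0) (fun t : R => `|t|)).
    by apply: (@cvgB R R); [exact: continuous_dot|exact: cvg_cst].
  exact: norm_continuous.
- by split; [exact: ballxx|rewrite /= subrr normr0].
(* Covers the parameters of the pieces, within [rho] of [s0], and those of the poles in the larger
   ball, within [2 * r' = 4 * r] of [s0]. *)
pose L := `|s0| + 4 * r + rho.
have rhoL s : `|s - s0| <= rho -> `|s| <= L.
  move=> h; have : `|s| <= `|s - s0| + `|s0| by rewrite -{1}(subrK s0 s) ler_normD.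
  by rewrite /L; lra.
have [C [M [u [C0 u1 itp]]]] := planar_interpolation L gk (2 * Y) (exprn_gt0 2 r0).
have ipi : 0 <= (pi : R)^-1 by rewrite invr_ge0 ltW // pi_gt0.
exists (pi^-1 * C), M; split; first exact: mulr_ge0.
move=> n n0; have n0R : 0 < n%:R :> R by rewrite ltr0n.
pose h := rho / n%:R; pose ctr (i : 'I_n) := s0 - rho + (2 * i%:R + 1) * h.
have h0 : 0 < h by rewrite divr_gt0.
have hrho : h <= rho by rewrite ler_pdivrMr // ler_peMr ?ler1n // ltW.
have pieceL i s : `|s - ctr i| <= h -> `|s - s0| <= rho.
  rewrite !ler_norml /ctr => /andP[lo hi].
  have i0 : 0 <= i%:R * h by rewrite mulr_ge0 ?ler0n // ltW.
  have ih : (i%:R + 1) * h <= rho.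
    have -> : rho = n%:R * h by rewrite /h; field; rewrite gt_eqF.
    by rewrite (ler_pM2r h0) natr1 ler_nat.
  by apply/andP; split; lra.
have nodeP i j : `|ctr i + h * u j - ctr i| <= h.
  by rewrite addrAC subrr add0r normrM (gtr0_norm h0) ler_piMr // ltW.
have nodeB i j : boundary Omega (graph_point e1 e2 g (ctr i + h * u j)).
  apply: (graph_point_boundary oO ch); apply: rU.
  exact: ball_rU (rhoB _ (pieceL _ _ (nodeP i j))).
exists ('I_n * 'I_M)%type, (fun ij => graph_point e1 e2 g (ctr ij.1 + h * u ij.2)); split.
- by rewrite card_prod !card_ord mulnC.
- by move=> [i j]; exact: nodeB.
move=> x [/= xp xs] bx.
have Ux : U x by exact: rU (ball_rU _ xp).
have xE := boundary_graph_point oO ch Ux bx.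
set s := dot x e1 in xs xE.
have [i si] := subdivision n0 rho0 xs.
have [c hc] := itp (ctr i) h h0 (le_trans hrho rho1) (fun t ht => rhoL t (pieceL i t ht)) s si.
(* Only the nodes of the piece containing [s] are used, so the constant does not grow with [n]. *)
exists (fun ij => if ij.1 == i then c ij.2 else 0) => y yb yx yz.
have hmn : h ^+ m <= n%:R ^- m.
  rewrite /h expr_div_n ler_piMl ?invr_ge0 ?exprn_ge0 // exprn_ile1 // ltW //.
have nuy : `|dot (nu y) e1| <= 1 /\ `|dot (nu y) e2| <= 1.
  have := nu1 yb; rewrite (dot_frame u11 u22 u12) => nn.
  by apply: sqr_sum_component; rewrite // expr1n !expr2 nn.
have kE t := neumann_kernel_graph t y ch.
set yf := (dot y e1, dot y e2) in kE; set nf := (dot (nu y) e1, dot (nu y) e2) in kE.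
have sumE : \sum_(ij : 'I_n * 'I_M) (if ij.1 == i then c ij.2 else 0) *
      neumann_kernel nu (graph_point e1 e2 g (ctr ij.1 + h * u ij.2)) y =
    pi^-1 * \sum_j c j * planar_kernel g yf nf (ctr i + h * u j).
  rewrite -(pair_bigA _ (fun i' j => (if i' == i then c j else 0) *
      neumann_kernel nu (graph_point e1 e2 g (ctr i' + h * u j)) y)) /=.
  rewrite (bigD1 i) //= [X in _ + X]big1 ?addr0 => [|i' /negPf ii]; last first.
    by apply: big1 => j _; rewrite ii mul0r.
  rewrite mulr_sumr; apply: eq_bigr => j _; rewrite eqxx kE; ring.
rewrite sumE -{1 2}xE kE -mulrBr !(normrM pi^-1) (ger0_norm ipi) -(mulrA pi^-1).
suff [F1 F2] : `|planar_kernel g yf nf s| <= C /\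
    `|planar_kernel g yf nf s - \sum_j c j * planar_kernel g yf nf (ctr i + h * u j)| <= C * h ^+ m.
  split; first exact: (ler_wpM2l ipi).
  by apply: (ler_wpM2l ipi); apply: le_trans F2 _; exact: (ler_wpM2l C0).
apply: hc; [exact: nuy.1|exact: nuy.2|].
have [By|nBy] := pselect (ball p r' y).
  right; have Uy : U y by exact: rU.
  have [_ _ nE _] := normal_unit (isT : (0 < m.+2)%N) ch Uy yb.
  have yE := boundary_graph_point oO ch Uy yb.
  split => //.
  - have yp : `|dot (y - p) e1| <= 2 * r'.
      apply: dot_component_le => //; move/ball_plane: By => [b1 b2] /=; rewrite distrC; exact: ltW.
    have : `|dot y e1| <= `|dot (y - p) e1| + `|s0|.
      by rewrite dotBl -{1}(subrK s0 (dot y e1)) ler_normD.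
    by rewrite /L /r; lra.
  - by have /(chart_boundary oO ch Uy) := yb.
  - by apply/eqP => /= e; apply: yx; rewrite -xE -yE e.
  - by move=> j; apply/eqP => /= e; apply: (yz (i, j)); rewrite /= -yE e.
left; have [y1 y2] := bY yb; split; [exact: dot_component_le|exact: dot_component_le|].
move=> t ht; have [c1 c2] := graph_point_coords ch t.
have /ball_plane[b1 b2] := rhoB t (pieceL _ _ ht).
rewrite /yf /= -{1}c1 -c2 -!dotBl expr2 [X in _ + X]expr2 -(dot_frame u11 u22 u12).
rewrite leNgt; apply/negP => dlt; apply: nBy; apply/ball_plane.
set v := graph_point e1 e2 g t - y in dlt.
have v2 : v.1 ^+ 2 + v.2 ^+ 2 < r ^+ 2 by rewrite !expr2.
have [w1 w2] := sqr_sum_component (ltW r0) (ltW v2).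
rewrite -[r'](@divfK _ 2) // -/r mulr_natr mulr2n; split.
  apply: le_lt_trans (ler_distD (graph_point e1 e2 g t).1 _ _) _; exact: ltr_leD.
apply: le_lt_trans (ler_distD (graph_point e1 e2 g t).2 _ _) _; exact: ltr_leD.
Qed.

End BoundaryInterpolation.

(** An equality of measures, so that a measure found to be finite can be replaced throughout by one
    carrying that structure. *)
Lemma finite_measureP (R : realType) d (T : measurableType d)
    (mu : {measure set T -> \bar R}) : (mu setT < +oo)%E ->
  exists nu : {finite_measure set T -> \bar R}, mu = nu :> {measure set T -> \bar R}.
Proof.
move=> h; have fin : fin_num_fun mu by exact: lty_fin_num_fun.
case: mu h fin => s c _ fin.
pose mu0 : {measure set T -> \bar R} := Measure.Pack c.
pose nu : {finite_measure set T -> \bar R} :=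
  HB.pack s c (Measure_isFinite.Build d T R mu0 fin).
by exists nu.
Qed.

(** * Finiteness of the line element and measurability of the normal *)

Section BoundaryMeasure.
Local Open Scope classical_set_scope.
Variables (R : realType) (k : nat) (Omega : set (R * R)) (nu : R * R -> R * R).
Variable ds : {measure set (R * R) -> \bar R}.
Hypothesis k0 : (0 < k)%N.
Hypothesis oO : open Omega.
Hypothesis bO : bounded_set Omega.
Hypothesis kO : Ck_boundary k Omega.
Hypothesis nuP : outer_unit_normal Omega nu.
Hypothesis dsP : line_element Omega ds.
Implicit Types (W : set (R * R)) (x y p : R * R).

Lemma measurable_boundary : measurable (boundary Omega).
Proof.
rewrite -[boundary Omega]setCK; apply: measurableC; apply: open_measurable_plane.
by rewrite openC; exact: boundary_closed.
Qed.

Lemma measurable_point y : measurable [set y].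
Proof.
rewrite (_ : [set y] = [set y.1] `*` [set y.2]); first by apply: measurableX.
by apply/seteqP; split => [x -> //|[a b] [/= -> ->]]; case: y.
Qed.

Lemma measurable_dot e : measurable_fun setT (fun y : R * R => dot y e).
Proof.
apply: measurable_funD; apply: measurable_funM => //.
Qed.

Lemma normal_unitP y : boundary Omega y -> dot (nu y) (nu y) = 1.
Proof.
move=> yb; have [U [e1 [e2 [g [Uy ch]]]]] := kO yb.
by have [] := nuP (graph_chart_le ch k0) Uy yb.
Qed.

(** On the boundary, a chart turns the measure of a point into an integral over a single parameter;
    off the boundary [ds] vanishes. *)
Lemma line_element_point y : ds [set y] = 0%E.
Proof.
have [yb|nyb] := pselect (boundary Omega y); last first.
  apply/eqP; rewrite eq_le measure_ge0 andbT -dsP.1; apply: le_measure.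
  - by rewrite inE; exact: measurable_point.
  - by rewrite inE; apply: measurableC; exact: measurable_boundary.
  - by move=> x ->.
have [U [e1 [e2 [g [Uy ch]]]]] := kO yb.
have := dsP.2 _ _ _ _ (graph_chart_le ch k0) _ (measurable_point y).
rewrite (_ : [set y] `&` boundary Omega = [set y]); last first.
  by apply/seteqP; split => [x [] //|x ->].
move=> -> //; last by move=> x ->.
have yE := boundary_graph_point oO ch Uy yb.
rewrite (_ : [set t | _] = [set dot y e1]) ?integral_set1 //.
apply/seteqP; split => t /=; last by move=> ->; exact: yE.
by move=> <-; have [] := graph_point_coords ch t.
Qed.

(** A form of the global regularity that is stable under unions, as [compact_local_ind] asks. *)
Definition locally_regular W : Prop := [/\ measurable W, (ds (W `&` boundary Omega) < +oo)%E,
  measurable_fun (W `&` boundary Omega) (fun y => (nu y).1) &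
  measurable_fun (W `&` boundary Omega) (fun y => (nu y).2)].

Lemma locally_regularU W1 W2 : locally_regular W1 -> locally_regular W2 ->
  locally_regular (W1 `|` W2).
Proof.
move=> [m1 d1 n1 n1'] [m2 d2 n2 n2'].
have mb := measurable_boundary.
split; first exact: measurableU.
- rewrite setIUl; apply: le_lt_trans (measureU2 _ _ _) _; [exact: measurableI..|].
  exact: lte_add_pinfty.
- by rewrite setIUl; apply/measurable_funU; [exact: measurableI..|].
- by rewrite setIUl; apply/measurable_funU; [exact: measurableI..|].
Qed.

(** On a ball inside the chart, [nu] is a continuous function of the parameter, expressed through
    [derive1 g]; [ds] is the integral of a bounded function over a bounded parameter set. *)
Lemma chart_regular p : boundary Omega p -> exists W, [/\ open W, W p & locally_regular W].
Proof.
move=> pb; have [U [e1 [e2 [g [Up ch]]]]] := kO pb.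
have [oU [u11 u22 u12] gk _] := ch.
have [r r0 rU] := open_ballP oU Up.
have oB : open (ball p r) by exact: ball_open.
have mB := open_measurable_plane oB.
have gk1 : Ck 1 g by exact: Ck_le gk.
have g'c : continuous (derive1 g) by case: gk1.
have mb := measurable_boundary.
have slope_c : continuous (fun t => Num.sqrt (1 + derive1 g t ^+ 2)).
  move=> t; apply: (@continuous_comp _ _ _ (fun t => 1 + derive1 g t ^+ 2) (@Num.sqrt R)).
    apply: (@cvgD R R); first exact: cvg_cst.
    by apply: (@continuous_comp _ _ _ (derive1 g) (fun u : R => u ^+ 2)); [exact: g'c|exact: exprn_continuous].
  exact: sqrt_continuous.
(* The inverse is written as a power of exponent [-1], to which [measurable_powR] applies. *)
pose n2 t : R := - (Num.sqrt (1 + derive1 g t ^+ 2) `^ (-1)).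
have mn2 : measurable_fun setT (fun y : R * R => n2 (dot y e1)).
  apply: measurableT_comp; last exact: measurable_dot.
  apply: measurableT_comp => //; apply: (measurableT_comp (measurable_powR _)).
  exact: continuous_measurable_fun.
have mn1 : measurable_fun setT (fun y : R * R => - n2 (dot y e1) * derive1 g (dot y e1)).
  apply: measurable_funM; first exact: measurableT_comp.
  apply: measurableT_comp; last exact: measurable_dot.
  exact: continuous_measurable_fun.
have nuE y : (ball p r `&` boundary Omega) y ->
    nu y = (- n2 (dot y e1) * derive1 g (dot y e1)) *: e1 + n2 (dot y e1) *: e2.
  move=> [yB yb]; have [_ _ h1 h2] := normal_unit nuP k0 ch (rU _ yB) yb.
  rewrite [LHS](frame_decomp u11 u22 u12) h1.
  have -> : dot (nu y) e2 = n2 (dot y e1); last by [].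
  by rewrite h2 /n2 powR_inv1 // sqrtr_ge0.
exists (ball p r); split; [by []|exact: ballxx|split => //].
- rewrite (dsP.2 _ _ _ _ (graph_chart_le ch k0) _ mB rU).
  set A := [set t | _].
  have AE : A = graph_point e1 e2 g @^-1` ball p r by [].
  have mA : measurable A.
    apply: open_measurable; rewrite AE; apply: open_comp => // t _.
    exact: continuous_graph_point ch _.
  pose L := `|dot p e1| + 2 * r.
  have AL : A `<=` `[- L, L]%classic.
    move=> t /ball_plane[b1 b2]; rewrite /= in_itv /= -ler_norml.
    have [c1 _] := graph_point_coords ch t.
    have : `|dot (graph_point e1 e2 g t - p) e1| <= 2 * r.
      by apply: dot_component_le => //; rewrite /= distrC; exact: ltW.
    rewrite dotBl c1 => h; have : `|t| <= `|t - dot p e1| + `|dot p e1|.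
      by rewrite -{1}(subrK (dot p e1) t) ler_normD.
    by rewrite /L; lra.
  have [C C0 hC] := continuous_bounded L slope_c.
  apply: (@le_lt_trans _ _ (\int[lebesgue_measure]_(t in A) (cst C%:E t))%E).
    apply: ge0_le_integral => //.
    + apply/measurable_EFinP; apply: measurable_funS (continuous_measurable_fun slope_c) => //.
    + move=> t At; rewrite lee_fin; apply: le_trans (ler_norm _) _; apply: hC.
      by have := AL t At; rewrite /= in_itv /= -ler_norml.
  rewrite integral_cst //; apply: lte_mul_pinfty; rewrite ?lee_fin //.
  apply: (@le_lt_trans _ _ (lebesgue_measure (`[- L, L]%classic : set R))).
    by apply: le_measure; rewrite ?inE //; exact: measurable_itv.
  by rewrite lebesgue_measure_itv /=; case: ifP => // _; rewrite -EFinD ltry.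
- apply: (eq_measurable_fun (fun y : R * R => (- n2 (dot y e1) * derive1 g (dot y e1)) * e1.1 + n2 (dot y e1) * e2.1)).
    by move=> y; rewrite inE => /nuE ->.
  apply: (measurable_funS measurableT) => //.
  by apply: measurable_funD; apply: measurable_funM.
- apply: (eq_measurable_fun (fun y : R * R => (- n2 (dot y e1) * derive1 g (dot y e1)) * e1.2 + n2 (dot y e1) * e2.2)).
    by move=> y; rewrite inE => /nuE ->.
  apply: (measurable_funS measurableT) => //.
  by apply: measurable_funD; apply: measurable_funM.
Qed.

Lemma boundary_regular : [/\ (ds setT < +oo)%E,
  measurable_fun (boundary Omega) (fun y => (nu y).1) &
  measurable_fun (boundary Omega) (fun y => (nu y).2)].
Proof.
have mb := measurable_boundary.
have [W bW [mW dW n1 n2]] : exists2 W, boundary Omega `<=` W & locally_regular W.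
  apply: compact_local_ind; first exact: boundary_compact.
  - split => //; rewrite set0I ?measure0 ?ltry //; exact: measurable_fun_set0.
  - exact: locally_regularU.
  - exact: chart_regular.
have WbE : W `&` boundary Omega = boundary Omega by rewrite setIC; apply/setIidPl.
rewrite WbE in dW n1 n2; split => //.
have : (ds setT <= ds (boundary Omega) + ds (~` boundary Omega))%E.
  by rewrite -(setUv (boundary Omega)); apply: measureU2 => //; exact: measurableC.
by move/le_lt_trans; apply; rewrite dsP.1 adde0.
Qed.

End BoundaryMeasure.

Section BoundaryKernel.
Local Open Scope classical_set_scope.
Variables (R : realType) (m : nat) (Omega : set (R * R)) (nu : R * R -> R * R).
Hypothesis oO : open Omega.
Hypothesis bO : bounded_set Omega.
Hypothesis kO : Ck_boundary m.+2 Omega.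
Hypothesis nuP : outer_unit_normal Omega nu.

Lemma boundary_interpolable : interpolable Omega nu m (boundary Omega).
Proof.
have [Y Y0 hY] := bounded_region_bound bO.
have [W bW [C [M [C0 hW]]]] : exists2 W, boundary Omega `<=` W & interpolable Omega nu m W.
  apply: compact_local_ind; first exact: boundary_compact.
  - exact: interpolable0.
  - by move=> A B; exact: interpolableU.
  - move=> p pb; have [U [e1 [e2 [g [Up ch]]]]] := kO pb.
    exact: (chart_interpolable oO nuP (normal_unitP (isT : (0 < m.+2)%N) kO nuP) hY ch Up pb).
exists C, M; split => // n n0; have [J [z [JM zb hz]]] := hW n n0.
by exists J, z; split => // x xb _; exact: hz (bW x xb) xb.
Qed.

End BoundaryKernel.

(** * Decay of the eigenvalues *)

Lemma half_le_sub n N : (N.*2 <= n)%N -> (n <= (n - N) * 2)%N.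
Proof. by lia. Qed.

Lemma pred_mul_le_sub n N q : (N * q <= n)%N -> (n * q.-1 <= (n - N) * q)%N.
Proof. by case: q => [|q] h; rewrite ?muln0 //= mulnBl mulnS; lia. Qed.

Section EigenvalueDecay.
Local Open Scope complex_scope.
Local Open Scope ring_scope.
Context {R : realType} {d : measure_display} {T : measurableType d}.
Variable mu : {finite_measure set T -> \bar R}.
Variables (D : set T) (kap : T -> T -> R) (B : R) (m : nat).
Hypothesis mD : measurable D.
Hypothesis D0 : mu (~` D) = 0%E.
Hypothesis mkap : measurable_fun setT (fun z : T * T => kap z.1 z.2).
Hypothesis B0 : 0 <= B.
Hypothesis kapB : forall x, D x -> {ae mu, forall y, `|kap x y| <= B}.
Hypothesis kapI : exists C M, 0 <= C /\
  forall n, (0 < n)%N -> exists (J : finType) (z : J -> T),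
  [/\ (#|J| <= M * n)%N, forall j, D (z j) &
   forall x, D x -> exists c : J -> R,
     {ae mu, forall y, `|kap x y - \sum_j c j * kap (z j) y| <= C * n%:R ^- m}].
Variable A : (T -> R[i]) -> T -> R[i].
Hypothesis bA : bounded_operator mu A.
Hypothesis Akap : forall f, L2 mu f -> sqnorm mu (A f) = sqnorm mu (kernel_op mu kap f).

(* At index n, the n/q constraints coming from the nodes of a subdivision into
   about n/(q(M+1)) pieces cost only a fraction 1/q of the decay exponent. *)
Lemma eigenvalue_power_bound (s : nat -> R[i]) (q : nat) : (1 < q)%N ->
  ordered_eigenvalues mu A s -> exists K n0, 0 <= K /\ forall n, (n0 <= n)%N ->
  Normc.normc (s n.-1) ^+ q <= K * (n%:R ^- m * (Num.sqrt n%:R)^-1) ^+ q.-1.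
Proof.
move=> q1 sA; have [C [M [C0 hM]]] := kapI.
pose mT : R := fine (mu setT); have mT0 : 0 <= mT by exact: fine_ge0.
(* The added units keep [E], and hence [theta] below, positive even if [C] or the total mass
   vanishes. *)
pose E := (C + 1) * (mT + 1).
have E0 : 0 < E by rewrite mulr_gt0 // ltr_wpDl.
pose Mop := Num.max 1 (B * mT).
have Mop1 : 1 <= Mop by rewrite le_max lexx.
pose M' := M.+1; pose w : R := (2 * q * M')%:R.
have w0 : 0 < w by rewrite ltr0n !muln_gt0 /= (ltnW q1).
(* Chosen so that [theta ^+ 2 * (n / 2)] equals [(E * (w / n) ^+ m) ^+ 2]; the factor [Num.sqrt 2]
   pays for [n - N >= n / 2]. *)
pose E' := E * w ^+ m * Num.sqrt 2.
have E'0 : 0 < E'.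
  by apply: mulr_gt0; [apply: mulr_gt0 => //; exact: exprn_gt0|rewrite sqrtr_gt0].
(* The first threshold makes the number of pieces positive, the second makes [theta <= 1]. *)
pose n0 := maxn (q * M') (Num.truncn (E' ^+ 2)).+1.
exists (Mop * E' ^+ q.-1), n0; split.
  by rewrite mulr_ge0 ?exprn_ge0 ?(ltW E'0) // (le_trans ler01).
move=> n; rewrite geq_max => /andP[nq nE].
have qM0 : (0 < q * M')%N by rewrite muln_gt0 (ltnW q1).
have n_gt0 : (0 < n)%N by exact: leq_trans nq.
have nR : 0 < n%:R :> R by rewrite ltr0n.
have n1R : 1 <= n%:R :> R by rewrite ler1n.
(* The number of pieces: at most [M * nu] nodes give [N * q <= n], while [n <= w * nu] keeps the
   pieces short enough. *)
pose nu := (n %/ (q * M'))%N.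
have nu0 : (0 < nu)%N by rewrite divn_gt0.
have nuR : 0 < nu%:R :> R by rewrite ltr0n.
have nuw : n%:R <= w * nu%:R.
  rewrite -natrM ler_nat; have := ltn_ceil n qM0; rewrite -/nu => h.
  apply: leq_trans (ltnW h) _; rewrite -(mulnA 2) (mulnC 2) -(mulnA _ 2) (mulnC (q * M')%N) leq_mul2r.
  by rewrite mul2n -addnn -addn1 leq_add2l nu0 orbT.
have [J [z [JM zD hz]]] := hM nu nu0.
pose N := #|J|.
have NqM : (N * q <= n)%N.
  have := leq_trunc_div n (q * M'); rewrite -/nu => h; apply: leq_trans h.
  apply: leq_trans (leq_mul JM (leqnn q)) _.
  by rewrite (mulnC M) -mulnA leq_mul2l (mulnC M) leq_mul2l leqnSn !orbT.
have Nn : (N.*2 <= n)%N by rewrite -muln2; apply: leq_trans NqM; rewrite leq_mul2l q1 orbT.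
pose theta : R := E' * (n%:R ^- m * (Num.sqrt n%:R)^-1).
have sn0 : 0 < Num.sqrt n%:R :> R by rewrite sqrtr_gt0.
have th0 : 0 < theta.
  by apply: mulr_gt0 => //; apply: mulr_gt0; rewrite invr_gt0 ?exprn_gt0.
have th1 : theta <= 1.
  have E'n : E' <= Num.sqrt n%:R.
    rewrite -(ger0_norm (ltW E'0)) -sqrtr_sqr ler_sqrt //.
    by apply: ltW; apply: lt_le_trans (truncnS_gt _) _; rewrite ler_nat.
  have nm1 : n%:R ^- m <= 1 :> R by rewrite invf_le1 ?exprn_gt0 // exprn_ege1.
  rewrite /theta mulrCA -[leRHS]mulr1 ler_pM ?invr_ge0 ?exprn_ge0 ?(ltW nR) //.
    by rewrite divr_ge0 ?(ltW E'0) // ltW.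
  by rewrite ler_pdivrMr // mul1r.
have th2 : theta ^+ 2 * (n - N)%:R >= (C * nu%:R ^- m * mT) ^+ 2.
  have nN : n%:R / 2 <= (n - N)%:R :> R.
    by rewrite ler_pdivrMr // -natrM ler_nat half_le_sub.
  apply: (@le_trans _ _ (theta ^+ 2 * (n%:R / 2))); last by rewrite ler_wpM2l // sqr_ge0.
  have -> : theta ^+ 2 * (n%:R / 2) = (E * (w / n%:R) ^+ m) ^+ 2.
    have b0 : n%:R ^+ m != 0 :> R by rewrite expf_neq0 ?gt_eqF.
    have sn2 : Num.sqrt n%:R ^+ 2 = n%:R :> R by rewrite sqr_sqrtr ?ler0n.
    have s22 : Num.sqrt 2 ^+ 2 = 2 :> R by rewrite sqr_sqrtr.
    rewrite /theta /E' expr_div_n; move: (w ^+ m) (n%:R ^+ m) b0 => a b b0.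
    transitivity ((E * (a / b)) ^+ 2 * (Num.sqrt 2 ^+ 2 / 2) * (n%:R / Num.sqrt n%:R ^+ 2)).
      by move: (Num.sqrt 2) => r; field; rewrite b0 gt_eqF.
    by rewrite s22 sn2 !divff ?mulr1 ?gt_eqF.
  have nm0 : 0 <= nu%:R ^- m :> R by rewrite invr_ge0 exprn_ge0 // ltW.
  have lhs0 : 0 <= C * nu%:R ^- m * mT by apply: mulr_ge0 => //; exact: mulr_ge0.
  have rhs : C * nu%:R ^- m * mT <= E * (w / n%:R) ^+ m.
    rewrite mulrAC; apply: ler_pM => //; first exact: mulr_ge0.
      by apply: ler_pM => //; rewrite lerDl.
    rewrite -exprVn; apply: lerXn2r; rewrite ?nnegrE ?invr_ge0 ?divr_ge0 ?(ltW nuR) ?(ltW w0) ?(ltW nR) //.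
    by rewrite ler_pdivlMr // ler_pdivrMl // mulrC.
  by apply: lerXn2r; rewrite ?nnegrE // (le_trans lhs0).
pose k (j : 'I_N) : T -> R[i] := fun y => (kap (z (enum_val j)) y)%:C.
have kL j : L2 mu (k j) by have [] := section_L2 mkap B0 kapB (zD (enum_val j)).
have main : Normc.normc (s n.-1) ^+ n <= Mop ^+ N * theta ^+ (n - N).
  apply: (eigenvalue_product_bound bA sA n_gt0 _ Mop1 th0 th1 kL).
    by apply: leq_trans Nn; rewrite -addnn leq_addr.
    move=> f fL; rewrite Akap //; have [_ h] := kernel_op_L2 mD D0 mkap B0 kapB fL.
    apply: le_trans h _; apply: ler_wpM2r; first exact: sqnorm_ge0.
    rewrite lerXn2r ?nnegrE ?mulr_ge0 ?(le_trans ler01 Mop1) //.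
    by rewrite le_max lexx orbT.
  move=> p u uL uo uk; apply: le_trans th2.
  rewrite (eq_bigr (fun i => sqnorm mu (kernel_op mu kap (u i)))) => [|i _]; last exact: Akap.
  apply: (@kernel_op_HS _ _ _ mu D kap B mD D0 mkap B0 kapB N (fun j => z (enum_val j))) => //.
    by rewrite mulr_ge0 ?invr_ge0 ?exprn_ge0.
  move=> x Dx; have [c hc] := hz x Dx; exists (fun j => c (enum_val j)).
  apply: filterS hc => y; rewrite (reindex (enum_val : 'I_N -> J)) //=.
  by exists enum_rank => j _; rewrite ?enum_valK ?enum_rankK.
rewrite -mulrA -exprMn -/theta.
have r0 : 0 <= Normc.normc (s n.-1).
  by rewrite -lecR -normcE normr_ge0.
have Mop0 : 0 <= Mop by exact: le_trans Mop1.
move/ltW in th0; clear th2; clearbody theta Mop.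
have rhs0 : 0 <= Mop * theta ^+ q.-1 by rewrite mulr_ge0 ?exprn_ge0.
have prod0 : 0 <= Mop ^+ N * theta ^+ (n - N) by rewrite mulr_ge0 ?exprn_ge0.
(* Comparing n-th powers avoids roots: [N * q <= n] bounds the power of [Mop] by [Mop ^+ n], and
   [(n - N) * q >= n * q.-1] that of [theta]. *)
rewrite -(@ler_pXn2r _ n) ?nnegrE ?exprn_ge0 // exprAC.
apply: (@le_trans _ _ ((Mop ^+ N * theta ^+ (n - N)) ^+ q)).
  by rewrite lerXn2r ?nnegrE ?exprn_ge0.
rewrite !exprMn -!exprM; apply: ler_pM; rewrite ?exprn_ge0 //.
  exact: ler_weXn2l.
by apply: ler_wiXn2l => //; rewrite mulnC; exact: pred_mul_le_sub.
Qed.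

End EigenvalueDecay.

(** * The double layer potential *)

Section PowerDecay.
Local Open Scope complex_scope.
Local Open Scope ring_scope.
Variable R : realType.

Lemma power_decay (x : nat -> R) (m : nat) (b : R) : (forall n, 0 <= x n) ->
  b < m%:R + 2^-1 ->
  (forall q, (1 < q)%N -> exists K n0, 0 <= K /\ forall n, (n0 <= n)%N ->
     x n ^+ q <= K * (n%:R ^- m * (Num.sqrt n%:R)^-1) ^+ q.-1) ->
  forall e, 0 < e -> exists n1, forall n, (n1 <= n)%N -> x n <= e * n%:R `^ (- b).
Proof.
move=> x0 bm xq e e0; set al : R := m%:R + 2^-1 in bm.
have al0 : 0 < al by rewrite ltr_wpDl // invr_gt0.
(* [q > al / (al - b)] is equivalent to [al * (q - 1) > b * q]; the surplus [ga] is a positive power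
   of [n] that absorbs [K / e ^+ q]. *)
pose q := (Num.truncn (al / (al - b))).+2.
have qgt : 0 < al * q.-1%:R - b * q%:R.
  have h : al / (al - b) < q%:R.
    by apply: lt_le_trans (truncnS_gt _) _; rewrite ler_nat.
  rewrite ltr_pdivrMr ?subr_gt0 // in h.
  have -> : q%:R = q.-1%:R + 1 :> R by rewrite natr1.
  by rewrite [q%:R](_ : _ = q.-1%:R + 1) ?natr1 // in h; lra.
set ga := al * _ - _ in qgt.
have [K [n0 [K0 hK]]] := xq q isT.
pose t0 := (K / e ^+ q) `^ ga^-1.
exists (maxn n0 (Num.truncn t0).+1) => n; rewrite geq_max => /andP[n0n t0n].
have n_gt0 : (0 < n)%N by exact: leq_trans t0n.
have nR : 0 < n%:R :> R by rewrite ltr0n.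
have nt : t0 <= n%:R by apply: ltW; apply: lt_le_trans (truncnS_gt _) _; rewrite ler_nat.
have eq0 : 0 < e ^+ q by exact: exprn_gt0.
have Kn : K <= e ^+ q * n%:R `^ ga.
  rewrite mulrC -ler_pdivrMr //.
  have <- : t0 `^ ga = K / e ^+ q.
    by rewrite /t0 -powRrM mulVf ?gt_eqF // powRr1 // divr_ge0 // ltW.
  by apply: ge0_ler_powR => //; rewrite ?nnegrE ?powR_ge0 ?(ltW qgt) ?ler0n.
have base : n%:R ^- m * (Num.sqrt n%:R)^-1 = n%:R `^ (- al) :> R.
  rewrite -powR12_sqrt ?ler0n // -powR_mulrn ?ler0n // -!powRN -powRD; last by rewrite (gt_eqF nR) implybT.
  by rewrite /al opprD.
have := hK n n0n; rewrite base => h.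
have : x n ^+ q <= (e * n%:R `^ (- b)) ^+ q.
  apply: le_trans h _; apply: le_trans (ler_wpM2r _ Kn) _; first by rewrite exprn_ge0 ?powR_ge0.
  rewrite exprMn -mulrA ler_wpM2l ?(ltW eq0) // -!powR_mulrn ?powR_ge0 // -!powRrM.
  rewrite -powRD; last by rewrite (gt_eqF nR) implybT.
  by rewrite /ga (_ : _ + _ = - b * q%:R) //; ring.
by rewrite ler_pXn2r // nnegrE ?mulr_ge0 ?powR_ge0 // ltW.
Qed.

End PowerDecay.

Section DoubleLayer.
Local Open Scope complex_scope.
Local Open Scope ring_scope.
Variables (R : realType) (m : nat) (Omega : set (R * R)) (nu : R * R -> (R * R)%type).
Variable mu : {finite_measure set (R * R)%type -> \bar R}.
Hypothesis oO : open Omega.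
Hypothesis bO : bounded_set Omega.
Hypothesis kO : Ck_boundary m.+2 Omega.
Hypothesis nuP : outer_unit_normal Omega nu.
Hypothesis muP : line_element Omega mu.
Let D := boundary Omega.

(* The values of nu off the boundary are arbitrary, hence cut off. *)
Definition boundary_normal (y : R * R) : (R * R)%type :=
  (((fun y => (nu y).1) \_ D) y, ((fun y => (nu y).2) \_ D) y).

Lemma boundary_normalE y : D y -> boundary_normal y = nu y.
Proof. by move=> yb; rewrite /boundary_normal !patchE mem_set // -surjective_pairing. Qed.

Let kap := neumann_kernel boundary_normal.

Lemma boundary_kernelE x y : D y -> kap x y = neumann_kernel nu x y.
Proof. by move=> yb; rewrite /kap /neumann_kernel boundary_normalE. Qed.

Lemma measurable_inv_ge0 d (T : measurableType d) (f : T -> R) : measurable_fun setT f ->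
  (forall x, 0 <= f x) -> measurable_fun setT (fun x => (f x)^-1).
Proof.
move=> mf f0; rewrite (_ : (fun x => _) = (fun x => f x `^ (-1))).
  exact: (measurableT_comp (measurable_powR _)).
by apply/funext => x; rewrite powR_inv1.
Qed.

Lemma measurable_boundary_kernel :
  measurable_fun setT (fun z : (R * R) * (R * R) => kap z.1 z.2).
Proof.
have mb : measurable D := @measurable_boundary R Omega.
have [_ n1 n2] := boundary_regular (isT : (0 < m.+2)%N) bO kO nuP muP.
have mn1 : measurable_fun setT (fun y => (boundary_normal y).1).
  by apply/(measurable_restrict _ mb measurableT); rewrite setTI.
have mn2 : measurable_fun setT (fun y => (boundary_normal y).2).
  by apply/(measurable_restrict _ mb measurableT); rewrite setTI.
have c11 : measurable_fun setT (fun z : (R * R) * (R * R) => z.1.1).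
  exact: (measurableT_comp measurable_fst measurable_fst).
have c12 : measurable_fun setT (fun z : (R * R) * (R * R) => z.1.2).
  exact: (measurableT_comp measurable_snd measurable_fst).
have c21 : measurable_fun setT (fun z : (R * R) * (R * R) => z.2.1).
  exact: (measurableT_comp measurable_fst measurable_snd).
have c22 : measurable_fun setT (fun z : (R * R) * (R * R) => z.2.2).
  exact: (measurableT_comp measurable_snd measurable_snd).
have d1 : measurable_fun setT (fun z : (R * R) * (R * R) => (z.1 - z.2).1).
  exact: measurable_funB.
have d2 : measurable_fun setT (fun z : (R * R) * (R * R) => (z.1 - z.2).2).
  exact: measurable_funB.
have p1 : measurable_fun setT (fun z : (R * R) * (R * R) => (boundary_normal z.2).1).
  exact: (measurableT_comp mn1 measurable_snd).
have p2 : measurable_fun setT (fun z : (R * R) * (R * R) => (boundary_normal z.2).2).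
  exact: (measurableT_comp mn2 measurable_snd).
apply: measurable_funM => //; apply: measurable_funM.
  by apply: measurable_funD; exact: measurable_funM.
apply: measurable_inv_ge0; first by apply: measurable_funD; exact: measurable_funM.
by move=> z; rewrite /dot -!expr2 addr_ge0 ?sqr_ge0.
Qed.

Lemma ae_boundary : {ae mu, forall y, D y}.
Proof.
by apply/negligibleP; [apply: measurableC; exact: measurable_boundary|exact: muP.1].
Qed.

Lemma ae_neq x : {ae mu, forall y, y <> x}.
Proof.
have := line_element_point (isT : (0 < m.+2)%N) oO kO muP x.
move/(negligibleP _ (measurable_point x)).2; apply: negligibleS => y /=.
by move=> /contrapT.
Qed.

(** The exceptional points [x] and [z j] are finitely many, hence null for the line element. *)
Lemma boundary_kernel_interpolation : exists C M, 0 <= C /\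
  forall n, (0 < n)%N -> exists (J : finType) (z : J -> R * R),
  [/\ (#|J| <= M * n)%N, forall j, D (z j) &
   forall x, D x -> {ae mu, forall y, `|kap x y| <= C} /\ exists c : J -> R,
     {ae mu, forall y, `|kap x y - \sum_j c j * kap (z j) y| <= C * n%:R ^- m}].
Proof.
have [C [M [C0 hM]]] := boundary_interpolable oO bO kO nuP.
exists C, M; split => // n n0; have [J [z [JM zD hz]]] := hM n n0.
exists J, z; split => // x xb; have [c hc] := hz x xb xb.
have ae_z : {ae mu, forall y, forall j, y <> z j} by apply: filter_forall => j; exact: ae_neq.
have H : {ae mu, forall y, `|kap x y| <= C /\
    `|kap x y - \sum_j c j * kap (z j) y| <= C * n%:R ^- m}.
  apply: filterS3 ae_boundary (ae_neq x) ae_z => y yb yx yz.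
  rewrite boundary_kernelE //; under eq_bigr do rewrite boundary_kernelE //.
  exact: hc.
by split; [|exists c]; apply: filterS H => y [].
Qed.

(** Equality holds at every [x], not merely almost everywhere, so the two operators can be exchanged
    as functions on [L2]. *)
Lemma double_layerE f x : L2 mu f -> double_layer Omega mu nu f x = kernel_op mu kap f x.
Proof.
move=> fL; have [f1 f2] := L2_measurable fL.
have mb : measurable D := @measurable_boundary R Omega.
have mk : measurable_fun setT (kap x) := measurable_section measurable_boundary_kernel x.
have int (h : R * R -> R) : measurable_fun setT h ->
    (\int[mu]_(y in D) (h y * 'D_(nu y) (log_kernel x) y) = \int[mu]_y (h y * kap x y))%R.
  move=> mh; rewrite Rintegral_mkcond.
  pose c := h x * 'D_(nu x) (log_kernel x) x.
  (* The original integrand with its possibly arbitrary value at [y = x] kept and the explicit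
     kernel elsewhere; this form shows that it is measurable. *)
  pose G y : R := if (y == x) then ((fun y => h y * 'D_(nu y) (log_kernel x) y) \_ D) x
                  else ((fun y => h y * kap x y) \_ D) y.
  have mG : measurable_fun setT G.
    apply: measurable_fun_ifT => //.
      apply: (measurable_fun_bool true).
      rewrite setTI (_ : _ @^-1` _ = [set x]); first exact: measurable_point.
      by apply/seteqP; split => y /= /eqP.
    apply/(measurable_restrict _ mb measurableT); rewrite setTI.
    by apply: measurable_funS (measurable_funM mh mk).
  rewrite (_ : (fun y => h y * 'D_(nu y) (log_kernel x) y) \_ D = G); last first.
    apply/funext => y; rewrite /G; case: eqP => [-> //|/eqP yx].
    rewrite !patchE; case: ifPn => // yD; rewrite derive_log_kernel 1?eq_sym //.
    by rewrite boundary_kernelE //; exact: set_mem yD.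
  apply: ae_eq_Rintegral => //; first exact: measurable_funM.
  apply: filterS2 ae_boundary (ae_neq x) => y yb /eqP yx.
  by rewrite /G (negPf yx) patchE mem_set.
apply/eqP; rewrite eq_complex; apply/andP; split; apply/eqP => /=.
- under eq_Rintegral do rewrite cReM /= mulr0 subr0.
  by under [RHS]eq_Rintegral do rewrite cReM /= mulr0 subr0; apply: int.
- under eq_Rintegral do rewrite cImM /= mulr0 add0r.
  by under [RHS]eq_Rintegral do rewrite cImM /= mulr0 add0r; apply: int.
Qed.

End DoubleLayer.

Section DoubleLayerSpectrum.
Local Open Scope complex_scope.
Local Open Scope ring_scope.
Variables (R : realType) (m : nat) (Omega : set (R * R)) (nu : R * R -> (R * R)%type).
Variable mu : {finite_measure set (R * R)%type -> \bar R}.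
Hypothesis oO : open Omega.
Hypothesis bO : bounded_set Omega.
Hypothesis kO : Ck_boundary m.+2 Omega.
Hypothesis nuP : outer_unit_normal Omega nu.
Hypothesis muP : line_element Omega mu.
Let kap := neumann_kernel (boundary_normal Omega nu).

Lemma boundary_kernel_bounded : exists2 B, 0 <= B &
  forall x, boundary Omega x -> {ae mu, forall y, `|kap x y| <= B}.
Proof.
have [C [M [C0 hM]]] := boundary_kernel_interpolation oO bO kO nuP muP.
by have [J [z [_ _ hz]]] := hM 1%N isT; exists C => // x /hz[].
Qed.

Lemma double_layer_bounded : bounded_operator mu (double_layer Omega mu nu).
Proof.
have [B B0 kapB] := boundary_kernel_bounded.
have mb := @measurable_boundary R Omega.
have mk := measurable_boundary_kernel bO kO nuP muP.
have [KL Kae Klin [M KM]] := kernel_op_bounded mb muP.1 mk B0 kapB.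
have E f : L2 mu f -> double_layer Omega mu nu f = kernel_op mu kap f.
  by move=> fL; apply/funext => x; exact: (double_layerE oO bO kO nuP muP x fL).
split.
- by move=> f fL; rewrite E //; exact: KL.
- by move=> f g fL gL fg; rewrite !E //; exact: Kae.
- by move=> c f g fL gL; rewrite !E //; [exact: Klin|exact: L2_lin].
- by exists M => f fL; rewrite E //; exact: KM.
Qed.

Lemma double_layer_spectral_decay (A : (R * R -> R[i]) -> R * R -> R[i]) (s : nat -> R[i]) (b : R) :
  bounded_operator mu A ->
  (forall f, L2 mu f -> sqnorm mu (A f) = sqnorm mu (double_layer Omega mu nu f)) ->
  ordered_eigenvalues mu A s -> b < m%:R + 2^-1 ->
  forall e, 0 < e -> exists n1, forall n, (n1 <= n)%N ->
    Normc.normc (s n.-1) <= e * n%:R `^ (- b).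
Proof.
move=> bA AK sA bm.
have [B B0 kapB] := boundary_kernel_bounded.
have mb := @measurable_boundary R Omega.
have mk := measurable_boundary_kernel bO kO nuP muP.
have [C [M [C0 hM]]] := boundary_kernel_interpolation oO bO kO nuP muP.
apply: power_decay bm _ => [n|q q1].
  by rewrite -lecR -normcE normr_ge0.
apply: (eigenvalue_power_bound mb muP.1 mk B0 kapB _ bA _ q1 sA).
  exists C, M; split => // n n0; have [J [z [JM zb hz]]] := hM n n0.
  by exists J, z; split => // x /hz[].
move=> f fL; rewrite (AK f fL) (_ : double_layer Omega mu nu f = kernel_op mu kap f) //.
by apply/funext => x; exact: (double_layerE oO bO kO nuP muP x fL).
Qed.

End DoubleLayerSpectrum.

(** The alternative accommodates two numberings. With [y n] the modulus of the n-th listed value,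
    singular values start at 1, so [x j] is [y j]; eigenvalues start at 0, so [x j] is [y j.+1]. The
    sign of [b] makes the bound at [j.+1] no worse than at [j]. *)
Lemma decay_littleo (R : realType) (x y : nat -> R) (a b : R) : 0 <= b -> - b <= a ->
  (forall e : R, 0 < e -> exists n1, forall n, (n1 <= n)%N -> y n <= e * n%:R `^ (- b)) ->
  (forall j, (0 < j)%N -> `|x j| <= y j \/ `|x j| <= y j.+1) ->
  x =o_\oo (fun j : nat => (j%:R : R) `^ a).
Proof.
move=> b0 ba hy xy; apply/esym/littleoE => e e0; have [n1 hn] := hy e e0.
exists (maxn n1 1) => // j; rewrite /= geq_max => /andP[n1j j0].
have j1 : 1 <= j%:R :> R by rewrite ler1n.
rewrite [X in _ <= _ * X]ger0_norm ?powR_ge0 //.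
have bound i : (j <= i)%N -> y i <= e * j%:R `^ a.
  move=> ji; apply: le_trans (hn i (leq_trans n1j ji)) _; rewrite ler_wpM2l ?(ltW e0) //.
  apply: (@le_trans _ _ (j%:R `^ (- b))); last exact: ler_powR.
  rewrite !powRN lef_pV2 ?posrE ?powR_gt0 ?ltr0n ?(leq_trans j0 ji) //.
  by apply: ge0_ler_powR; rewrite ?nnegrE ?ler0n // ler_nat.
by case: (xy j j0) => /le_trans; apply; apply: bound.
Qed.

Theorem theorem2p12 (R : realType) (k : nat) (Omega : set (R * R))
    (ds : {measure set (R * R) -> \bar R}) (nu : R * R -> R * R) (a : R) :
  (2 <= k)%N ->
  bounded_region Omega ->
  Ck_boundary k Omega ->
  line_element Omega ds ->
  outer_unit_normal Omega nu ->
  - 2 * k%:R + 3 < a ->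
  (forall alpha : nat -> R,
     ordered_singular_values ds (double_layer Omega ds nu)
       (fun j => alpha j.+1) ->
     alpha =o_\oo (fun j : nat => (j%:R : R) `^ (a / 2))) /\
  (forall lambda : nat -> R[i],
     ordered_eigenvalues ds (double_layer Omega ds nu) lambda ->
     (fun j => Normc.normc (lambda j))
       =o_\oo (fun j : nat => (j%:R : R) `^ (a / 2))).
Proof.
case: k => [|[|m]] // _ [_ oO _ bO] kO dsP nuP am.
have [mu E] := finite_measureP (let: And3 h _ _ := boundary_regular (isT : (0 < m.+2)%N) bO kO nuP dsP in h).
subst ds.
have normc0 (z : R[i]) : 0 <= Normc.normc z by rewrite -lecR -normcE normr_ge0.
(* The exponent of decay to be reached, raised to at least 1/4 so that it is nonnegative even when
   [a] is positive; 1/4 is below [m + 1/2] for every [m]. *)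
pose b := Num.max (- (a / 2)) 4^-1.
have bm : b < m%:R + 2^-1 :> R.
  rewrite gt_max; have m0 : 0 <= m%:R :> R by exact: ler0n.
  by move: am; rewrite -(addn2 m) natrD; lra.
have b0 : 0 <= b by rewrite le_max [X in _ || X]invr_ge0 ler0n orbT.
have ba : - b <= a / 2 by rewrite lerNl le_max lexx.
split => [alpha [al0 [B [S [adj sq sv]]]]|lambda lv].
  have dlb := double_layer_bounded oO bO kO nuP dsP.
  have Sb : bounded_operator mu S by case: sq.
  have SK f : L2 mu f -> sqnorm mu (S f) = sqnorm mu (double_layer Omega mu nu f).
    by move=> fL; exact: sqrt_operator_sqnorm dlb adj sq fL.
  have dec := double_layer_spectral_decay oO bO kO nuP dsP Sb SK sv bm.
  apply: (decay_littleo b0 ba dec) => j j0; left.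
  by rewrite prednK // -lecR -normcE normc_def /= expr0n /= addr0 sqrtr_sqr.
have dlb := double_layer_bounded oO bO kO nuP dsP.
have dec := double_layer_spectral_decay oO bO kO nuP dsP dlb (fun f _ => erefl) lv bm.
by apply: (decay_littleo b0 ba dec) => j j0; right; rewrite ger0_norm.
Qed.
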